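(* Consider the direct regime, in which the encoder observes the state $X$. Let $C_0=(B-I)\Sigma_X(B-I)^\top+\Sigma_V$, $\tilde W=W_e(B-I)+(B-I)^\top W_e+W_e$, and $D_e'=D_e-\mathrm{tr}(W_eC_0)$. Then the strategic rate--distortion function is $$R(D_e)=\min_{0\preceq K_X\preceq\Sigma_X}\left\{\frac12\log\frac{\det\Sigma_X}{\det K_X}\;:\;\mathrm{tr}(\tilde W K_X)\le D_e'\right\}.$$ For every feasible $K_X$, Gaussian test channels $U=X+Z$ (with $Z$ Gaussian and independent of $X$) achieve rate $\frac12\log\frac{\det\Sigma_X}{\det K_X}$ and induce $\Sigma_{X\mid U}=K_X$.
   Context: $B\in\mathbb R^{k\times k}$ is a known matrix; $X\sim\mathcal N(0,\Sigma_X)$ in $\mathbb R^k$ with $\Sigma_X\succ0$; $V\sim\mathcal N(0,\Sigma_V)$ in $\mathbb R^k$ is independent of $X$; $\Theta=BX+V$. $W_e\succ0$ and $W_d\succ0$ are symmetric $k\times k$ weight matrices. $(X_t,V_t)_{t\ge1}$ are i.i.d. copies of $(X,V)$ and $\Theta_t=BX_t+V_t$. $\preceq$ is the Loewner order on symmetric matrices; logarithms are natural and rates are in nats. Codes: for blocklength $n$ and rate $R$, the encoder is a map $f_n$ from the observed sequence (here $X^n=(X_1,\dots,X_n)$) to $\{1,\dots,\exp(nR)\}$, producing the message $M$. The decoder minimizes $\frac1n\sum_{t=1}^n\mathbb E[(X_t-\hat X_t)^\top W_d(X_t-\hat X_t)]$ over estimates $\hat X^n$ that are functions of $M$, so its best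 response is $\hat X^n=\mathbb E[X^n\mid M]$. The encoder's distortion under this best response is $D_e(f_n)=\frac1n\sum_{t=1}^n\mathbb E[(\Theta_t-\hat X_t)^\top W_e(\Theta_t-\hat X_t)]$. A level $D_e$ is achievable at rate $R$ if there is a sequence of encoders $\{f_n\}$ with $\limsup_{n\to\infty}D_e(f_n)\le D_e$. The strategic rate--distortion function is $R(D_e)=\inf\{R: D_e\text{ is achievable at rate }R\}$. For random $Y,U$, $\Sigma_{Y\mid U}=\mathbb E[(Y-\mathbb E[Y\mid U])(Y-\mathbb E[Y\mid U])^\top]$ is the average MMSE error covariance. The rate of the test channel is $I(X;U)$.
   Formalization: The test channel is U = Q(X+Z) with Q idempotent, and Q = I when K_X ≺ Σ_X; when Σ_X − K_X is singular (e.g. K_X = Σ_X), no finite-variance Z gives Σ_{X|U} = K_X with U = X+Z, so the directions of infinite noise are projected out. *)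

(* Defs.v *)
From HB Require Import structures.
From mathcomp Require Export all_boot all_order all_algebra.
From mathcomp Require Export all_classical all_reals all_analysis.
Export Order.TTheory GRing.Theory Num.Theory numFieldNormedType.Exports.

Global Set Implicit Arguments.
Global Unset Strict Implicit.
Global Unset Printing Implicit Defensive.

Local Open Scope classical_set_scope.
Local Open Scope ring_scope.

(* Random vectors are measurable maps into [k.-tuple R], which carries the
   product Borel sigma-algebra; [vec] turns their values into the column
   vectors on which matrices act. *)

Definition vec (R : realType) (k : nat) (x : k.-tuple R) : 'cV[R]_k :=
  \col_i tnth x i.

Definition quad (R : realType) (k : nat) (A : 'M[R]_k) (v : 'cV[R]_k) : R :=
  (v^T *m A *m v) 0 0.

Definition psd (R : realType) (k : nat) (A : 'M[R]_k) : Prop :=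
  A^T = A /\ forall v, 0 <= quad A v.

Definition posdef (R : realType) (k : nat) (A : 'M[R]_k) : Prop :=
  A^T = A /\ forall v, v != 0 -> 0 < quad A v.

Definition loewner_le (R : realType) (k : nat) (A B : 'M[R]_k) : Prop :=
  psd (B - A).

Definition loewner_lt (R : realType) (k : nat) (A B : 'M[R]_k) : Prop :=
  posdef (B - A).

(* The variance-[v] law N(0, v).  The library's [normal_prob 0 0] is not the
   point mass at 0 (it is the uniform law on [0, 1]), hence the case split. *)
Definition centered_normal (R : realType) (v : R) : set R -> \bar R :=
  if v == 0 then dirac (0 : R) else normal_prob 0 (Num.sqrt v).

(* X ~ N(0, S), with S possibly singular: every linear form a^T X is
   N(0, a^T S a). *)
Definition gaussian (d : measure_display) (T : measurableType d)
    (R : realType) (P : probability T R) (k : nat)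
    (X : {RV P >-> k.-tuple R}) (S : 'M[R]_k) : Prop :=
  psd S /\
  forall (a : 'cV[R]_k) (A : set R), measurable A ->
    P [set w | A ((a^T *m vec (X w)) 0 0)] = centered_normal (quad S a) A.

Definition independent2 (d : measure_display) (T : measurableType d)
    (R : realType) (P : probability T R)
    (d1 d2 : measure_display) (T1 : measurableType d1) (T2 : measurableType d2)
    (X : T -> T1) (Y : T -> T2) : Prop :=
  forall (A : set T1) (B : set T2), measurable A -> measurable B ->
    P (X @^-1` A `&` Y @^-1` B) = (P (X @^-1` A) * P (Y @^-1` B))%E.

Definition independent_seq (d : measure_display) (T : measurableType d)
    (R : realType) (P : probability T R)
    (d1 : measure_display) (T1 : measurableType d1) (Y : nat -> T -> T1)
    : Prop :=
  forall (s : seq nat) (A : nat -> set T1), uniq s ->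
    (forall t, measurable (A t)) ->
    P (\bigcap_(t in [set` s]) (Y t @^-1` A t)) =
    (\prod_(t <- s) P (Y t @^-1` A t))%E.

Section mutual_information.
Context (d d1 d2 : measure_display) (T : measurableType d)
  (T1 : measurableType d1) (T2 : measurableType d2) (R : realType)
  (P : probability T R).

Definition pair_RV (X : {RV P >-> T1}) (Y : {RV P >-> T2}) : T -> T1 * T2 :=
  fun w => (X w, Y w).

Lemma measurable_pair_RV X Y : measurable_fun setT (pair_RV X Y).
Proof. by apply: measurable_fun_pair; exact: measurable_funPT. Qed.

HB.instance Definition _ X Y :=
  isMeasurableFun.Build _ _ _ _ (pair_RV X Y) (measurable_pair_RV X Y).

End mutual_information.

Definition relative_entropy (d : measure_display) (T : measurableType d)
    (R : realType) (mu nu : probability T R) : \bar R :=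
  if `[< mu `<< nu >]
  then (\int[mu]_x
          lne (Radon_Nikodym (charge_of_finite_measure mu) nu x))%E
  else +oo%E.

Definition mutual_info (d d1 d2 : measure_display) (T : measurableType d)
    (T1 : measurableType d1) (T2 : measurableType d2)
    (R : realType) (P : probability T R)
    (X : {RV P >-> T1}) (Y : {RV P >-> T2}) : \bar R :=
  relative_entropy (distribution P (pair_RV X Y))
    (distribution P X \x distribution P Y)%E.

(* Z is a version of E[Y | U]. *)
Definition is_cond_exp (d d' : measure_display) (T : measurableType d)
    (T' : measurableType d') (R : realType) (P : probability T R)
    (Y : T -> R) (U : T -> T') (Z : T -> R) : Prop :=
  [/\ forall B, measurable B -> g_sigma_algebra_preimage U (Z @^-1` B),
      P.-integrable setT (EFin \o Z) &
      forall A, g_sigma_algebra_preimage U A ->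
        (\int[P]_(w in A) (Z w)%:E = \int[P]_(w in A) (Y w)%:E)%E].

Definition cond_exp (d d' : measure_display) (T : measurableType d)
    (T' : measurableType d') (R : realType) (P : probability T R)
    (Y : T -> R) (U : T -> T') : T -> R :=
  xget (cst 0) [set Z | is_cond_exp P Y U Z].

(* Sigma_{Y | U} = E[(Y - E[Y | U]) (Y - E[Y | U])^T]. *)
Definition mmse_cov (d d' : measure_display) (T : measurableType d)
    (T' : measurableType d') (R : realType) (P : probability T R) (k : nat)
    (Y : {RV P >-> k.-tuple R}) (U : T -> T') : 'M[R]_k :=
  let err (i : 'I_k) (w : T) :=
    tnth (Y w) i - cond_exp P (fun w' => tnth (Y w') i) U w in
  \matrix_(i, j) fine 'E_P[fun w => err i w * err j w].

Section codes.
Context (d : measure_display) (T : measurableType d) (R : realType)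
  (P : probability T R) (k : nat) (X V : nat -> {RV P >-> k.-tuple R}).

Definition state_block (n : nat) (w : T) : n.-tuple (k.-tuple R) :=
  [tuple X t w | t < n].

(* (1/n) sum_t E[(S_t - hat S_t)^T W (S_t - hat S_t)] *)
Definition block_distortion (W : 'M[R]_k) (n : nat)
    (S Shat : 'I_n -> T -> 'cV[R]_k) : \bar R :=
  ((n%:R^-1)%:E *
   \sum_(t < n) 'E_P[fun w => quad W (S t w - Shat t w)])%E.

(* The message set {1, ..., exp(n r)} consists of the integers m with
   1 <= m <= exp(n r); it is empty when n > 0 and r < 0. *)
Definition is_encoder (r : R) (n : nat) (f : n.-tuple (k.-tuple R) -> nat)
    : Prop :=
  measurable_fun setT f /\
  forall x, (1 <= f x)%N /\ (f x)%:R <= expR (n%:R * r).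

Definition estimate (n : nat) (f : n.-tuple (k.-tuple R) -> nat)
    (g : nat -> 'I_n -> 'cV[R]_k) (t : 'I_n) (w : T) : 'cV[R]_k :=
  g (f (state_block n w)) t.

Definition decoder_distortion (Wd : 'M[R]_k) (n : nat)
    (f : n.-tuple (k.-tuple R) -> nat) (g : nat -> 'I_n -> 'cV[R]_k) :=
  block_distortion Wd (fun (t : 'I_n) w => vec (X t w)) (estimate f g).

Definition encoder_distortion (B We : 'M[R]_k) (n : nat)
    (f : n.-tuple (k.-tuple R) -> nat) (g : nat -> 'I_n -> 'cV[R]_k) :=
  block_distortion We (fun (t : 'I_n) w => B *m vec (X t w) + vec (V t w))
    (estimate f g).

(* For Wd positive definite such a g exists and the resulting estimate is
   almost surely E[X^n | M], so the encoder's distortion under the best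
   response does not depend on the choice of g. *)
Definition best_response (Wd : 'M[R]_k) (n : nat)
    (f : n.-tuple (k.-tuple R) -> nat) (g : nat -> 'I_n -> 'cV[R]_k) : Prop :=
  forall g', (decoder_distortion Wd f g <= decoder_distortion Wd f g')%E.

Definition achievable (B We Wd : 'M[R]_k) (De r : R) : Prop :=
  exists (f : forall n, n.-tuple (k.-tuple R) -> nat)
         (g : forall n, nat -> 'I_n -> 'cV[R]_k),
    (forall n, is_encoder r (f n) /\ best_response Wd (f n) (g n)) /\
    (limn_esup (fun n => encoder_distortion B We (f n) (g n)) <= De%:E)%E.

Definition strategic_rd (B We Wd : 'M[R]_k) (De : R) : \bar R :=
  ereal_inf [set r%:E | r in [set r | achievable B We Wd De r]].

End codes.

(* (1/2) log (det S / det K) for positive semidefinite K and positive definite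
   S, equal to +oo when K is singular ([ln] is total, with ln 0 = 0). *)
Definition gaussian_rate (R : realType) (k : nat) (S K : 'M[R]_k) : \bar R :=
  if \det K == 0 then +oo%E else (2^-1 * ln (\det S / \det K))%:E.

(* The constraint set of the optimization problem; [loewner_le 0 K] also makes
   K symmetric. *)
Definition feasible (R : realType) (k : nat)
    (B SX SV We : 'M[R]_k) (De : R) : set 'M[R]_k :=
  let C0 := (B - 1%:M) *m SX *m (B - 1%:M)^T + SV in
  let Wt := We *m (B - 1%:M) + (B - 1%:M)^T *m We + We in
  let De' := De - \tr (We *m C0) in
  [set K | [/\ loewner_le 0 K, loewner_le K SX & \tr (Wt *m K) <= De']].

(* Main.v *)
From HB Require Import structures.
Require Import Defs.
From mathcomp Require Import complex ring lra measurable_realfun.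

(** A best response is the conditional mean on each cell of the encoder, so its
    error is orthogonal to its output and the encoder's distortion is
    [tr (We C0) + tr (Wt K)], where [K] is the average over the block of the
    error covariances of the decoder, and [0 <= K <= SX].  By the converse,
    a code of rate [r] has [r >= 1/2 ln (det SX / det Psi) + (k - tr (Psi^-1 K)) / 2]
    for all positive definite [Psi]: the likelihood ratio of N(estimate, Psi) to
    N(0, SX) is at most the sum of the ratios over all messages, and each ratio
    has expectation 1.  These constraints on [K] are closed, and letting [Psi]
    tend to [K] turns them into [gaussian_rate SX K <= r].

    For achievability, [SX = Q Q^T] and [K = Q diag(l) Q^T] reduce to independent
    standard normal coordinates.  A random codebook covers all but a small
    fraction of the source blocks within [K^-1]-weighted distortion [k + o(1)];
    a Chernoff bound under the test channel replaces typicality.  This bounds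
    [tr (K^-1 K')] for the error covariance [K'] of the code, not [tr (Wt K')],
    but by the converse a code with near-optimal rate and [K^-1]-weighted
    distortion must have [K'] close to [K].

    The mutual information of the test channel is computed from the explicit
    density of the joint law, and the MMSE matrix from the fact that the
    normalized estimation error and the channel output are a rotation of
    [(X, Z)], hence independent. *)

Local Open Scope classical_set_scope.
Local Open Scope ring_scope.

(** * Simultaneous diagonalization by congruence *)

(** Two obstacles shape the argument. First, [Wt] is symmetric but may be indefinite: passing from
    codewords to conditional means lowers the cost for every positive semidefinite weight, in
    particular for [K^-1], yet it may raise tr (Wt K'). Hence the covering only bounds the
    [K^-1]-weighted cost, and the control of K' in all directions has to come from the converse.
    Second, the rate is +oo at singular matrices, which is awkward for limits. The converse is
    therefore kept as a family of inequalities indexed by [Psi], each affine in the error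
    covariance: this form survives averaging over the block and entrywise limits, and it is used
    once more to show that the minimum is attained. Gaussian vectors are given through the laws of
    their linear forms. The joint independence of whitened coordinates, on which all explicit
    densities rest, has to be recovered from cosine integrals; the normal law enters there through
    the multiplicativity of [std_cos] in the variance. *)

Lemma trmx11 (R : realType) (A : 'M[R]_1) : A^T = A.
Proof. by apply/matrixP => i j; rewrite mxE !ord1. Qed.

Lemma posdef_unitmx (R : realType) k (S : 'M[R]_k) : posdef S -> S \in unitmx.
Proof.
move=> [_ Sp]; rewrite -row_free_unit -kermx_eq0; apply/negPn/negP => /rowV0Pn.
move=> [v /sub_kermxP vS v0]; have := Sp v^T.
by rewrite /quad trmxK vS mul0mx mxE ltxx trmx_eq0 v0 => /(_ isT).
Qed.

Lemma psd0 (R : realType) k : psd (0 : 'M[R]_k).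
Proof. by split; rewrite ?trmx0// => v; rewrite /quad mulmx0 mul0mx mxE. Qed.

Lemma posdef_psd (R : realType) k (S : 'M[R]_k) : posdef S -> psd S.
Proof.
move=> [St Sp]; split=> // v; have [->|v0] := eqVneq v 0; last exact/ltW/Sp.
by rewrite /quad mulmx0 mxE.
Qed.

(** The spectral theorem by way of the complex numbers: K S^-1 has a complex left eigenvector x + iy
    with eigenvalue a + ib. As [K] and [S] are symmetric, comparing x K y^T with y K x^T gives b (x
    S x^T + y S y^T) = 0. The second factor is positive, so b = 0, and whichever of x, y is nonzero
    is a real eigenvector. *)
Lemma generalized_eigenvector (R : realType) k (S K : 'M[R]_k) : (0 < k)%N ->
  posdef S -> K^T = K -> exists l (v : 'cV[R]_k), v != 0 /\ K *m v = l *: (S *m v).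
Proof.
move=> k0 Sp Kt; have Su := posdef_unitmx Sp; have [St SP] := Sp.
set A := K *m invmx S.
have [[a b] /eigenvalueP [v vA v0]] :=
  eigenvalue_closed (map_mx (real_complex R) A) k0.
pose x := map_mx (@Re R) v; pose y := map_mx (@Im R) v.
have ReD : {morph @Re R : u w / u + w >-> u + w} by case=> ? ? [].
have ImD : {morph @Im R : u w / u + w >-> u + w} by case=> ? ? [].
have xA : x *m A = a *: x - b *: y.
  apply/matrixP => i j; move/matrixP: vA => /(_ i j); rewrite !mxE => /(congr1 (@Re R)).
  rewrite (big_morph _ ReD (erefl _)) => e.
  transitivity (Re ((a +i* b)%C * v i j)); last by case: (v i j).
  rewrite -e; apply: eq_bigr => l _; rewrite !mxE; case: (v i l) => ? ? /=.
  by rewrite mulr0 subr0.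
have yA : y *m A = b *: x + a *: y.
  apply/matrixP => i j; move/matrixP: vA => /(_ i j); rewrite !mxE => /(congr1 (@Im R)).
  rewrite (big_morph _ ImD (erefl _)) => e.
  transitivity (Im ((a +i* b)%C * v i j)); last by case: (v i j) => ? ? /=; rewrite addrC.
  rewrite -e; apply: eq_bigr => l _; rewrite !mxE; case: (v i l) => ? ? /=.
  by rewrite mulr0 add0r.
have AS : A *m S = K by rewrite mulmxKV.
have xK : x *m K = a *: (x *m S) - b *: (y *m S).
  by rewrite -AS mulmxA xA mulmxBl -!scalemxAl.
have yK : y *m K = b *: (x *m S) + a *: (y *m S).
  by rewrite -AS mulmxA yA mulmxDl -!scalemxAl.
have sK : x *m K *m y^T = y *m K *m x^T.
  by rewrite -[RHS]trmx11 !trmx_mul trmxK Kt mulmxA.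
have sS : x *m S *m y^T = y *m S *m x^T.
  by rewrite -[RHS]trmx11 !trmx_mul trmxK St mulmxA.
have xy : (x != 0) || (y != 0).
  apply: contraNT v0; rewrite negb_or !negbK => /andP[/eqP x0 /eqP y0].
  apply/eqP/matrixP => i j; move/matrixP: x0 => /(_ i j); move/matrixP: y0 => /(_ i j).
  by rewrite !mxE; case: (v i j) => p q /= -> ->.
have q0 : 0 < quad S x^T + quad S y^T.
  have qx := (posdef_psd Sp).2 x^T; have qy := (posdef_psd Sp).2 y^T.
  case/orP: xy => h; first by rewrite ltr_pwDl// SP// trmx_eq0.
  by rewrite ltr_wpDl// SP// trmx_eq0.
have b0 : b = 0.
  move: sK; rewrite xK yK !(mulmxBl, mulmxDl) -!scalemxAl sS => /matrixP /(_ 0 0).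
  move: q0; rewrite /quad !trmxK !mxE.
  set p := \sum_j (x *m S) 0 j * x^T j 0; set q := \sum_j (y *m S) 0 j * x^T j 0; set r := \sum_j (y *m S) 0 j * y^T j 0.
  move=> q0 e; have : b * (p + r) = 0 by move: e; lra.
  by move/eqP; rewrite mulf_eq0 (gt_eqF q0) orbF => /eqP.
case/orP: xy => h; exists a.
  exists x^T; rewrite trmx_eq0; split=> //; apply: trmx_inj.
  by rewrite !linearZ/= !trmx_mul !trmxK Kt St xK b0 scale0r subr0.
exists y^T; rewrite trmx_eq0; split=> //; apply: trmx_inj.
by rewrite !linearZ/= !trmx_mul !trmxK Kt St yK b0 scale0r add0r.
Qed.

Lemma posdef_congr (R : realType) m k (S : 'M[R]_k) (C : 'M[R]_(k, m)) :
  posdef S -> (forall v : 'cV[R]_m, C *m v = 0 -> v = 0) -> posdef (C^T *m S *m C).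
Proof.
move=> [St Sp] C0; split; first by rewrite !trmx_mul trmxK St mulmxA.
move=> v v0; have := Sp (C *m v); rewrite /quad trmx_mul !mulmxA; apply.
by apply: contraNneq v0 => /C0 ->.
Qed.

(** Induction on the dimension. Since K v is a multiple of S v, a vector that is [S]-orthogonal to
    [v] is also [K]-orthogonal to it; both forms are thus block diagonal in a basis made of the
    normalized [v] and an [S]-orthogonal complement [C], and the induction hypothesis applies to
    their restrictions to [C]. *)
Lemma simultaneous_diagonalization (R : realType) k (S K : 'M[R]_k) :
  posdef S -> K^T = K ->
  exists (P : 'M[R]_k) (l : 'rV[R]_k),
    [/\ P \in unitmx, S = P *m P^T & K = P *m diag_mx l *m P^T].
Proof.
elim: k S K => [|k IH] S K Sp Kt.
  exists 1%:M, 0; split; [exact: unitmx1| |];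
    by apply/matrixP => -[].
have [l [v [v0 Kv]]] := generalized_eigenvector (ltn0Sn k) Sp Kt.
have [St SP] := Sp.
pose s := quad S v; have s0 : 0 < s by exact: SP.
(* a basis whose first vector is proportional to v *)
have [Q0 Q0u [c c0 Q0v]] : exists2 Q0 : 'M[R]_(1 + k), Q0 \in unitmx &
    exists2 c, c != 0 & Q0 *m col_mx (c%:M : 'M[R]_1) 0 = v.
  exists (col_ebase v); first exact: col_ebase_unit.
  have rv : \rank v = 1%N.
    by apply/eqP; rewrite eqn_leq rank_leq_col lt0n mxrank_eq0 v0.
  exists (row_ebase v 0 0).
    have := row_ebase_unit v; rewrite unitmxE det_mx11 unitfE; exact.
  rewrite -[RHS]mulmx_ebase rv -mulmxA; congr (_ *m _).
  rewrite [row_ebase v]mx11_scalar mul_mx_scalar.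
  apply/matrixP => i j; rewrite !mxE; case: splitP => i' ->; rewrite !ord1 !mxE/=.
    by rewrite mulr1n mulr1.
  by rewrite mulr0.
pose r : 'rV[R]_k := rsubmx (v^T *m S *m Q0 : 'M[R]_(1, 1 + k)).
(* the remaining vectors, made S-orthogonal to v *)
pose C : 'M[R]_(1 + k, k) := Q0 *m col_mx 0 1%:M - s^-1 *: (v *m r).
have vSC : v^T *m S *m C = 0.
  rewrite /C mulmxBr mulmxA -[_ *m Q0]hsubmxK mul_row_col mulmx0 add0r mulmx1 -/r.
  rewrite -scalemxAr mulmxA [v^T *m S *m v]mx11_scalar -/(quad S v) -/s mul_scalar_mx.
  by rewrite scalerA mulVf ?gt_eqF// scale1r subrr.
pose Q : 'M[R]_(1 + k) := row_mx ((Num.sqrt s)^-1 *: v) C.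
have Qinj (w : 'cV[R]_(1 + k)) : Q *m w = 0 -> w = 0.
  rewrite -[w]vsubmxK mul_row_col -scalemxAl => e.
  have : v^T *m S *m ((Num.sqrt s)^-1 *: (v *m usubmx w) + C *m dsubmx w) = 0.
    by rewrite e mulmx0.
  rewrite mulmxDr (mulmxA _ C) vSC mul0mx addr0 -scalemxAr mulmxA.
  rewrite [v^T *m S *m v]mx11_scalar -/(quad S v) -/s mul_scalar_mx scalerA => /eqP.
  rewrite scaler_eq0 mulf_eq0 invr_eq0 sqrtr_eq0 leNgt s0/= gt_eqF//= => /eqP u0.
  move: e; rewrite u0 mulmx0 scaler0 add0r.
  have -> : C = Q0 *m (col_mx 0 1%:M - s^-1 *: (col_mx (c%:M : 'M[R]_1) 0 *m r)).
    by rewrite /C -{1}Q0v mulmxBr -scalemxAr mulmxA.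
  rewrite -mulmxA => /(congr1 (mulmx (invmx Q0))); rewrite mulKmx// mulmx0.
  rewrite mul_col_mx mul0mx scale_col_mx scaler0 opp_col_mx add_col_mx oppr0 addr0 mul_col_mx mul1mx.
  by move/(congr1 dsubmx); rewrite col_mxKd linear0 => ->; rewrite col_mx0.
have Qu : Q \in unitmx.
  rewrite -unitmx_tr -row_free_unit -kermx_eq0; apply/negPn/negP => /rowV0Pn.
  move=> [w /sub_kermxP wQ w0]; have := Qinj w^T; rewrite -(trmxK (Q *m w^T)) trmx_mul trmxK.
  by rewrite wQ trmx0 => /(_ erefl) /eqP; rewrite trmx_eq0 (negbTE w0).
have Sp' : posdef (C^T *m S *m C).
  apply: posdef_congr => // w Cw; have := Qinj (col_mx 0 w).
  rewrite mul_row_col mulmx0 add0r => /(_ Cw) /(congr1 dsubmx).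
  by rewrite col_mxKd linear0.
have Kt' : (C^T *m K *m C)^T = C^T *m K *m C by rewrite !trmx_mul trmxK Kt mulmxA.
have [P' [l' [P'u SP' KP']]] := IH _ _ Sp' Kt'.
have CSv : C^T *m S *m v = 0.
  by apply: trmx_inj; rewrite !trmx_mul trmxK St mulmxA vSC trmx0.
have vSv : v^T *m S *m v = s%:M by rewrite [LHS]mx11_scalar.
have vKC : v^T *m K *m C = 0.
  have -> : v^T *m K = l *: (v^T *m S).
    by apply: trmx_inj; rewrite linearZ/= !trmx_mul Kt St trmxK.
  by rewrite -scalemxAl vSC scaler0.
have CKv : C^T *m K *m v = 0 by rewrite -mulmxA Kv -scalemxAr mulmxA CSv scaler0.
have vKv : v^T *m K *m v = (l * s)%:M by rewrite -mulmxA Kv -scalemxAr mulmxA vSv scale_scalar_mx.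
have ss : (Num.sqrt s)^-1 * ((Num.sqrt s)^-1 * s) = 1.
  rewrite mulrA -invfM -expr2 sqr_sqrtr ?ltW// mulVf// gt_eqF//.
have trZ a : (a *: v)^T = a *: v^T by apply/matrixP => i j; rewrite !mxE.
have QSQ : Q^T *m S *m Q = block_mx 1%:M 0 0 (P' *m P'^T).
  rewrite /Q tr_row_mx mul_col_mx mul_col_row -SP' trZ -!scalemxAl -!scalemxAr.
  by rewrite vSC CSv vSv !scaler0 !scale_scalar_mx ss.
have QKQ : Q^T *m K *m Q = block_mx l%:M 0 0 (P' *m diag_mx l' *m P'^T).
  rewrite /Q tr_row_mx mul_col_mx mul_col_row -KP' trZ -!scalemxAl -!scalemxAr.
  by rewrite vKC CKv vKv !scaler0 !scale_scalar_mx !(mulrCA _ l) ss mulr1.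
pose B : 'M[R]_(1 + k) := block_mx 1%:M 0 0 P'.
have Bt : B^T = block_mx 1%:M 0 0 P'^T by rewrite tr_block_mx trmx1 !trmx0.
have back M N : Q^T *m M *m Q = N -> M = invmx Q^T *m N *m invmx Q.
  by move=> <-; rewrite -!mulmxA mulmxV// mulmx1 mulKmx// unitmx_tr.
have BB : B *m (block_mx 1%:M 0 0 P'^T : 'M[R]_(1 + k)) = block_mx 1%:M 0 0 (P' *m P'^T).
  by rewrite /B mulmx_block !(mulmx0, mul0mx, addr0, add0r, mulmx1).
have BDB : B *m diag_mx (row_mx (l%:M : 'M[R]_1) l') *m (block_mx 1%:M 0 0 P'^T : 'M[R]_(1 + k)) =
    block_mx l%:M 0 0 (P' *m diag_mx l' *m P'^T).
  rewrite diag_mx_row mulmx_block !(mulmx0, mul0mx, addr0, add0r, mul1mx, mulmx1).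
  rewrite mulmx_block !(mulmx0, mul0mx, addr0, add0r, mul1mx, mulmx1).
  by congr block_mx; apply/matrixP => i j; rewrite !ord1 !mxE eqxx.
exists (invmx Q^T *m B), (row_mx (l%:M : 'M[R]_1) l'); split.
- rewrite unitmx_mul unitmx_inv unitmx_tr Qu/= unitmxE.
  have -> : \det B = \det P' by rewrite (det_lblock (1%:M : 'M[R]_1)) det1 mul1r.
  by rewrite -unitmxE.
- rewrite (back _ _ QSQ) trmx_mul Bt trmx_inv trmxK -!mulmxA; congr (_ *m _).
  by rewrite !mulmxA; congr (_ *m _); rewrite -BB.
- rewrite (back _ _ QKQ) trmx_mul Bt trmx_inv trmxK -!mulmxA; congr (_ *m _).
  by rewrite !mulmxA; congr (_ *m _); rewrite -BDB.
Qed.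

(** * One-dimensional normal integrals *)

Section integral_of_density.
Local Open Scope ereal_scope.
Import HBNNSimple.

(** One change of measure formula for three uses: [U] the identity when a law has a density, [h]
    constant for the law of a random variable, and [h] the product of the remaining factors when
    coordinates are integrated one at a time. *)
Lemma ge0_integral_density d d' (T : measurableType d) (T' : measurableType d')
    (R : realType) (mu : {measure set T -> \bar R}) (nu : {measure set T' -> \bar R})
    (U : T -> T') (h : T -> R) (F : T' -> \bar R) :
  measurable_fun setT U -> measurable_fun setT h -> (forall w, (0 <= h w)%R) ->
  (forall A, measurable A -> nu A = \int[mu]_(w in U @^-1` A) (h w)%:E) ->
  measurable_fun setT F -> (forall y, 0 <= F y) ->
  \int[nu]_y F y = \int[mu]_w (F (U w) * (h w)%:E).
Proof.
move=> mU mh h0 nuE mF F0.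
pose f_ := nnsfun_approx measurableT mF.
have cf y : (f_ n y)%:E @[n --> \oo] --> F y by exact: cvg_nnsfun_approx.
transitivity (limn (fun n => \int[nu]_y (f_ n y)%:E)).
  rewrite -monotone_convergence//.
  - by apply: eq_integral => y _; apply/esym/cvg_lim => //; exact: cf.
  - by move=> n; exact/measurable_EFinP/measurable_funP.
  - by move=> n y _; rewrite lee_fin.
  - by move=> y _ m n mn; rewrite lee_fin; exact/lefP/nd_nnsfun_approx.
rewrite [X in limn X](_ : _ = (fun n => \int[mu]_w ((f_ n (U w))%:E * (h w)%:E))).
  rewrite -monotone_convergence//; last 3 first.
  - move=> n; apply: emeasurable_funM; apply/measurable_EFinP => //.
    exact: (measurableT_comp (measurable_funP (f_ n)) mU).
  - by move=> n w _; rewrite mule_ge0 ?lee_fin.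
  - move=> w _ m n mn; rewrite lee_pmul ?lee_fin//; exact/lefP/nd_nnsfun_approx.
  apply: eq_integral => w _; apply/cvg_lim => //.
  by apply: cvgeZr => //; exact: cf.
apply/funext => n; rewrite integralT_nnsfun sintegralE.
have mUk k : measurable (U @^-1` (f_ n @^-1` [set k])).
  by rewrite -[X in measurable X]setTI; apply: mU.
transitivity (\int[mu]_w (\sum_(k \in range (f_ n))
    (k%:E * ((EFin \o h) \_ (U @^-1` (f_ n @^-1` [set k])) w)))).
  rewrite ge0_integral_fsum//; last 2 first.
  - move=> k; apply: emeasurable_funM => //; apply/(measurable_restrictT _ _).1 => //.
    exact/measurable_funTS/measurable_EFinP.
  - move=> k w _; rewrite /patch; case: ifPn => [|_]; last by rewrite mule0.
    by rewrite inE /= => <-; rewrite mule_ge0 ?lee_fin.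
  apply: eq_fsbigr => k /[!inE] -[y _ <-].
  rewrite ge0_integralZl ?lee_fin//; last 2 first.
  - by apply/(measurable_restrictT _ _).1 => //; exact/measurable_funTS/measurable_EFinP.
  - by move=> w _; rewrite /patch; case: ifPn => // _; rewrite lee_fin.
  by rewrite -integral_mkcond nuE.
apply: eq_integral => w _; rewrite (fsbigD1 (f_ n (U w)))//=; last first.
  by exists (U w).
rewrite fsbig1 ?addr0; last first.
  move=> k [_ /= kU]; rewrite /patch memNset ?mule0//=; exact/nesym.
by rewrite /patch mem_set.
Qed.

End integral_of_density.

Section normal_integrals.
Context (R : realType).
Local Notation mu := (@lebesgue_measure R).
Implicit Types (F : R -> \bar R) (m s a b c x y : R).

Lemma normal_pdf_expR m s x : s != 0 ->
  normal_pdf m s x = normal_peak 1 / `|s| * expR (- (x - m) ^+ 2 / (s ^+ 2 *+ 2)).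
Proof.
move=> s0; rewrite /normal_pdf (negbTE s0) /normal_fun; congr (_ * _).
rewrite /normal_peak -mulrnAr sqrtrM ?sqr_ge0// sqrtr_sqr invfM mulrC.
by rewrite expr1n mul1r.
Qed.

Lemma measurable_affine a c : measurable_fun setT (fun x => a * x + c).
Proof. by apply: measurable_funD => //; exact: measurable_funM. Qed.

Definition affine_fun a c (x : measurableTypeR R) : measurableTypeR R := a * x + c.

Lemma measurable_affine_fun a c : measurable_fun setT (affine_fun a c).
Proof. exact: measurable_affine. Qed.

Definition affine_measure a c : {measure set (measurableTypeR R) -> \bar R} :=
  mscale (`|a|%:nng)
    (measure_function_pushforward__canonical__measure_function_Measure mu (measurable_affine_fun a c)).

Lemma affine_measureE a c A :
  affine_measure a c A = (`|a|%:E * mu [set x | A (a * x + c)%R])%E.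
Proof. reflexivity. Qed.

(** Lebesgue measure is determined by half-open intervals, so only those are computed. The split is
    on the sign of [a]: a negative slope reverses the interval, and its closed end changes side. *)
Lemma lebesgue_measure_affine a c (A : set R) : a != 0 -> measurable A ->
  mu A = (`|a|%:E * mu [set x | A (a * x + c)%R])%E.
Proof.
move=> a0 mA; have -> // : mu A = affine_measure a c A.
apply: lebesgue_measure_unique => // X /ocitvP[->|[[p q] /= pq ->]].
  by rewrite !measure0.
rewrite /= /mscale/= /pushforward lebesgue_measure_itv/= lte_fin pq.
have [a_gt|a_lt|a_eq] := ltgtP a 0; last by rewrite a_eq eqxx in a0.
- rewrite (_ : _ @^-1` _ = `[(q - c) / a, (p - c) / a[%classic); last first.
    apply/seteqP; split => x /=; rewrite /affine_fun !in_itv/= => /andP[];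
      rewrite ?ler_ndivrMr ?ltr_ndivlMr// => h1 h2; apply/andP; split; lra.
  rewrite lebesgue_measure_itv/= lte_fin ltr_nM2r ?invr_lt0// ltrD2r pq.
  rewrite ltr0_norm// -!EFinB -EFinM; congr EFin; field; exact: ltr0_neq0.
- rewrite (_ : _ @^-1` _ = `](p - c) / a, (q - c) / a]%classic); last first.
    apply/seteqP; split => x /=; rewrite /affine_fun !in_itv/= => /andP[];
      rewrite ?ltr_pdivrMr ?ler_pdivlMr// => h1 h2; apply/andP; split; lra.
  rewrite lebesgue_measure_itv/= lte_fin ltr_pM2r ?invr_gt0// ltrD2r pq.
  rewrite gtr0_norm// -!EFinB -EFinM; congr EFin; field; exact: lt0r_neq0.
Qed.

Lemma ge0_integral_affine a c F : a != 0 -> measurable_fun setT F ->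
  (forall x, 0 <= F x)%E ->
  (\int[mu]_x F x = `|a|%:E * \int[mu]_x F (a * x + c)%R)%E.
Proof.
move=> a0 mF F0.
rewrite (@eq_measure_integral _ _ _ _ (affine_measure a c)); last first.
  by move=> A mA _; rewrite affine_measureE; exact: (lebesgue_measure_affine c a0 mA).
rewrite [LHS]ge0_integral_mscale//; congr (_ * _)%E.
rewrite [LHS]ge0_integral_pushforward//.
exact: measurable_affine.
Qed.

Fact gauss_key : unit. Proof. exact: tt. Qed.

(* Locked: unification would otherwise compare the densities of two normal laws. *)
Definition gauss m s : probability (measurableTypeR R) R :=
  locked_with gauss_key
    (fun m s => normal_prob m s : probability (measurableTypeR R) R) m s.

Lemma gaussE m s A : gauss m s A = normal_prob m s A.
Proof. by rewrite /gauss unlock. Qed.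

Lemma ge0_integral_gauss m s F : measurable_fun setT F ->
  (forall x, 0 <= F x)%E ->
  (\int[gauss m s]_x F x = \int[mu]_x (F x * (normal_pdf m s x)%:E))%E.
Proof.
move=> mF F0; rewrite (@ge0_integral_density _ _ _ _ _ mu _ id (normal_pdf m s))//.
- exact: measurable_normal_pdf.
- by move=> x; exact: normal_pdf_ge0.
- by move=> A mA; exact: gaussE.
Qed.

Lemma ge0_integral_std_affine a c F : a != 0 -> measurable_fun setT F ->
  (forall x, 0 <= F x)%E ->
  (\int[gauss 0 1]_x F (a * x + c)%R = \int[gauss c a]_x F x)%E.
Proof.
move=> a0 mF F0; have mFa := measurableT_comp mF (measurable_affine a c).
rewrite [RHS](ge0_integral_gauss c a mF F0).
rewrite [LHS](ge0_integral_gauss 0 1 mFa (fun x => F0 _)).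
rewrite [RHS](@ge0_integral_affine a c)//; last 2 first.
- by apply: emeasurable_funM => //; apply/measurable_EFinP; exact: measurable_normal_pdf.
- by move=> x; rewrite mule_ge0// lee_fin normal_pdf_ge0.
rewrite -ge0_integralZl//; last 2 first.
- apply: emeasurable_funM; first exact: measurableT_comp mF (measurable_affine _ _).
  by apply/measurable_EFinP; apply: measurableT_comp (measurable_affine _ _);
    exact: measurable_normal_pdf.
- by move=> x _; rewrite mule_ge0// lee_fin normal_pdf_ge0.
apply: eq_integral => x _; rewrite muleCA -EFinM; congr (_ * _%:E)%E.
rewrite !normal_pdf_expR ?oner_neq0// normr1 divr1 mulrCA mulrA divfK ?normr_eq0//.
by congr (_ * expR _); field; rewrite a0.
Qed.

Lemma gauss_opp m s : s != 0 -> forall F, measurable_fun setT F ->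
  (forall x, 0 <= F x)%E ->
  (\int[gauss m (- s)]_x F x = \int[gauss m s]_x F x)%E.
Proof.
move=> s0 F mF F0; rewrite [RHS](ge0_integral_gauss m s mF F0) [LHS](ge0_integral_gauss m (- s) mF F0); apply: eq_integral => x _.
by rewrite !normal_pdf_expR ?oppr_eq0// normrN sqrrN.
Qed.

Lemma ge0_integral_std_opp F : measurable_fun setT F -> (forall x, 0 <= F x)%E ->
  (\int[gauss 0 1]_x F (- x)%R = \int[gauss 0 1]_x F x)%E.
Proof.
move=> mF F0; rewrite -[RHS](gauss_opp 0 (oner_neq0 R))// -[RHS](@ge0_integral_std_affine (-1) 0)//.
  by apply: eq_integral => x _; rewrite mulN1r addr0.
Qed.

(** The sum of independent normals is normal. After the substitution u = a x + b y and Tonelli, the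
    joint density of (y, u) factors into the density of u, which is N(0, s^2), and that of y given
    u, which integrates to 1. *)
Lemma ge0_integral_std_conv a b F : a != 0 -> measurable_fun setT F ->
  (forall x, 0 <= F x)%E ->
  (\int[gauss 0 1]_y \int[gauss 0 1]_x F (a * x + b * y)%R =
   \int[gauss 0 1]_x F (Num.sqrt (a ^+ 2 + b ^+ 2) * x)%R)%E.
Proof.
move=> a0 mF F0; set s := Num.sqrt _.
have s2 : s ^+ 2 = a ^+ 2 + b ^+ 2 by rewrite sqr_sqrtr// addr_ge0 ?sqr_ge0.
have sp : 0 < s by rewrite sqrtr_gt0 ltr_pwDl ?sqr_ge0// exprn_even_gt0.
have s0 : s != 0 by rewrite gt_eqF.
pose G (z : R * R) := (F z.2 * (normal_pdf (b * z.1) a z.2)%:E *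
  (normal_pdf 0 1 z.1)%:E)%E.
have pdf2 : measurable_fun setT (fun z : R * R => normal_pdf (b * z.1) a z.2).
  under eq_fun do rewrite normal_pdf_expR//.
  apply: measurable_funM => //; apply: measurableT_comp => //.
  apply: measurable_funM => //; apply: measurableT_comp => //.
  apply: measurable_funX; apply: measurable_funB; first exact: (@measurable_snd _ _ R R).
  by apply: measurable_funM => //; exact: measurable_fst.
have mG : measurable_fun setT G.
  apply: emeasurable_funM.
    apply: emeasurable_funM; first exact: measurableT_comp mF measurable_snd.
    exact/measurable_EFinP.
  apply/measurable_EFinP; apply: measurableT_comp measurable_fst.
  exact: measurable_normal_pdf.
have G0 z : (0 <= G z)%E by rewrite !mule_ge0 ?lee_fin ?normal_pdf_ge0.
transitivity (\int[mu]_y \int[mu]_u G (y, u))%E.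
  rewrite [LHS](ge0_integral_gauss 0 1); last 2 first.
  - rewrite (_ : (fun y => _) = fun y => (\int[gauss 0 1]_x (F \o (fun z : R * R => (a * z.1 + b * z.2)%R)) (x, y)))%E//.
    apply: measurable_fun_fubini_tonelli_G => //=.
    apply: measurableT_comp mF _; apply: measurable_funD; exact: measurable_funM.
  - by move=> y; apply: integral_ge0 => x _.
  apply: eq_integral => y _.
  rewrite (ge0_integral_std_affine (b * y) a0 mF F0) (ge0_integral_gauss (b * y) a mF F0).
  rewrite -ge0_integralZr ?lee_fin ?normal_pdf_ge0//.
  - by apply: emeasurable_funM => //; apply/measurable_EFinP; exact: measurable_normal_pdf.
  - by move=> x _; rewrite mule_ge0// lee_fin normal_pdf_ge0.
rewrite [LHS](@fubini_tonelli _ _ _ _ R mu mu G)//=.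
transitivity (\int[mu]_u (F u * (normal_pdf 0 s u)%:E))%E; last first.
  rewrite -[LHS](ge0_integral_gauss 0 s mF F0) -[LHS](ge0_integral_std_affine 0 s0 mF F0).
  by apply: eq_integral => x _; rewrite addr0.
apply: eq_integral => u _; rewrite /G/=.
have as0 : a / s != 0 by rewrite mulf_neq0// invr_eq0.
(* Given u, the variable y has mean b u / s^2 and deviation |a| / s; the factor 1 is written as the
   integral of that density. *)
rewrite -[in RHS](mul1e (_ * _)%E) muleC -(integral_normal_pdf (b * u / s ^+ 2) (a / s)).
rewrite -ge0_integralZl; last 4 first.
- exact: measurableT.
- by apply/measurable_EFinP; exact: measurable_normal_pdf.
- by move=> x _; rewrite lee_fin normal_pdf_ge0.
- by rewrite mule_ge0// lee_fin normal_pdf_ge0.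
apply: eq_integral => y _; rewrite -!muleA -!EFinM; congr (_ * _%:E)%E.
rewrite !normal_pdf_expR ?oner_neq0// normr1 divr1 normf_div (gtr0_norm sp).
rewrite mulrACA [RHS]mulrACA.
have -> : expR (- (u - b * y) ^+ 2 / (a ^+ 2 *+ 2)) * expR (- (y - 0) ^+ 2 / (1 ^+ 2 *+ 2)) =
   expR (- (u - 0) ^+ 2 / (s ^+ 2 *+ 2)) * expR (- (y - b * u / s ^+ 2) ^+ 2 / ((a / s) ^+ 2 *+ 2)).
  rewrite -!expRD; congr expR.
  have b2 : b ^+ 2 = s ^+ 2 - a ^+ 2 by rewrite s2; ring.
  (* [field] does not know s^2 = a^2 + b^2; the difference of the exponents is therefore factored so
     that this relation kills one factor. *)
  suff : (- (u - b * y) ^+ 2 / (a ^+ 2 *+ 2) + - (y - 0) ^+ 2 / (1 ^+ 2 *+ 2)) -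
   (- (u - 0) ^+ 2 / (s ^+ 2 *+ 2) + - (y - b * u / s ^+ 2) ^+ 2 / ((a / s) ^+ 2 *+ 2)) = 0 by move/subr0_eq.
  transitivity ((s ^+ 2 - a ^+ 2 - b ^+ 2) * (s ^+ 2 * y ^+ 2 - u ^+ 2) / (2 * a ^+ 2 * s ^+ 2)).
    by field; rewrite a0 s0.
  by rewrite b2 subrr !mul0r.
by congr (_ * _); field; rewrite s0 normr_eq0 a0.
Qed.

End normal_integrals.

(** * Trigonometric polynomials determine finite measures *)

Definition bounded_measurable d (T : measurableType d) (R : realType) (f : T -> R) :=
  measurable_fun setT f /\ exists M, forall x, `|f x| <= M.

Section bounded_measurable_theory.
Context d (T : measurableType d) (R : realType).
Implicit Types f g : T -> R.

Lemma bmf_cst (c : R) : bounded_measurable (fun _ : T => c).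
Proof. by split; [exact: measurable_cst | exists `|c|]. Qed.

Lemma bmfD f g : bounded_measurable f -> bounded_measurable g ->
  bounded_measurable (fun x => f x + g x).
Proof.
move=> [mf [M fM]] [mg [N gN]]; split; first exact: measurable_funD.
by exists (M + N) => x; rewrite (le_trans (ler_normD _ _))// lerD.
Qed.

Lemma bmfM f g : bounded_measurable f -> bounded_measurable g ->
  bounded_measurable (fun x => f x * g x).
Proof.
move=> [mf [M fM]] [mg [N gN]]; split; first exact: measurable_funM.
by exists (M * N) => x; rewrite normrM ler_pM.
Qed.

Lemma bmfZ (c : R) f : bounded_measurable f -> bounded_measurable (fun x => c * f x).
Proof. by move=> bf; apply: bmfM => //; exact: bmf_cst. Qed.

Lemma bmf_indic (A : set T) : measurable A -> bounded_measurable (\1_A : T -> R).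
Proof.
move=> mA; split; first exact: measurable_indic.
by exists 1 => x; rewrite indicE ger0_norm// lern1 leq_b1.
Qed.

Lemma bmf_integrable (P : probability T R) f : bounded_measurable f ->
  P.-integrable setT (EFin \o f).
Proof.
move=> [mf [M fM]]; apply: measurable_bounded_integrable => //.
  exact: (le_lt_trans (probability_le1 _ _) (ltry 1)).
by exists M; split; [exact: num_real | move=> N MN x _; exact: le_trans (fM x) (ltW MN)].
Qed.

Lemma bmf_lim (f_ : nat -> T -> R) f (M : R) :
  (forall n, measurable_fun setT (f_ n)) -> (forall n x, `|f_ n x| <= M) ->
  (forall x, f_ n x @[n --> \oo] --> f x) -> bounded_measurable f.
Proof.
move=> mf fM ff; split; first by apply: (measurable_fun_cvg mf) => x _; exact: ff.
exists M => x; have := ff x => /cvg_norm h.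
rewrite -(cvg_lim (@Rhausdorff R) h); apply: limr_le; last exact: nearW.
by apply/cvg_ex; eexists; exact: h.
Qed.

Lemma bmf_cvg (P : probability T R) (f_ : nat -> T -> R) f (M : R) :
  (forall n, measurable_fun setT (f_ n)) -> (forall n x, `|f_ n x| <= M) ->
  (forall x, f_ n x @[n --> \oo] --> f x) ->
  (\int[P]_x f_ n x)%R @[n --> \oo] --> (\int[P]_x f x)%R.
Proof.
move=> mf fM ff; have [mf' bf'] := bmf_lim mf fM ff.
have bn n : bounded_measurable (f_ n) by split=> //; exists M.
have [] := @dominated_convergence _ _ R P setT measurableT (fun n => EFin \o f_ n)
  (EFin \o f) (cst M%:E).
- by move=> n; exact/measurable_EFinP.
- exact/measurable_EFinP.
- by apply: aeW => x _; apply: cvg_EFin; [exact: nearW | exact: ff].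
- exact/finite_measure_integrable_cst.
- by apply: aeW => x n _; rewrite /= lee_fin.
move=> _ _ h; apply: fine_cvg.
by rewrite fineK//; exact: integrable_fin_num (bmf_integrable P (conj mf' bf')).
Qed.

Lemma bmf_RintegralD (P : probability T R) f g :
  bounded_measurable f -> bounded_measurable g ->
  (\int[P]_x (f x + g x) = \int[P]_x f x + \int[P]_x g x)%R.
Proof. by move=> bf bg; rewrite RintegralD//; exact: bmf_integrable. Qed.

Lemma bmf_RintegralZ (P : probability T R) (c : R) f : bounded_measurable f ->
  (\int[P]_x (c * f x) = c * \int[P]_x f x)%R.
Proof. by move=> bf; rewrite RintegralZl//; exact: bmf_integrable. Qed.

End bounded_measurable_theory.

Lemma bmf_comp d d' (T : measurableType d) (T' : measurableType d') (R : realType)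
    (f : T' -> R) (U : T -> T') : measurable_fun setT U -> bounded_measurable f ->
  bounded_measurable (fun x => f (U x)).
Proof.
move=> mU [mf [M fM]]; split; first exact: (measurableT_comp mf mU).
by exists M => x.
Qed.

Lemma bmf_cos (R : realType) (b t : R) :
  bounded_measurable (fun x : R => cos (b * x + t)).
Proof.
split; last by exists 1 => x; rewrite ler_norml cos_geN1 cos_le1.
apply: (measurableT_comp (f := @cos R)); last exact: measurable_affine.
by apply: continuous_measurable_fun; exact: continuous_cos.
Qed.

Section trigonometric_uniqueness.
Context (R : realType) (L : (R -> R) -> R).
Local Notation bm := (@bounded_measurable _ R R).
Hypothesis LD : forall f g, bm f -> bm g -> L (fun x => f x + g x) = L f + L g.
Hypothesis LZ : forall c f, bm f -> L (fun x => c * f x) = c * L f.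
Hypothesis Llim : forall (f_ : nat -> R -> R) (f : R -> R) (M : R),
  (forall n, measurable_fun setT (f_ n)) -> (forall n x, `|f_ n x| <= M) ->
  (forall x, f_ n x @[n --> \oo] --> f x) -> (forall n, L (f_ n) = 0) -> L f = 0.
Hypothesis Lcos : forall b t, L (fun x => cos (b * x + t)) = 0.

Let trig f := bm f /\ forall b t, L (fun x => f x * cos (b * x + t)) = 0.
(** The functions killed by [L] need not be closed under products; the multipliers of the class
    [trig] are, and they are closed under sums and bounded pointwise limits too. As the constant 1
    is in [trig], [L] kills every multiplier. *)
Let mult g := bm g /\ forall f, trig f -> trig (fun x => f x * g x).

Let trig_cst : trig (fun=> 1).
Proof.
split; first exact: bmf_cst.
by move=> b t; rewrite -[RHS](Lcos b t); congr L; apply/funext => x; rewrite mul1r.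
Qed.

Let mult_L g : mult g -> L g = 0.
Proof.
move=> [_ /(_ _ trig_cst)[_ /(_ 0 0)]] <-; congr L; apply/funext => x.
by rewrite mul0r addr0 cos0 mulr1 mul1r.
Qed.

(** A product of two cosines is half the sum of the cosines of the sum and of the difference of
    their arguments. The free phase covers the sines. *)
Let mult_cos b t : mult (fun x => cos (b * x + t)).
Proof.
split; first exact: bmf_cos.
move=> f [bf Lf]; split; first by apply: bmfM => //; exact: bmf_cos.
move=> b' t'; rewrite (_ : (fun x => _) = fun x =>
    2^-1 * (f x * cos ((b + b') * x + (t + t')) + f x * cos ((b - b') * x + (t - t')))).
  have bm1 b1 t1 : bm (fun x => f x * cos (b1 * x + t1)).
    by apply: bmfM => //; exact: bmf_cos.
  by rewrite LZ ?LD ?Lf ?addr0 ?mulr0//; exact: bmfD.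
apply/funext => x.
have -> : (b + b') * x + (t + t') = (b * x + t) + (b' * x + t') by ring.
have -> : (b - b') * x + (t - t') = (b * x + t) - (b' * x + t') by ring.
by move: (b * x + t) (b' * x + t') => p q; rewrite (cosD p q) (cosB p q); field.
Qed.

Let mult_cst c : mult (fun=> c).
Proof.
split; first exact: bmf_cst.
move=> f [bf Lf]; split; first by apply: bmfM => //; exact: bmf_cst.
move=> b t; rewrite (_ : (fun x => _) = fun x => c * (f x * cos (b * x + t))).
  by rewrite LZ ?Lf ?mulr0//; apply: bmfM => //; exact: bmf_cos.
by apply/funext => x; rewrite (mulrC (f x)) mulrA.
Qed.

Let multD g h : mult g -> mult h -> mult (fun x => g x + h x).
Proof.
move=> [bg Mg] [bh Mh]; split; first exact: bmfD.
move=> f tf; have [bf Lf] := tf; split; first by apply: bmfM => //; exact: bmfD.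
move=> b t; rewrite (_ : (fun x => _) = fun x =>
    f x * g x * cos (b * x + t) + f x * h x * cos (b * x + t)).
  by rewrite LD ?(Mg _ tf).2 ?(Mh _ tf).2 ?addr0//; apply: bmfM; try exact: bmf_cos;
    exact: bmfM.
by apply/funext => x; rewrite mulrDr mulrDl.
Qed.

Let multM g h : mult g -> mult h -> mult (fun x => g x * h x).
Proof.
move=> [bg Mg] [bh Mh]; split; first exact: bmfM.
move=> f tf; have := Mh _ (Mg _ tf); congr trig; apply/funext => x.
by rewrite mulrA.
Qed.

Let mult_lim (g_ : nat -> R -> R) (g : R -> R) (M : R) : (forall n, mult (g_ n)) ->
  (forall n x, `|g_ n x| <= M) -> (forall x, g_ n x @[n --> \oo] --> g x) -> mult g.
Proof.
move=> mg gM gg; have bg : bm g by exact: (bmf_lim (fun n => (mg n).1.1) gM gg).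
split=> // f tf; have [bf Lf] := tf; split; first exact: bmfM.
move=> b t; have [mf [N fN]] := bf.
apply: (Llim (f_ := fun n x => f x * g_ n x * cos (b * x + t)) (M := N * M * 1)).
- by move=> n; apply: (proj1 (bmfM (bmfM bf (mg n).1) (bmf_cos b t))).
- move=> n x; rewrite normrM ler_pM//; first by rewrite normrM ler_pM.
  by rewrite ler_norml cos_geN1 cos_le1.
- move=> x; apply: cvgMl; apply: cvgMr; exact: gg.
- by move=> n; exact: ((mg n).2 _ tf).2.
Qed.

Let multX g n : mult g -> mult (fun x => g x ^+ n).
Proof.
move=> mg; elim: n => [|n IH].
  by have := mult_cst 1; congr mult; apply/funext => x; rewrite expr0.
by have := multM mg IH; congr mult; apply/funext => x; rewrite exprS.
Qed.

(** The partial sums of the exponential series are polynomials in [g], uniformly bounded by [expR M]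
    when [g] is bounded by [M]. *)
Let mult_exp g : mult g -> mult (fun x => expR (g x)).
Proof.
move=> mg; have [[_ [M gM]] _] := mg.
apply: (mult_lim (g_ := fun n x => \sum_(0 <= i < n) exp_coeff (g x) i) (M := expR M)).
- elim=> [|n IH].
    by have := mult_cst 0; congr mult; apply/funext => x; rewrite big_geq.
  have := multD IH (multM (multX n mg) (mult_cst (n`!%:R^-1))).
  by congr mult; apply/funext => x; rewrite big_nat_recr.
- move=> n x; rewrite (le_trans (ler_norm_sum _ _ _))//.
  rewrite (@le_trans _ _ (\sum_(0 <= i < n) exp_coeff M i))//.
    apply: ler_sum => i _; rewrite /exp_coeff/= normrM normrX normfV.
    by rewrite (ger0_norm (ler0n _ _)) ler_wpM2r ?invr_ge0 ?ler0n// lerXn2r ?nnegrE// (le_trans _ (gM x)).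
  apply: nondecreasing_cvgn_le; last exact: is_cvg_series_exp_coeff.
  apply: nondecreasing_series => i _ _; apply: exp_coeff_ge0.
  exact: le_trans (normr_ge0 _) (gM x).
- by move=> x; exact: is_cvg_series_exp_coeff.
Qed.

(* [exp (- exp (n - n^2 g))] tends to the indicator of [g > 0], without an
   exceptional value where [g = 0]. *)
Let mult_gt0 g : mult g -> mult (\1_[set x | 0 < g x]).
Proof.
move=> mg.
apply: (mult_lim (g_ := fun n x => expR (-1 * expR (n%:R + (- n%:R ^+ 2) * g x))) (M := 1)).
- move=> n; apply: mult_exp; apply: multM; first exact: mult_cst.
  by apply: mult_exp; apply: multD; [|apply: multM => //]; exact: mult_cst.
- move=> n x; rewrite ger0_norm ?expR_ge0// -expR0 ler_expR mulN1r oppr_le0.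
- move=> x; rewrite indicE; case: (boolP (_ \in _)); rewrite ?inE ?notin_setE/= => gx.
    rewrite -[X in _ --> X]expR0; apply: continuous_cvg; first exact: continuous_expR.
    rewrite -[X in _ --> X](mulr0 (-1)); apply: cvgMr.
    rewrite (_ : (fun n => _) = fun n => (expR ((n%:R ^+ 2) * g x - n%:R))^-1); last first.
      by apply/funext => n; rewrite -expRN; congr expR; ring.
    apply: (@squeeze_cvgr _ _ _ _ (fun=> 0) (fun n => (1 + (n%:R ^+ 2 * g x - n%:R))^-1)).
    + near=> n; rewrite invr_ge0 expR_ge0/= lef_pV2 ?posrE ?expR_gt0 ?expR_ge1Dx//.
      rewrite ltr_pwDl// subr_ge0 expr2 -mulrA ler_peMr// -ler_pdivrMr//.
      by near: n; exact: nbhs_infty_ger.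
    + exact: cvg_cst.
    + apply/gtr0_cvgV0; first (near=> n).
        rewrite ltr_pwDl// subr_ge0 expr2 -mulrA ler_peMr// -ler_pdivrMr//.
        by near: n; exact: nbhs_infty_ger.
      apply/cvgryPge => A; near=> n.
      have h : 2 <= n%:R * g x.
        by rewrite -ler_pdivrMr//; near: n; exact: nbhs_infty_ger.
      have hA : A <= n%:R by near: n; exact: nbhs_infty_ger.
      rewrite (le_trans hA)// expr2 -mulrA.
      have := ler_wpM2l (ler0n R n) h; lra.
  apply: (@squeeze_cvgr _ _ _ _ (fun=> 0) (fun n => (1 + n%:R)^-1)).
  + near=> n; rewrite expR_ge0/= mulN1r expRN lef_pV2 ?posrE ?expR_gt0 ?ltr_pwDl//.
    rewrite (le_trans _ (expR_ge1Dx _))// lerD2l.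
    apply: (@le_trans _ _ (expR n%:R)).
      by rewrite (le_trans _ (expR_ge1Dx _))// lerDr.
    by rewrite ler_expR lerDl mulNr -mulrN mulr_ge0 ?sqr_ge0// oppr_ge0 leNgt; exact/negP.
  + exact: cvg_cst.
  + apply/gtr0_cvgV0; first by near=> n; rewrite ltr_pwDl.
    apply/cvgryPge => A; near=> n; rewrite (@le_trans _ _ n%:R)//.
      by near: n; exact: nbhs_infty_ger.
    by rewrite lerDr.
Unshelve. all: end_near. Qed.

(** Once n exceeds |x - c| and e, the numbers b_n |x - c| and b_n e lie in [0, pi], where the cosine
    decreases; from then on cos (b_n (x - c)) > cos (b_n e) says exactly that x is in the interval.
    The period grows with n, which pushes the periodic copies away to infinity. *)
Let mult_ball c e : 0 < e -> mult (\1_[set x | `|x - c| < e]).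
Proof.
move=> e0.
pose b n : R := (n.+1%:R)^-1.
apply: (mult_lim (g_ := fun n => \1_[set x | 0 < cos (b n * x + (- (b n * c))) + - cos (b n * e)]) (M := 1)).
- by move=> n; apply: mult_gt0; apply: multD; [exact: mult_cos|exact: mult_cst].
- by move=> n x; rewrite indicE ger0_norm// lern1 leq_b1.
- move=> x; apply: cvg_near_cst; near=> n.
  have b0 : 0 < b n by rewrite invr_gt0 ltr0n.
  have bpi y : 0 <= y -> y <= n%:R -> b n * y \in `[0, pi].
    move=> y0 yn; rewrite in_itv/=; apply/andP; split; first by apply: mulr_ge0 => //; exact: ltW.
    apply: (@le_trans _ _ 1); last by rewrite (le_trans _ (pi_ge2 R))// ler1n.
    by rewrite mulrC ler_pdivrMr ?ltr0n// mul1r (le_trans yn)// ler_nat.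
  rewrite !indicE; congr (nat_of_bool _)%:R.
  have key : (0 < cos (b n * x - b n * c) - cos (b n * e)) = (`|x - c| < e).
    rewrite subr_gt0 -mulrBr -(cos_norm (b n * (x - c))) normrM (gtr0_norm b0).
    have en : e <= n%:R by near: n; exact: nbhs_infty_ger.
    have xn : `|x - c| <= n%:R by near: n; exact: nbhs_infty_ger.
    by rewrite ltr_cos ?bpi ?ltr_pM2l ?(ltW e0).
  by apply/idP/idP; rewrite !inE /= key.
Unshelve. all: end_near. Qed.

(** The sets whose indicator is a multiplier form a sigma-algebra that contains the bounded open
    intervals. In [cramer_wold] the functional [L] is the difference between the two sides of a
    product formula. *)
Lemma trigonometric_uniqueness (A : set R) : measurable A -> L \1_A = 0.
Proof.
move=> mA; apply: mult_L.
pose S : set (set R) := [set A | measurable A /\ mult \1_A].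
suff : S A by case.
have SCo B : S B -> S (~` B).
  move=> [mB MB]; split; first exact: measurableC.
  have := multD (mult_cst 1) (multM (mult_cst (-1)) MB); congr mult; apply/funext => x.
  by rewrite !indicE in_setC; case: (_ \in _); rewrite /= ?mulr1 ?mulr0 ?addr0 ?subrr.
have SI B C : S B -> S C -> S (B `&` C).
  move=> [mB MB] [mC MC]; split; first exact: measurableI.
  by have := multM MB MC; congr mult; rewrite indicI.
have S0 : S set0.
  by split=> //; have := mult_cst 0; congr mult; apply/funext => x; rewrite indicE in_set0.
have SU B C : S B -> S C -> S (B `|` C).
  move=> SB SC'; by rewrite -[_ `|` _]setCK setCU; apply: (SCo); apply: (SI); exact: (SCo).
have Sbig (F : nat -> set R) : (forall i, S (F i)) -> S (\bigcup_i F i).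
  move=> SF; split; first by apply: bigcup_measurable => i _; exact: (SF i).1.
  have Sn n : S (\big[setU/set0]_(i < n) F i).
    by elim/big_rec: _ => // i B _; exact: SU.
  apply: (mult_lim (g_ := fun n => \1_(\big[setU/set0]_(i < n) F i)) (M := 1)).
  - by move=> n; exact: (Sn n).2.
  - by move=> n x; rewrite indicE ger0_norm// lern1 leq_b1.
  - move=> x; apply: cvg_near_cst; rewrite indicE.
    have [[i _ Fi]|nF] := pselect ((\bigcup_i F i) x).
      rewrite mem_set; last by exists i.
      near=> n; rewrite indicE mem_set// -bigcup_mkord; exists i => //=.
      by near: n; exact: nbhs_infty_gt.
    rewrite memNset//; near=> n; rewrite indicE memNset// => /=.
    by rewrite -bigcup_mkord => -[i _ Fi]; apply: nF; exists i.
have Sball c e : 0 < e -> S [set x | `|x - c| < e].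
  move=> e0; split; last exact: mult_ball.
  by rewrite (_ : [set x | _] = ball c e); [exact: measurable_ball|rewrite /ball/=; apply/seteqP; split=> x /=; rewrite distrC].
have {}mA : (@ocitv R).-sigma.-measurable A by [].
move: mA; rewrite RGenOpens.measurableE => mA.
apply: (smallest_sub _ _ mA) => /=.
  split=> //; first by move=> B; rewrite setTD; exact: SCo.
move=> B [p [q ->]].
have [pq|qp] := ltP p q.
  have := Sball ((p + q) / 2) ((q - p) / 2); rewrite divr_gt0 ?subr_gt0// => /(_ isT).
  congr S; apply/seteqP; split=> x /=; rewrite in_itv/= ltr_norml => /andP[? ?];
    apply/andP; split; lra.
by rewrite set_itv_ge ?bnd_simp -?leNgt.
Unshelve. all: end_near. Qed.

End trigonometric_uniqueness.

(** * Independence and families of independent standard normal variables *)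

Section independence.
Context d (T : measurableType d) (R : realType) (P : probability T R).

Lemma EFin_Rintegral (f : T -> R) : P.-integrable setT (EFin \o f) ->
  (\int[P]_w (f w)%:E = (\int[P]_w f w)%R%:E)%E.
Proof. by move=> fi; rewrite /Rintegral fineK// integrable_fin_num. Qed.

Lemma ge0_integrable (f : T -> R) c : measurable_fun setT f -> (forall w, 0 <= f w) ->
  (\int[P]_w (f w)%:E = c%:E)%E -> P.-integrable setT (EFin \o f).
Proof.
move=> mf f0 fc; apply/integrableP; split; first exact/measurable_EFinP.
by under eq_integral => w _ do rewrite /= ger0_norm//; rewrite fc ltry.
Qed.

Lemma integrableDr (f g : T -> R) : P.-integrable setT (EFin \o f) ->
  P.-integrable setT (EFin \o g) -> P.-integrable setT (EFin \o (fun w => f w + g w)).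
Proof.
move=> fi gi; rewrite (_ : _ \o _ = ((EFin \o f) \+ (EFin \o g))%E)//.
exact: integrableD.
Qed.

Lemma integrableZr (c : R) (f : T -> R) : P.-integrable setT (EFin \o f) ->
  P.-integrable setT (EFin \o (fun w => c * f w)).
Proof.
move=> fi; rewrite (_ : _ \o _ = (fun w => c%:E * (EFin \o f) w)%E)//.
exact: integrableZl.
Qed.

Context d1 d2 (T1 : measurableType d1) (T2 : measurableType d2).
Context (X : {RV P >-> T1}) (Y : {RV P >-> T2}).
Hypothesis XY : independent2 P X Y.

(** Two passes of [ge0_integral_density]: restricted to an event on [X], the law of [Y] is only
    scaled by the probability of that event; hence, weighted by [g (Y w)], the law of [X] is only
    scaled by [b]. *)
Lemma independent2_ge0_integral (f : T1 -> R) (g : T2 -> R) a b :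
  measurable_fun setT f -> measurable_fun setT g ->
  (forall x, 0 <= f x) -> (forall y, 0 <= g y) ->
  (\int[P]_w (f (X w))%:E = a%:E)%E -> (\int[P]_w (g (Y w))%:E = b%:E)%E ->
  (\int[P]_w (f (X w) * g (Y w))%:E = (a * b)%:E)%E.
Proof.
move=> mf mg f0 g0 fa gb.
have mX : measurable_fun setT X by exact: measurable_funPT.
have mY : measurable_fun setT Y by exact: measurable_funPT.
have b0 : 0 <= b by rewrite -lee_fin -gb; apply: integral_ge0 => w _; rewrite lee_fin.
have mXA A : measurable A -> measurable (X @^-1` A).
  by move=> mA; rewrite -[X in measurable X]setTI; exact: mX.
have mYA A : measurable A -> measurable (Y @^-1` A).
  by move=> mA; rewrite -[X in measurable X]setTI; exact: mY.
have stepA (A : set T1) : measurable A ->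
    (\int[P]_(w in X @^-1` A) (g (Y w))%:E = P (X @^-1` A) * b%:E)%E.
  move=> mA; have pA : P (X @^-1` A) = (fine (P (X @^-1` A)))%:E.
    by rewrite fineK// fin_num_measure//; exact: mXA.
  have p0 : 0 <= fine (P (X @^-1` A)) by rewrite fine_ge0.
  rewrite pA -gb.
  rewrite -[X in (_ * X)%E](ge0_integral_distribution _ (f := EFin \o g))//; last exact/measurable_EFinP.
  rewrite -[RHS](@ge0_integral_mscale _ _ _ (distribution P Y) _ measurableT (NngNum p0))//; last 2 first.
  - exact/measurable_EFinP.
  - by move=> y _; rewrite lee_fin.
  rewrite [RHS](@ge0_integral_density _ _ _ _ _ P _ Y (\1_(X @^-1` A)))//.
  - rewrite [LHS]integral_mkcond; apply: eq_integral => w _ /=; rewrite /patch indicE.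
    by case: ifPn => _; rewrite ?mule1 ?mule0.
  - by apply: measurable_indic; exact: mXA.
  - move=> B mB; rewrite /= /mscale/= /distribution/pushforward.
    rewrite [RHS]integral_indic; [|exact: mYA|exact: mXA].
    by rewrite -pA; exact/esym/XY.
  - exact/measurable_EFinP.
rewrite mulrC EFinM -fa.
rewrite -[X in (_ * X)%E](ge0_integral_distribution _ (f := EFin \o f))//; last exact/measurable_EFinP.
rewrite -[RHS](@ge0_integral_mscale _ _ _ (distribution P X) _ measurableT (NngNum b0))//; last 2 first.
- exact/measurable_EFinP.
- by move=> y _; rewrite lee_fin.
rewrite [RHS](@ge0_integral_density _ _ _ _ _ P _ X (fun w => g (Y w)))//.
- exact: measurableT_comp mg mY.
- by move=> A mA; rewrite stepA// muleC.
- exact/measurable_EFinP.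
Qed.

Lemma independent2_integral (f : T1 -> R) (g : T2 -> R) :
  measurable_fun setT f -> measurable_fun setT g ->
  P.-integrable setT (EFin \o (f \o X)) -> P.-integrable setT (EFin \o (g \o Y)) ->
  (\int[P]_w (f (X w) * g (Y w)) = (\int[P]_w f (X w)) * (\int[P]_w g (Y w)))%R.
Proof.
move=> mf mg fi gi.
(* The sign s = 1 gives the positive part and s = -1 the negative part; the four products then fall
   under the nonnegative case. *)
pose fp s x := Num.max (s * f x) 0; pose gp s y := Num.max (s * g y) 0.
have mfp s : measurable_fun setT (fp s) by apply: measurable_maxr => //; exact: measurable_funM.
have mgp s : measurable_fun setT (gp s) by apply: measurable_maxr => //; exact: measurable_funM.
have mX : measurable_fun setT X by exact: measurable_funPT.
have mY : measurable_fun setT Y by exact: measurable_funPT.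
have max_le (s x : R) : `|s| = 1 -> `|Num.max (s * x) 0| <= `|x|.
  move=> s1; rewrite ger0_norm ?le_max ?lexx ?orbT// ge_max normr_ge0 andbT.
  by rewrite (le_trans (ler_norm _))// normrM s1 mul1r.
have fpi s : `|s| = 1 -> P.-integrable setT (EFin \o (fp s \o X)).
  move=> s1; apply: le_integrable fi => //; first exact/measurable_EFinP/measurableT_comp.
  by move=> w _ /=; rewrite lee_fin max_le.
have gpi s : `|s| = 1 -> P.-integrable setT (EFin \o (gp s \o Y)).
  move=> s1; apply: le_integrable gi => //; first exact/measurable_EFinP/measurableT_comp.
  by move=> w _ /=; rewrite lee_fin max_le.
have fp0 s x : 0 <= fp s x by rewrite le_max lexx orbT.
have gp0 s x : 0 <= gp s x by rewrite le_max lexx orbT.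
have fgp s u : `|s| = 1 -> `|u| = 1 ->
    (\int[P]_w (fp s (X w) * gp u (Y w))%:E =
     ((\int[P]_w fp s (X w)) * (\int[P]_w gp u (Y w)))%R%:E)%E.
  move=> s1 u1; apply: independent2_ge0_integral => //; rewrite EFin_Rintegral//; [exact: fpi|exact: gpi].
have fgi s u : `|s| = 1 -> `|u| = 1 -> P.-integrable setT (EFin \o (fun w => fp s (X w) * gp u (Y w))).
  move=> s1 u1; apply: ge0_integrable (fgp _ _ s1 u1).
    by apply: measurable_funM; exact: measurableT_comp.
  by move=> w; rewrite mulr_ge0.
have fgR s u : `|s| = 1 -> `|u| = 1 -> (\int[P]_w (fp s (X w) * gp u (Y w)) =
     (\int[P]_w fp s (X w)) * (\int[P]_w gp u (Y w)))%R.
  by move=> s1 u1; apply: EFin_inj; rewrite -fgp// EFin_Rintegral//; exact: fgi.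
have n1 : `|1 : R| = 1 by rewrite normr1.
have n2 : `|-1 : R| = 1 by rewrite normrN1.
have maxE (y : R) : y = Num.max y 0 - Num.max (- y) 0.
  by rewrite /Num.max oppr_lt0; case: (ltgtP y 0) => h; lra.
have fE x : f x = fp 1 x - fp (-1) x by rewrite /fp mul1r mulN1r -maxE.
have gE x : g x = gp 1 x - gp (-1) x by rewrite /gp mul1r mulN1r -maxE.
have -> : (\int[P]_w f (X w) = \int[P]_w fp 1 (X w) - \int[P]_w fp (-1) (X w))%R.
  rewrite -RintegralB//; [|exact: fpi|exact: fpi].
  by apply: eq_Rintegral => w _; rewrite fE.
have -> : (\int[P]_w g (Y w) = \int[P]_w gp 1 (Y w) - \int[P]_w gp (-1) (Y w))%R.
  rewrite -RintegralB//; [|exact: gpi|exact: gpi].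
  by apply: eq_Rintegral => w _; rewrite gE.
transitivity (\int[P]_w ((fp 1 (X w) * gp 1 (Y w) + fp (-1) (X w) * gp (-1) (Y w)) -
    (fp 1 (X w) * gp (-1) (Y w) + fp (-1) (X w) * gp 1 (Y w))))%R.
  by apply: eq_Rintegral => w _; rewrite fE gE; ring.
rewrite RintegralB//; last 2 first.
- by apply: integrableDr; exact: fgi.
- by apply: integrableDr; exact: fgi.
rewrite !RintegralD//; try exact: fgi.
by rewrite !fgR//; ring.
Qed.

End independence.

Section standard_normal_family.
Context d (T : measurableType d) (R : realType) (P : probability T R).
Context (J : finType).
Implicit Types (W : J -> T -> R).

(** Stated with products of indicators under an integral, the form in which factors can be exchanged
    one at a time: for cosines in [cramer_wold], for nonnegative functions in
    [iid_normal_ge0_integral]. *)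
Definition iid_normal W := (forall j, measurable_fun setT (W j)) /\
  forall A : J -> set R, (forall j, measurable (A j)) ->
    (\int[P]_w (\prod_j \1_(A j) (W j w)) = \prod_j fine (gauss (0 : R) 1 (A j)))%R.

(** Induction on a list of coordinates outside which all factors are indicators. For its head [i],
    weighting [P] by the other factors turns the law of [W i] into a multiple of the normal law;
    this is the induction hypothesis with an indicator put at [i]. *)
Lemma iid_normal_ge0_integral W (F : J -> R -> R) (c : J -> R) : iid_normal W ->
  (forall j, measurable_fun setT (F j)) -> (forall j x, 0 <= F j x) ->
  (forall j, \int[gauss (0 : R) 1]_x (F j x)%:E = (c j)%:E)%E ->
  (\int[P]_w (\prod_j F j (W j w))%:E = (\prod_j c j)%:E)%E.
Proof.
move=> [mW WA].
have mprod (r : seq J) (G : J -> R -> R) : (forall j, measurable_fun setT (G j)) ->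
    measurable_fun setT (fun w => \prod_(j <- r) G j (W j w)).
  move=> mG; elim: r => [|j r IH].
    by under eq_fun do rewrite big_nil; exact: measurable_cst.
  under eq_fun do rewrite big_cons; apply: measurable_funM IH.
  exact: measurableT_comp.
suff H (s : seq J) : forall (F : J -> R -> R) (c : J -> R), (forall j, measurable_fun setT (F j)) ->
    (forall j x, 0 <= F j x) ->
    (forall j, \int[gauss (0 : R) 1]_x (F j x)%:E = (c j)%:E)%E ->
    (forall j, j \notin s -> exists2 A : set R, measurable A & F j = \1_A) ->
    (\int[P]_w (\prod_j F j (W j w))%:E = (\prod_j c j)%:E)%E.
  move=> mF F0 Fc; apply: (H (enum J)) => // j.
  by rewrite mem_enum.
elim: s => [|i s IH] {}F {}c mF F0 Fc FA.
  have /choice[A AF] : forall j, exists A : set R, measurable A /\ F j = \1_A.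
    by move=> j; have [A mA FE] := FA j isT; exists A.
  have cE j : c j = fine (gauss (0 : R) 1 (A j)).
    apply: EFin_inj; rewrite -Fc (AF j).2.
    rewrite fineK ?fin_num_measure//; last exact: (AF j).1.
    by rewrite integral_indic ?setIT//; exact: (AF j).1.
  rewrite EFin_Rintegral; last first.
    apply: bmf_integrable; split; first exact: mprod.
    exists 1 => w; rewrite normr_prod; apply: prodr_ile1 => j _.
    by rewrite normr_ge0/= (AF j).2 indicE ger0_norm// lern1 leq_b1.
  congr EFin; under eq_bigr do rewrite cE; rewrite -WA; last by move=> j; exact: (AF j).1.
  by apply: eq_Rintegral => w _; apply: eq_bigr => j _; rewrite (AF j).2.
have c0 j : 0 <= c j.
  by rewrite -lee_fin -Fc; apply: integral_ge0 => x _; rewrite lee_fin.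
pose C := \prod_(j | j != i) c j; pose h w := \prod_(j | j != i) F j (W j w).
have C0 : 0 <= C by apply: prodr_ge0.
have mh : measurable_fun setT h.
  rewrite /h; under eq_fun do rewrite -big_filter; exact: mprod.
rewrite [in RHS](bigD1 i)//= -/C mulrC EFinM -Fc.
rewrite -[RHS](@ge0_integral_mscale _ _ _ (gauss 0 1) _ measurableT (NngNum C0))//; last 2 first.
- by apply/measurable_EFinP; exact: mF.
- by move=> x _; rewrite lee_fin.
rewrite [RHS](@ge0_integral_density _ _ T (measurableTypeR R) R P _ (W i) h)//.
- by apply: eq_integral => w _; rewrite (bigD1 i)//= EFinM.
- exact: mW.
- by move=> w; apply: prodr_ge0.
- move=> A mA; rewrite /= /mscale/=.
  pose F' j := if j == i then \1_A else F j.
  pose c' j := if j == i then fine (gauss (0 : R) 1 A) else c j.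
  have gA : gauss (0 : R) 1 A = (fine (gauss (0 : R) 1 A))%:E.
    by rewrite fineK// fin_num_measure.
  have <- : (\prod_j c' j)%:E = (C%:E * gauss (0 : R) 1 A)%E.
    rewrite (bigD1 i)//= {1}/c' eqxx gA -EFinM mulrC; congr (_ * _)%:E.
    by apply: eq_bigr => j /negbTE ji; rewrite /c' ji.
  rewrite -(IH F' c').
  + rewrite [RHS]integral_mkcond; apply: eq_integral => w _.
    rewrite (bigD1 i)//= {1}/F' eqxx /patch indicE.
    rewrite (_ : \prod_(_ | _) _ = h w); last by apply: eq_bigr => j /negbTE ji; rewrite /F' ji.
    by rewrite -[w \in _]/(W i w \in A); case: ifPn => _; rewrite ?mul1r ?mul0r.
  + by move=> j; rewrite /F'; case: ifP => _ //; exact: measurable_indic.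
  + by move=> j x; rewrite /F'; case: ifP => _ //; rewrite indicE.
  + move=> j; rewrite /F' /c'; case: ifP => _ //.
    by rewrite integral_indic// setIT fineK// fin_num_measure.
  + move=> j js; rewrite /F'; case: eqP => [_|/eqP ji]; first by exists A.
    by apply: FA; rewrite inE negb_or ji.
- by apply/measurable_EFinP; exact: mF.
- by move=> y; rewrite lee_fin.
Qed.

End standard_normal_family.

Lemma iid_normal_coord d (T : measurableType d) (R : realType) (P : probability T R)
    (J : finType) (W : J -> T -> R) (j : J) (F : R -> R) (c : R) :
  iid_normal P W -> measurable_fun setT F -> (forall x, 0 <= F x) ->
  (\int[gauss (0 : R) 1]_x (F x)%:E = c%:E)%E -> (\int[P]_w (F (W j w))%:E = c%:E)%E.
Proof.
move=> iid mF F0 Fc.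
have p1 (G : J -> R) : \prod_i (if i == j then G i else 1) = G j.
  by rewrite (bigD1 j)//= eqxx big1 ?mulr1// => i /negbTE ->.
rewrite -(p1 (fun=> c)) -(iid_normal_ge0_integral (F := fun i x => if i == j then F x else 1) iid).
- by apply: eq_integral => w _; rewrite p1.
- by move=> i; case: (i == j); [exact: mF|exact: measurable_cst].
- by move=> i x; case: (i == j).
- move=> i; case: (i == j) => //.
  by rewrite integral_cst// mul1e; exact: probability_setT.
Qed.

(** * From linear forms to joint independence *)

Lemma Rintegral_prob_cst d (T : measurableType d) (R : realType)
  (P : probability T R) (c : R) : (\int[P]_w c)%R = c.
Proof. by rewrite /Rintegral integral_cst// [X in (_ * X)%E]probability_setT mule1. Qed.

Section std_cos.
Context (R : realType).
Local Notation N := (gauss (0 : R) 1).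

(** The characteristic function at 1 of N(0, v), real because this law is even. It is handled
    through its value at 0 and its multiplicativity in [v]. *)
Definition std_cos (v : R) : R := (\int[N]_x cos (Num.sqrt v * x))%R.

Lemma bmf_cosR (b t : R) :
  bounded_measurable (fun x : measurableTypeR R => cos (b * x + t)).
Proof. exact: bmf_cos. Qed.

Lemma std_integral_cos (b t : R) :
  (\int[N]_x cos (b * x + t) = cos t * std_cos (b ^+ 2))%R.
Proof.
have sin0 : (\int[N]_x cos (b * x - pi / 2))%R = 0.
  (* Adding 1 makes the integrand nonnegative, as the transformation rules for the normal law
     require; the constant cancels at the end. *)
  have e (s : R) : (\int[N]_x (1 + cos (s * x - pi / 2))%:E = (1 + (\int[N]_x cos (s * x - pi / 2))%R)%:E)%E.
    rewrite [LHS]EFin_Rintegral; last first.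
      by apply: bmf_integrable; apply: bmfD (bmf_cosR _ _); exact: bmf_cst.
    congr EFin; rewrite bmf_RintegralD; [|exact: bmf_cst|exact: bmf_cosR].
    by rewrite Rintegral_prob_cst.
  have mc : measurable_fun setT (fun x : R => (1 + cos (b * x - pi / 2))%:E).
    by apply/measurable_EFinP; apply: measurable_funD => //; exact: (bmf_cos _ _).1.
  have c0 (x : R) : (0 <= (1 + cos (b * x - pi / 2))%:E)%E.
    by rewrite lee_fin -lerBlDl sub0r cos_geN1.
  have := ge0_integral_std_opp mc c0; under eq_integral do rewrite mulrN -mulNr.
  rewrite !e => -[].
  have -> : (\int[N]_x cos (- b * x - pi / 2) = (-1) * \int[N]_x cos (b * x - pi / 2))%R.
    rewrite -bmf_RintegralZ; last exact: bmf_cosR.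
    by apply: eq_Rintegral => x _; rewrite !cosBpihalf mulNr sinN mulN1r.
  lra.
have -> : (\int[N]_x cos (b * x + t) =
    \int[N]_x (cos t * cos (b * x + 0) + (- sin t) * cos (b * x - pi / 2)))%R.
  by apply: eq_Rintegral => x _; rewrite cosBpihalf addr0 cosD mulNr mulrC (mulrC (sin t)).
rewrite bmf_RintegralD ?bmf_RintegralZ; try by [exact: bmf_cosR|apply: bmfZ; exact: bmf_cosR].
rewrite sin0 mulr0 addr0; congr (_ * _); apply: eq_Rintegral => x _.
rewrite addr0 sqrtr_sqr; have [b0|b0] := ger0P b => //.
by rewrite mulNr cosN.
Qed.

Lemma std_cos0 : std_cos 0 = 1.
Proof.
rewrite /std_cos; under eq_Rintegral do rewrite sqrtr0 mul0r cos0.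
by rewrite Rintegral_prob_cst.
Qed.

(** [ge0_integral_std_conv] for a cosine: the inner integral is [std_integral_cos] with phase sqrt w
    * y. The case v = 0 is apart because the first coefficient has to be nonzero there. *)
Lemma std_cosD (v w : R) : 0 <= v -> 0 <= w -> std_cos (v + w) = std_cos v * std_cos w.
Proof.
move=> v0 w0; have [->|vn0] := eqVneq v 0; first by rewrite add0r std_cos0 mul1r.
have a0 : Num.sqrt v != 0 by rewrite sqrtr_eq0 -ltNge lt_neqAle eq_sym vn0.
have e (c : R) (f : measurableTypeR R -> R) : bounded_measurable f ->
    (\int[N]_x (c + f x)%:E = (c + (\int[N]_x f x)%R)%:E)%E.
  move=> bf; rewrite [LHS]EFin_Rintegral; last first.
    by apply: bmf_integrable; apply: bmfD bf; exact: bmf_cst.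
  congr EFin; rewrite bmf_RintegralD//; last exact: bmf_cst.
  by rewrite Rintegral_prob_cst.
have := @ge0_integral_std_conv R (Num.sqrt v) (Num.sqrt w) (fun x => (1 + cos (1 * x + 0))%:E) a0.
rewrite !sqr_sqrtr//.
have -> : (\int[N]_x (1 + cos (1 * (Num.sqrt (v + w) * x) + 0))%:E = (1 + std_cos (v + w))%:E)%E.
  rewrite -e//; last by have := bmf_cosR (Num.sqrt (v + w)) 0; congr bounded_measurable; apply/funext => x; rewrite addr0.
  by apply: eq_integral => x _; rewrite mul1r addr0.
have -> : (\int[N]_y \int[N]_x (1 + cos (1 * (Num.sqrt v * x + Num.sqrt w * y) + 0))%:E =
    (1 + std_cos v * std_cos w)%:E)%E.
  transitivity (\int[N]_y (1 + std_cos v * cos (Num.sqrt w * y + 0))%:E)%E.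
    apply: eq_integral => y _; 
    have -> : std_cos v * cos (Num.sqrt w * y + 0) =
        (\int[N]_x cos (Num.sqrt v * x + Num.sqrt w * y))%R.
      by rewrite std_integral_cos sqr_sqrtr// addr0 mulrC.
    rewrite -e; last exact: bmf_cosR.
    by apply: eq_integral => x _; rewrite mul1r addr0.
  rewrite e; last by apply: bmfZ; exact: bmf_cosR.
  rewrite bmf_RintegralZ; last exact: bmf_cosR.
  by rewrite std_integral_cos cos0 mul1r sqr_sqrtr.
move=> h; have {}h : 1 + std_cos v * std_cos w = 1 + std_cos (v + w).
  apply: EFin_inj; apply: h.
  - by apply/measurable_EFinP; apply: measurable_funD => //; exact: (bmf_cos _ _).1.
  - by move=> x; rewrite lee_fin -lerBlDl sub0r cos_geN1.
lra.
Qed.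

End std_cos.

Section cramer_wold.
Context d (T : measurableType d) (R : realType) (P : probability T R).
Context (J : finType) (W : J -> T -> R).
Local Notation N := (gauss (0 : R) 1).

(** The joint characteristic function of independent standard normals, with a phase [t] in place of
    an imaginary part. *)
Definition normal_cos := forall (a : J -> R) (t : R),
  (\int[P]_w cos (\sum_j a j * W j w + t) = cos t * std_cos (\sum_j a j ^+ 2))%R.

Lemma measurable_linear_form (a : J -> R) (p : pred J) (t : R) :
  (forall j, measurable_fun setT (W j)) ->
  measurable_fun setT (fun w => \sum_(j | p j) a j * W j w + t).
Proof.
move=> mW; apply: measurable_funD => //.
under eq_fun do rewrite -big_filter; apply: measurable_sum => j.
exact: measurable_funM.
Qed.

Lemma bmf_cos_comp (U : T -> R) : measurable_fun setT U ->
  bounded_measurable (fun w => cos (U w)).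
Proof.
move=> mU; have [mc [M cM]] := bmf_cos (1 : R) 0.
have e x : cos x = cos (1 * x + 0) :> R by rewrite mul1r addr0.
split; last by exists M => w; rewrite e.
rewrite (_ : (fun _ => _) = (fun x => cos (1 * x + 0)) \o U); first exact: measurableT_comp.
by apply/funext => w /=; rewrite -e.
Qed.

(** Coordinates move one at a time out of the cosine: the claim [H] has indicators on the list [s]
    and one cosine of a linear form in the others. For each move, [trigonometric_uniqueness] is
    applied to [L], the defect of the product formula as a function of the test function put at
    [i]. *)
Lemma cramer_wold : (forall j, measurable_fun setT (W j)) -> normal_cos ->
  iid_normal P W.
Proof.
move=> mW Wc; split=> // A mA.
have mWA j (B : set R) : measurable B -> measurable (W j @^-1` B).
  by move=> mB; rewrite -[X in measurable X]setTI; exact: mW.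
have bind (r : seq J) : bounded_measurable (fun w => \prod_(j <- r) \1_(A j) (W j w) : R).
  elim: r => [|j r IH].
    by under eq_fun do rewrite big_nil; exact: bmf_cst.
  under eq_fun do rewrite big_cons; apply: bmfM IH.
  rewrite (_ : (fun x => _) = \1_(W j @^-1` A j)); last first.
    by apply/funext => x; rewrite !indicE.
  exact: (bmf_indic R (mWA j _ (mA j))).
suff H (s : seq J) : uniq s -> forall (a : J -> R) t,
    (\int[P]_w ((\prod_(j <- s) \1_(A j) (W j w)) *
       cos (\sum_(j | j \notin s) a j * W j w + t)) =
     (\prod_(j <- s) fine (N (A j))) *
       (cos t * std_cos (\sum_(j | j \notin s) a j ^+ 2)))%R.
  have := H _ (enum_uniq J) (fun=> 0) 0.
  have no f : (\sum_(j | j \notin enum J) f j : R) = 0.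
    by rewrite big_pred0// => j; rewrite mem_enum.
  rewrite no cos0 std_cos0 !mulr1 !big_enum/= => <-.
  by apply: eq_Rintegral => w _; rewrite no addr0 cos0 mulr1 big_enum.
elim: s => [_ a t|i s IH /= /andP[nis us] a t].
  rewrite big_nil mul1r -Wc; apply: eq_Rintegral => w _.
  by rewrite big_nil mul1r.
pose C := (\prod_(j <- s) fine (N (A j))) *
  (cos t * std_cos (\sum_(j | j \notin i :: s) a j ^+ 2)).
pose h w := (\prod_(j <- s) \1_(A j) (W j w)) *
  cos (\sum_(j | j \notin i :: s) a j * W j w + t).
have bh : bounded_measurable h.
  apply: bmfM; first exact: bind.
  by apply: bmf_cos_comp; exact: measurable_linear_form.
have bU (f : R -> R) : bounded_measurable f -> bounded_measurable (fun w => h w * f (W i w)).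
  by move=> bf; apply: bmfM bh _; exact: bmf_comp bf.
have bN (f : R -> R) : bounded_measurable f -> bounded_measurable (f : measurableTypeR R -> R) by [].
pose L (f : R -> R) := ((\int[P]_w (h w * f (W i w))) - C * (\int[N]_x f x))%R.
have sumD (a' : J -> R) w : (\sum_(j | j \notin s) a' j * W j w) =
    a' i * W i w + \sum_(j | j \notin i :: s) a' j * W j w.
  rewrite (bigD1 i)//=; congr (_ + _); apply: eq_bigl => j.
  by rewrite inE negb_or andbC.
have sumD2 (a' : J -> R) : (\sum_(j | j \notin s) a' j ^+ 2) =
    a' i ^+ 2 + \sum_(j | j \notin i :: s) a' j ^+ 2.
  rewrite (bigD1 i)//=; congr (_ + _); apply: eq_bigl => j.
  by rewrite inE negb_or andbC.
have := @trigonometric_uniqueness R L _ _ _ _ (A i) (mA i).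
have LD f g : bounded_measurable f -> bounded_measurable g -> L (fun x => f x + g x) = L f + L g.
  move=> bf bg; rewrite /L (bmf_RintegralD _ (bN _ bf) (bN _ bg)).
  under eq_Rintegral do rewrite mulrDr.
  by rewrite (bmf_RintegralD _ (bU _ bf) (bU _ bg)); ring.
have LZ c f : bounded_measurable f -> L (fun x => c * f x) = c * L f.
  move=> bf; rewrite /L (bmf_RintegralZ _ _ (bN _ bf)).
  under eq_Rintegral do rewrite mulrCA.
  by rewrite (bmf_RintegralZ _ _ (bU _ bf)); ring.
have Llim (f_ : nat -> R -> R) (f : R -> R) (M : R) :
    (forall n, measurable_fun setT (f_ n)) -> (forall n x, `|f_ n x| <= M) ->
    (forall x, f_ n x @[n --> \oo] --> f x) -> (forall n, L (f_ n) = 0) -> L f = 0.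
  move=> mf fM ff L0; have [mh [H hH]] := bh.
  have c1 : (\int[P]_w (h w * f_ n (W i w)))%R @[n --> \oo] --> (\int[P]_w (h w * f (W i w)))%R.
    apply: (bmf_cvg (M := H * M)).
    - by move=> n; apply: measurable_funM => //; exact: measurableT_comp.
    - by move=> n w; rewrite normrM ler_pM.
    - by move=> w; apply: cvgMr; exact: ff.
  have c2 : (\int[N]_x f_ n x)%R @[n --> \oo] --> (\int[N]_x f x)%R.
    exact: (@bmf_cvg _ (measurableTypeR R) R N f_ f M).
  have c3 : L (f_ n) @[n --> \oo] --> L f by apply: cvgB => //; exact: cvgMr.
  rewrite -(cvg_lim (@Rhausdorff R) c3) (_ : (fun n => L (f_ n)) = fun=> 0) ?lim_cst//.
  by apply/funext => n.
have Lcos b u : L (fun x => cos (b * x + u)) = 0.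
  rewrite /L std_integral_cos.
  (* The coefficient at [i] becomes b or -b: the product of the two cosines splits into cosines of
     two linear forms, and the induction hypothesis applies to each. *)
  pose ap (e : R) j := if j == i then e * b else a j.
  have apE (e : R) (G : J -> R -> R) : \sum_(j | j \notin i :: s) G j (ap e j) =
      \sum_(j | j \notin i :: s) G j (a j).
    by apply: eq_bigr => j; rewrite inE negb_or /ap => /andP[/negbTE ->].
  have -> : (\int[P]_w (h w * cos (b * W i w + u)) =
     \int[P]_w (2^-1 * (((\prod_(j <- s) \1_(A j) (W j w)) * cos (\sum_(j | j \notin s) ap 1 j * W j w + (t + u))) +
      ((\prod_(j <- s) \1_(A j) (W j w)) * cos (\sum_(j | j \notin s) ap (-1) j * W j w + (t - u))))))%R.
    apply: eq_Rintegral => w _; rewrite /h !sumD.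
    rewrite (apE 1 (fun j x => x * W j w)) (apE (-1) (fun j x => x * W j w)) /ap eqxx mul1r mulN1r.
    set p := \sum_(_ | _) _; set q := \prod_(_ <- _) _.
    have -> : b * W i w + p + (t + u) = (p + t) + (b * W i w + u) by ring.
    have -> : - b * W i w + p + (t - u) = (p + t) - (b * W i w + u) by ring.
    by rewrite (cosD (p + t)) (cosB (p + t)); field.
  have bb (e v : R) : bounded_measurable (fun w => (\prod_(j <- s) \1_(A j) (W j w)) *
      cos (\sum_(j | j \notin s) ap e j * W j w + v)).
    apply: bmfM; first exact: bind.
    by apply: bmf_cos_comp; exact: measurable_linear_form.
  rewrite bmf_RintegralZ; last exact: bmfD.
  rewrite bmf_RintegralD// !IH// !sumD2 (apE 1 (fun j x => x ^+ 2)) (apE (-1) (fun j x => x ^+ 2)).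
  rewrite /ap eqxx mul1r mulN1r sqrrN std_cosD ?sqr_ge0//; last by apply: sumr_ge0 => j _; exact: sqr_ge0.
  by rewrite /C cosD cosB; field.
move=> /(_ LD LZ Llim Lcos)/eqP; rewrite subr_eq0 => /eqP h1.
have eN : (\int[N]_x \1_(A i) x)%R = fine (N (A i)).
  by rewrite /Rintegral integral_indic ?setIT//; exact: mA.
rewrite [in RHS]big_cons -mulrA -/C mulrC -eN -h1.
by apply: eq_Rintegral => w _; rewrite big_cons /h; ring.
Qed.

End cramer_wold.

(** * Moments of the standard normal law *)

Section normal_moments.
Context (R : realType).
Local Notation N := (gauss (0 : R) 1).

Lemma integral_std_pdf (F : R -> R) (c m s : R) : measurable_fun setT F ->
  (forall x, 0 <= F x) -> 0 <= c ->
  (forall x, F x * normal_pdf 0 1 x = c * normal_pdf m s x) ->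
  (\int[N]_x (F x)%:E = c%:E)%E.
Proof.
move=> mF F0 c0 Fc; rewrite [LHS](ge0_integral_gauss 0 1 (F := EFin \o F)); last 2 first.
- exact/measurable_EFinP.
- by move=> x; rewrite lee_fin.
transitivity (c%:E * \int[@lebesgue_measure R]_x (normal_pdf m s x)%:E)%E.
  rewrite -[RHS]ge0_integralZl; last 4 first.
  - exact: measurableT.
  - by apply/measurable_EFinP; exact: measurable_normal_pdf.
  - by move=> x _; rewrite lee_fin normal_pdf_ge0.
  - by rewrite lee_fin.
  by apply: eq_integral => x _; rewrite -!EFinM /= Fc.
by rewrite integral_normal_pdf mule1.
Qed.

Lemma measurable_sqr : measurable_fun setT (fun x : R => x ^+ 2).
Proof. exact: exprn_measurable. Qed.

Lemma measurable_expR_sqr (a c : R) : measurable_fun setT (fun x : R => expR (a * x ^+ 2 + c)).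
Proof.
apply: measurableT_comp; first exact: measurable_expR.
by apply: measurable_funD => //; apply: measurable_funM => //; exact: measurable_sqr.
Qed.

Lemma integral_std_expR_sqr (a : R) : a < 2^-1 ->
  (\int[N]_x (expR (a * x ^+ 2))%:E = ((Num.sqrt (1 - 2 * a))^-1)%:E)%E.
Proof.
move=> a2; have p : 0 < 1 - 2 * a by lra.
set s := Num.sqrt _; have s0 : 0 < s by rewrite sqrtr_gt0.
have s2 : s ^+ 2 = 1 - 2 * a by rewrite sqr_sqrtr// ltW.
apply: (@integral_std_pdf _ _ 0 s^-1).
- by have := measurable_expR_sqr a 0; congr measurable_fun; apply/funext => x; rewrite addr0.
- by move=> x; exact: expR_ge0.
- by rewrite invr_ge0 ltW.
- move=> x; rewrite !normal_pdf_expR ?oner_neq0 ?invr_eq0 ?gt_eqF// normr1 divr1.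
  rewrite ger0_norm ?invr_ge0 ?ltW// mulrCA invrK [RHS]mulrA.
  rewrite (mulrC s^-1) -(mulrA _ s) divff ?gt_eqF// mulr1; congr (_ * _).
  rewrite -expRD; congr expR; rewrite subr0 expr1n exprVn s2.
  by field; rewrite gt_eqF.
Qed.

(** The left side expands as 1 + t + 3/2 t^2 + ...; the coefficient 2 leaves room for the higher
    terms when |t| is at most 1/8. Squaring leaves a polynomial inequality. *)
Lemma invsqrt_le (t : R) : `|t| <= 8^-1 -> (Num.sqrt (1 - 2 * t))^-1 <= 1 + t + 2 * t ^+ 2.
Proof.
rewrite ler_norml => /andP[t1 t2].
have s0 : 0 < Num.sqrt (1 - 2 * t) by rewrite sqrtr_gt0; lra.
have p : 0 < 1 + t + 2 * t ^+ 2 by nra.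
rewrite -[leLHS]mul1r ler_pdivrMr// -[X in X * _](ger0_norm (ltW p)) -sqrtr_sqr.
rewrite -sqrtrM ?sqr_ge0// -[leLHS]sqrtr1 ler_wsqrtr//.
nra.
Qed.

(** The derivative at 0 of the moment generating function of the square, obtained by inequalities:
    integrating 1 + t x^2 <= exp (t x^2) yields t M <= t + 2 t^2 for small t of either sign, and
    letting t tend to 0 from both sides forces M = 1. *)
Lemma integral_std_sqr : (\int[N]_x (x ^+ 2)%:E = 1)%E.
Proof.
have mE (a : R) : measurable_fun setT (fun x : measurableTypeR R => expR (a * x ^+ 2)).
  by have := measurable_expR_sqr a 0; congr measurable_fun; apply/funext => x; rewrite addr0.
have iE (a : R) : a < 2^-1 -> N.-integrable setT (fun x : measurableTypeR R => (expR (a * x ^+ 2))%:E).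
  move=> a2; apply: (ge0_integrable (mE a)); last exact: integral_std_expR_sqr.
  by move=> x; exact: expR_ge0.
have mS : measurable_fun setT (fun x : measurableTypeR R => x ^+ 2) by exact: measurable_sqr.
have iS : N.-integrable setT (fun x : measurableTypeR R => (x ^+ 2)%:E).
  apply: (@le_integrable _ _ _ N setT measurableT _ (fun x : measurableTypeR R => (4 * expR (4^-1 * x ^+ 2))%:E)).
  - exact/measurable_EFinP.
  - move=> x _; rewrite /= lee_fin !ger0_norm ?sqr_ge0 ?mulr_ge0 ?expR_ge0//.
    by have := expR_ge1Dx (4^-1 * x ^+ 2); lra.
  - by apply: integrableZr; apply: iE; lra.
rewrite [LHS]EFin_Rintegral//; congr EFin; set M := (\int[N]_x _)%R.
have key (t : R) : `|t| <= 8^-1 -> t * M <= t + 2 * t ^+ 2.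
  move=> t8; have t2 : t < 2^-1 by move: t8; rewrite ler_norml => /andP[]; lra.
  have : 1 + t * M <= (Num.sqrt (1 - 2 * t))^-1.
    have -> : (Num.sqrt (1 - 2 * t))^-1 = (\int[N]_x expR (t * x ^+ 2))%R.
      by rewrite /Rintegral integral_std_expR_sqr.
    rewrite /M -[X in X + _](Rintegral_prob_cst N) -RintegralZl// -RintegralD//; last 2 first.
    - exact: finite_measure_integrable_cst.
    - exact: integrableZr.
    apply: le_Rintegral => //.
    - by apply: integrableDr; [exact: finite_measure_integrable_cst|exact: integrableZr].
    - exact: iE.
    - by move=> x _; exact: expR_ge1Dx.
  by have := invsqrt_le t8; lra.
apply/eqP; rewrite eq_le; apply/andP; split; apply/ler_addgt0Pr => e e0.
- pose t := Num.min 8^-1 (e / 2).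
  have t0 : 0 < t by rewrite lt_min; apply/andP; split; [lra|rewrite divr_gt0].
  have t8 : t <= 8^-1 by rewrite ge_min lexx.
  have te : t <= e / 2 by rewrite ge_min lexx orbT.
  have := key t; rewrite (gtr0_norm t0) => /(_ t8).
  by rewrite expr2 mulrCA -[X in X + _]mulr1 -mulrDr ler_pM2l// => h; lra.
- pose t := Num.min 8^-1 (e / 2).
  have t0 : 0 < t by rewrite lt_min; apply/andP; split; [lra|rewrite divr_gt0].
  have t8 : t <= 8^-1 by rewrite ge_min lexx.
  have te : t <= e / 2 by rewrite ge_min lexx orbT.
  have := key (- t); rewrite normrN (gtr0_norm t0) => /(_ t8).
  have -> : - t + 2 * (- t) ^+ 2 = t * (2 * t - 1) by ring.
  by rewrite mulNr -mulrN ler_pM2l// => h; lra.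
Qed.

(** The exponential is the square of exp (x^2 / 8), which is at least x^2 / 8; hence the 64. It
    reduces fourth moments to a known exponential moment. *)
Lemma integral_std_sqr_expR (x : R) : x ^+ 4 <= 64 * expR (4^-1 * x ^+ 2).
Proof.
have h := expR_ge1Dx (8^-1 * x ^+ 2).
have -> : 4^-1 * x ^+ 2 = 8^-1 * x ^+ 2 + 8^-1 * x ^+ 2 :> R by field.
rewrite expRD (_ : x ^+ 4 = (x ^+ 2) ^+ 2); last by rewrite -exprM.
have : 0 <= x ^+ 2 by exact: sqr_ge0.
move: (x ^+ 2) (expR _) h => y E h y0.
have e1 : 1 + 8^-1 * y <= E by [].
nra.
Qed.

End normal_moments.

Section gaussian_vectors.
Context d (T : measurableType d) (R : realType) (P : probability T R) (k : nat).
Local Notation N := (gauss (0 : R) 1).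
Implicit Types (X : {RV P >-> k.-tuple R}) (a : 'cV[R]_k).

Lemma lin_formE (a v : 'cV[R]_k) : (a^T *m v) 0 0 = \sum_i a i 0 * v i 0.
Proof. by rewrite mxE; apply: eq_bigr => i _; rewrite mxE. Qed.

Lemma measurable_tnth_RV X i : measurable_fun setT (fun w => tnth (X w) i).
Proof. by apply: (measurableT_comp (measurable_tnth i)); exact: measurable_funPT. Qed.

Lemma measurable_lin_form X a : measurable_fun setT (fun w => (a^T *m vec (X w)) 0 0).
Proof.
under eq_fun do rewrite lin_formE; apply: measurable_sum => i.
apply: measurable_funM => //; under eq_fun do rewrite mxE.
exact: measurable_tnth_RV.
Qed.

(** The split at variance 0 follows [centered_normal]: a point mass there, a dilated standard normal
    elsewhere. *)
Lemma gaussian_ge0_integral X S a (F : R -> \bar R) : gaussian X S ->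
  measurable_fun setT F -> (forall x, 0 <= F x)%E ->
  (\int[P]_w F ((a^T *m vec (X w)) 0%R 0%R) = \int[N]_x F (Num.sqrt (quad S a) * x)%R)%E.
Proof.
move=> [[_ S0] XS] mF F0; set v := quad S a.
have key (nu : probability (measurableTypeR R) R) :
    (forall A : set R, measurable A -> nu A = centered_normal v A) ->
    (\int[P]_w F ((a^T *m vec (X w)) 0%R 0%R) = \int[nu]_x F x)%E.
  move=> nuE; rewrite [RHS](@ge0_integral_density _ _ T (measurableTypeR R) R P _
    (fun w => (a^T *m vec (X w)) 0 0) (cst 1))//.
  - by apply: eq_integral => w _; rewrite mule1.
  - exact: measurable_lin_form.
  - move=> A mA; rewrite [LHS](nuE A mA) -(XS a A mA).
    rewrite -[RHS]/(\int[P]_(w in _) (cst 1%E w))%E [RHS]integral_cst ?mul1e//.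
    rewrite -[X in measurable X]setTI; exact: measurable_lin_form.
have [v0|v0] := eqVneq v 0.
  rewrite (key (\d_(0 : measurableTypeR R))); last by move=> A mA; rewrite /centered_normal v0 eqxx.
  rewrite [LHS]integral_dirac// diracT mul1e v0 sqrtr0.
  under eq_integral do rewrite mul0r.
  by rewrite integral_cst// [X in (_ * X)%E]probability_setT mule1.
have s0 : Num.sqrt v != 0 by rewrite sqrtr_eq0 -ltNge lt_neqAle eq_sym v0 S0.
rewrite (key (gauss 0 (Num.sqrt v))); last first.
  by move=> A mA; rewrite gaussE /centered_normal (negbTE v0).
rewrite -[LHS](ge0_integral_std_affine 0 s0)//.
by apply: eq_integral => x _; rewrite addr0.
Qed.

Lemma gaussian_cos X S a (t : R) : gaussian X S ->
  (\int[P]_w cos ((a^T *m vec (X w)) 0 0 + t) = cos t * std_cos (quad S a))%R.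
Proof.
move=> XS; have S0 := XS.1.2 a.
have bP : bounded_measurable (fun w => cos ((a^T *m vec (X w)) 0 0 + t)).
  by apply: bmf_cos_comp; apply: measurable_funD => //; exact: measurable_lin_form.
have := @gaussian_ge0_integral X S a (fun x => (1 + cos (1 * x + t))%:E) XS.
rewrite [X in _ -> _ -> X = _]EFin_Rintegral; last first.
  by apply: bmf_integrable; apply: bmfD (bmf_cst _ 1) _; under eq_fun do rewrite mul1r.
rewrite [X in _ -> _ -> _ = X]EFin_Rintegral; last first.
  by apply: bmf_integrable; apply: bmfD (bmf_cst _ 1) _; under eq_fun do rewrite mul1r; exact: bmf_cosR.
under [X in _ -> _ -> X%:E = _]eq_Rintegral do rewrite mul1r.
under [X in _ -> _ -> _ = X%:E]eq_Rintegral do rewrite mul1r.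
rewrite !bmf_RintegralD; try by [exact: bmf_cst|exact: bmf_cosR|exact: bP].
rewrite !Rintegral_prob_cst std_integral_cos sqr_sqrtr// => h.
have : 1 + (\int[P]_w cos ((a^T *m vec (X w)) 0 0 + t))%R = 1 + cos t * std_cos (quad S a).
  apply: EFin_inj; apply: h.
  - by apply/measurable_EFinP; apply: measurable_funD => //; exact: (bmf_cos _ _).1.
  - by move=> x; rewrite lee_fin -lerBlDl sub0r cos_geN1.
lra.
Qed.

Lemma gaussian_sqr X S a : gaussian X S ->
  (\int[P]_w (((a^T *m vec (X w)) 0 0) ^+ 2)%:E = (quad S a)%:E)%E.
Proof.
move=> XS; have S0 := XS.1.2 a.
rewrite (gaussian_ge0_integral a (F := fun x => (x ^+ 2)%:E) XS); last 2 first.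
- by apply/measurable_EFinP; exact: measurable_sqr.
- by move=> x; rewrite lee_fin sqr_ge0.
under eq_integral do rewrite exprMn sqr_sqrtr// EFinM.
rewrite [LHS]ge0_integralZl//; first by rewrite integral_std_sqr mule1.
- by apply/measurable_EFinP; exact: measurable_sqr.
- by move=> x _; rewrite lee_fin sqr_ge0.
Qed.

End gaussian_vectors.

(** * Second moments *)

Lemma delta_lin_form (R : realType) m (v : 'cV[R]_m) i : ((delta_mx i 0 : 'cV[R]_m)^T *m v) 0 0 = v i 0.
Proof.
rewrite lin_formE (bigD1 i)//= big1 ?addr0 => [|j /negbTE ji]; first by rewrite mxE !eqxx mul1r.
by rewrite mxE ji mul0r.
Qed.

(** Polarization, on sums of two basis vectors. *)
Lemma sym_quad_inj (R : realType) m (A B : 'M[R]_m) : A^T = A -> B^T = B ->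
  (forall v, quad A v = quad B v) -> A = B.
Proof.
move=> At Bt AB.
have e (M : 'M[R]_m) (p q : 'I_m) :
    (((delta_mx p 0 : 'cV[R]_m)^T *m M *m (delta_mx q 0 : 'cV[R]_m)) 0 0 : R) = M p q.
  rewrite -mulmxA delta_lin_form mxE (bigD1 q)//= big1 ?addr0 => [|l /negbTE lq].
    by rewrite mxE !eqxx mulr1.
  by rewrite mxE lq mulr0.
have qd (M : 'M[R]_m) i j : quad M (delta_mx i 0 + delta_mx j 0) = M i i + M i j + M j i + M j j.
  have tD (u v : 'cV[R]_m) : (u + v)^T = u^T + v^T by apply/matrixP => p q; rewrite !mxE.
  rewrite /quad tD !(mulmxDl, mulmxDr).
  by rewrite [LHS]mxE [X in X + _]mxE [X in _ + X]mxE !e; ring.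
have qd1 (M : 'M[R]_m) i : quad M (delta_mx i 0) = M i i.
  exact: e.
apply/matrixP => i j; have := AB (delta_mx i 0 + delta_mx j 0); rewrite !qd.
have := AB (delta_mx i 0); have := AB (delta_mx j 0); rewrite !qd1 => -> ->.
have -> : A j i = A i j by rewrite -[in RHS]At mxE.
have -> : B j i = B i j by rewrite -[in RHS]Bt mxE.
lra.
Qed.

Section square_integrable.
Context d (T : measurableType d) (R : realType) (P : probability T R).
Implicit Types (f g : T -> R).

Definition L2 f := measurable_fun setT f /\
  P.-integrable setT (EFin \o (fun w => f w ^+ 2)).

Lemma L2_mul_integrable f g : L2 f -> L2 g ->
  P.-integrable setT (EFin \o (fun w => f w * g w)).
Proof.
move=> [mf fi] [mg gi]; apply: (@le_integrable _ _ _ P setT measurableT _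
  (EFin \o (fun w => f w ^+ 2 + g w ^+ 2))).
- by apply/measurable_EFinP; exact: measurable_funM.
- move=> w _; rewrite /= lee_fin [leRHS]ger0_norm ?addr_ge0 ?sqr_ge0//.
  by rewrite ler_norml; apply/andP; split; nra.
- exact: integrableDr.
Qed.

Lemma L2_bmf f : bounded_measurable f -> L2 f.
Proof.
move=> bf; split; first exact: bf.1.
by have := bmf_integrable P (bmfM bf bf); congr integrable; apply/funext => w.
Qed.

Lemma L2D f g : L2 f -> L2 g -> L2 (fun w => f w + g w).
Proof.
move=> Lf Lg; split; first exact: measurable_funD Lf.1 Lg.1.
have := integrableDr (integrableDr Lf.2 Lg.2) (integrableZr 2 (L2_mul_integrable Lf Lg)).
by congr integrable; apply/funext => w /=; congr EFin; ring.
Qed.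

Lemma L2M f g : L2 f -> bounded_measurable g -> L2 (fun w => g w * f w).
Proof.
move=> [mf fi] [mg [M gM]]; split; first exact: measurable_funM.
apply: (@le_integrable _ _ _ P setT measurableT _
  (EFin \o (fun w => M ^+ 2 * f w ^+ 2))).
- by apply/measurable_EFinP; apply: measurable_funX; exact: measurable_funM.
- move=> w _; rewrite /= lee_fin [leLHS]ger0_norm ?sqr_ge0// [leRHS]ger0_norm ?(mulr_ge0 (sqr_ge0 _) (sqr_ge0 _))//.
  rewrite exprMn ler_wpM2r ?sqr_ge0// -[leLHS]real_normK ?num_real//.
  by rewrite lerXn2r ?nnegrE// (le_trans _ (gM w)).
- exact: integrableZr.
Qed.

Lemma L2Z c f : L2 f -> L2 (fun w => c * f w).
Proof. by move=> Lf; apply: L2M => //; exact: bmf_cst. Qed.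

Lemma L2_sum (I : Type) (r : seq I) (F : I -> T -> R) :
  (forall i, L2 (F i)) -> L2 (fun w => \sum_(i <- r) F i w).
Proof.
move=> LF; elim: r => [|i r IH].
  by under eq_fun do rewrite big_nil; apply: L2_bmf; exact: bmf_cst.
by under eq_fun do rewrite big_cons; exact: L2D.
Qed.

Lemma L2_integrable f : L2 f -> P.-integrable setT (EFin \o f).
Proof.
move=> Lf; have := L2_mul_integrable (L2_bmf (bmf_cst _ 1)) Lf.
by congr integrable; apply/funext => w /=; rewrite mul1r.
Qed.

Lemma Rintegral_sum (I : Type) (r : seq I) (F : I -> T -> R) :
  (forall i, P.-integrable setT (EFin \o F i)) ->
  P.-integrable setT (EFin \o (fun w => \sum_(i <- r) F i w)) /\
  (\int[P]_w (\sum_(i <- r) F i w) = \sum_(i <- r) \int[P]_w F i w)%R.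
Proof.
move=> iF; elim: r => [|i r [IH1 IH2]].
  rewrite big_nil; split.
    by under eq_fun do rewrite big_nil; exact: bmf_integrable (bmf_cst _ 0).
  by under eq_Rintegral do rewrite big_nil; rewrite Rintegral_prob_cst.
split; first by under eq_fun do rewrite big_cons; exact: integrableDr.
rewrite big_cons -IH2 -RintegralD//.
by apply: eq_Rintegral => w _; rewrite big_cons.
Qed.

Definition L2v m (Y : T -> 'cV[R]_m) := forall i, L2 (fun w => Y w i 0).

Definition cov2 m n (Y : T -> 'cV[R]_m) (Z : T -> 'cV[R]_n) : 'M[R]_(m, n) :=
  \matrix_(i, j) (\int[P]_w (Y w i 0 * Z w j 0))%R.

Lemma L2vD m (Y Z : T -> 'cV[R]_m) : L2v Y -> L2v Z -> L2v (fun w => Y w + Z w).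
Proof. by move=> LY LZ i; under eq_fun do rewrite mxE; exact: L2D. Qed.

Lemma L2v_mul m n (A : 'M[R]_(m, n)) (Y : T -> 'cV[R]_n) :
  L2v Y -> L2v (fun w => A *m Y w).
Proof.
move=> LY i; under eq_fun do rewrite mxE.
by apply: L2_sum => j; exact: L2Z.
Qed.

Lemma L2vN m (Y : T -> 'cV[R]_m) : L2v Y -> L2v (fun w => - Y w).
Proof.
move=> LY i; under eq_fun do rewrite mxE -mulN1r; exact: L2Z.
Qed.

Lemma L2vB m (Y Z : T -> 'cV[R]_m) : L2v Y -> L2v Z -> L2v (fun w => Y w - Z w).
Proof. by move=> LY LZ; apply: L2vD => //; exact: L2vN. Qed.

Lemma cov2T m n (Y : T -> 'cV[R]_m) (Z : T -> 'cV[R]_n) : (cov2 Y Z)^T = cov2 Z Y.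
Proof.
by apply/matrixP => i j; rewrite !mxE; apply: eq_Rintegral => w _; rewrite mulrC.
Qed.

Lemma cov2Dl m n (Y Y' : T -> 'cV[R]_m) (Z : T -> 'cV[R]_n) : L2v Y -> L2v Y' -> L2v Z ->
  cov2 (fun w => Y w + Y' w) Z = cov2 Y Z + cov2 Y' Z.
Proof.
move=> LY LY' LZ; apply/matrixP => i j; rewrite !mxE -RintegralD//; try exact: L2_mul_integrable.
by apply: eq_Rintegral => w _; rewrite mxE mulrDl.
Qed.

Lemma cov2_mull m n p (A : 'M[R]_(m, n)) (Y : T -> 'cV[R]_n) (Z : T -> 'cV[R]_p) :
  L2v Y -> L2v Z -> cov2 (fun w => A *m Y w) Z = A *m cov2 Y Z.
Proof.
move=> LY LZ; apply/matrixP => i j; rewrite !mxE.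
have [_ e] := Rintegral_sum (index_enum 'I_n) (fun l => integrableZr (A i l) (L2_mul_integrable (LY l) (LZ j))).
transitivity (\sum_l (\int[P]_w (A i l * (Y w l 0 * Z w j 0)))%R).
  rewrite -e; apply: eq_Rintegral => w _; rewrite mxE mulr_suml.
  by apply: eq_bigr => l _; rewrite mulrA.
by apply: eq_bigr => l _; rewrite mxE RintegralZl//; exact: L2_mul_integrable.
Qed.

Lemma cov2Dr m n (Y : T -> 'cV[R]_m) (Z Z' : T -> 'cV[R]_n) : L2v Y -> L2v Z -> L2v Z' ->
  cov2 Y (fun w => Z w + Z' w) = cov2 Y Z + cov2 Y Z'.
Proof. by move=> *; rewrite -cov2T cov2Dl// linearD/= !cov2T. Qed.

Lemma cov2_mulr m n p (A : 'M[R]_(m, n)) (Y : T -> 'cV[R]_n) (Z : T -> 'cV[R]_p) :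
  L2v Y -> L2v Z -> cov2 Z (fun w => A *m Y w) = cov2 Z Y *m A^T.
Proof. by move=> *; rewrite -cov2T cov2_mull// trmx_mul cov2T. Qed.

Lemma quad_cov2 m (M : 'M[R]_m) (Y : T -> 'cV[R]_m) : L2v Y ->
  P.-integrable setT (EFin \o (fun w => quad M (Y w))) /\
  (\int[P]_w quad M (Y w))%R = \tr (M *m cov2 Y Y).
Proof.
move=> LY.
have qE w : quad M (Y w) = \sum_i \sum_j M i j * (Y w j 0 * Y w i 0).
  rewrite /quad -mulmxA mxE; apply: eq_bigr => i _.
  rewrite !mxE mulr_sumr; apply: eq_bigr => j _; ring.
have i1 i := Rintegral_sum (index_enum 'I_m) (fun j => integrableZr (M i j) (L2_mul_integrable (LY j) (LY i))).
have [i2 e2] := Rintegral_sum (index_enum 'I_m) (fun i => (i1 i).1).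
split; first by under eq_fun do rewrite qE.
under eq_Rintegral do rewrite qE.
rewrite e2 /mxtrace; apply: eq_bigr => i _; rewrite (i1 i).2 mxE; apply: eq_bigr => j _.
by rewrite RintegralZl ?mxE//; exact: L2_mul_integrable.
Qed.

Lemma psd_cov2 m (Y : T -> 'cV[R]_m) : L2v Y -> psd (cov2 Y Y).
Proof.
move=> LY; split; first by rewrite cov2T.
move=> v; have -> : quad (cov2 Y Y) v = cov2 (fun w => v^T *m Y w) (fun w => v^T *m Y w) 0 0.
  by rewrite cov2_mull ?cov2_mulr ?trmxK ?mulmxA//; exact: L2v_mul.
by rewrite mxE; apply: Rintegral_ge0 => w _; rewrite -expr2 sqr_ge0.
Qed.

End square_integrable.

Section gaussian_moments.
Context d (T : measurableType d) (R : realType) (P : probability T R) (k : nat).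
Context (X : {RV P >-> k.-tuple R}) (S : 'M[R]_k) (XS : gaussian X S).

Lemma gaussian_L2v : L2v P (fun w => vec (X w)).
Proof.
move=> i; split; first by under eq_fun do rewrite mxE; exact: measurable_tnth_RV.
have e w : vec (X w) i 0 = ((delta_mx i 0 : 'cV[R]_k)^T *m vec (X w)) 0 0.
  by rewrite delta_lin_form.
under eq_fun do rewrite e.
apply: ge0_integrable (gaussian_sqr _ XS).
  by apply: measurable_funX; exact: measurable_lin_form.
by move=> w; exact: sqr_ge0.
Qed.

Lemma gaussian_cov2 : cov2 P (fun w => vec (X w)) (fun w => vec (X w)) = S.
Proof.
have LX := gaussian_L2v; apply: sym_quad_inj; [exact: cov2T|exact: XS.1.1|].
move=> v; have -> : quad (cov2 P (fun w => vec (X w)) (fun w => vec (X w))) v =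
    cov2 P (fun w => v^T *m vec (X w)) (fun w => v^T *m vec (X w)) 0 0.
  by rewrite cov2_mull ?cov2_mulr ?trmxK ?mulmxA//; exact: L2v_mul.
rewrite mxE; apply: EFin_inj; rewrite -(gaussian_sqr v XS) EFin_Rintegral.
  by congr EFin; apply: eq_Rintegral => w _; rewrite expr2.
exact: (L2v_mul (v^T) LX 0).2.
Qed.

(** The forms of [a] and [- a] have the same variance, so 1 + X_i and 1 - X_i have equal second
    moments; the difference of these is four times the mean. Squares keep the integrands
    nonnegative. *)
Lemma gaussian_mean i : (\int[P]_w vec (X w) i 0 = 0)%R.
Proof.
pose a : 'cV[R]_k := delta_mx i 0.
have e w : vec (X w) i 0 = (a^T *m vec (X w)) 0 0.
  by rewrite delta_lin_form.
have LX := gaussian_L2v i.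
have iX := L2_integrable LX.
have exp2 (s : R) : s ^+ 2 = 1 -> (\int[P]_w ((1 + s * vec (X w) i 0) ^+ 2)%:E =
    (1 + 2 * s * (\int[P]_w vec (X w) i 0) + \int[P]_w (vec (X w) i 0 ^+ 2))%R%:E)%E.
  move=> s2; rewrite [LHS]EFin_Rintegral; last exact: (L2D (L2_bmf P (bmf_cst _ 1)) (L2Z s LX)).2.
  congr EFin; rewrite -[X in X + _ + _](Rintegral_prob_cst P) -RintegralZl// -RintegralD//; last 2 first.
  - exact: bmf_integrable (bmf_cst _ 1).
  - exact: integrableZr.
  rewrite -RintegralD//; last 2 first.
  - by apply: integrableDr; [exact: bmf_integrable (bmf_cst _ 1)|exact: integrableZr].
  - exact: LX.2.
  by apply: eq_Rintegral => w _; rewrite sqrrD exprMn s2; ring.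
have m1 : measurable_fun setT (fun x : R => ((1 + x) ^+ 2)%:E).
  by apply/measurable_EFinP; apply: measurable_funX; exact: measurable_funD.
have p1 (x : R) : (0 <= ((1 + x) ^+ 2)%:E)%E by rewrite lee_fin sqr_ge0.
have := exp2 1; have := exp2 (-1).
rewrite sqrrN expr1n => /(_ erefl) e1 /(_ erefl) e2.
have h1 := gaussian_ge0_integral a XS m1 p1.
have h2 := gaussian_ge0_integral (- a) XS m1 p1.
have aN : (- a)^T = - a^T by apply/matrixP => p q; rewrite !mxE.
have qN : quad S (- a) = quad S a by rewrite /quad aN !mulNmx mulmxN opprK.
rewrite qN -h1 in h2.
have e3 : (\int[P]_w ((1 + (-1) * vec (X w) i 0) ^+ 2)%:E = \int[P]_w ((1 + 1 * vec (X w) i 0) ^+ 2)%:E)%E.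
  etransitivity; [etransitivity; [|exact: h2]|].
    by apply: eq_integral => w _; rewrite e aN mulNmx [in RHS]mxE mulN1r.
  by apply: eq_integral => w _; rewrite e mul1r.
move: e1 e2; rewrite e3 => -> [].
lra.
Qed.

End gaussian_moments.

(** * Whitening *)

Lemma measurable_forall d (T : measurableType d) (I : finType) (F : I -> set T) : (forall i, measurable (F i)) ->
  measurable [set w | forall i, F i w].
Proof.
move=> mF; rewrite (_ : [set w | _] = \bigcap_(i in setT) F i).
  by apply: fin_bigcap_measurable => // i _; exact: mF.
by apply/seteqP; split => w h i //; exact: h.
Qed.

Section finite_rectangles.
Context d (T : measurableType d) (R : realType).

(** Rectangles are a pi-system that generates the product sigma-algebra. Independence of blocks and
    the laws of the test channel are all reduced to rectangles through this. *)
Lemma tuple_measure_unique n (m1 m2 : {measure set n.-tuple T -> \bar R}) :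
  (m1 setT < +oo)%E ->
  (forall C : 'I_n -> set T, (forall i, measurable (C i)) ->
    m1 [set x | forall i, C i (tnth x i)] = m2 [set x | forall i, C i (tnth x i)]) ->
  forall A, measurable A -> m1 A = m2 A.
Proof.
move=> m1T m12 A mA.
pose G : set (set (n.-tuple T)) := [set B | exists2 C : 'I_n -> set T,
  (forall i, measurable (C i)) & B = [set x | forall i, C i (tnth x i)]].
have GT : G setT.
  by exists (fun=> setT) => //; apply/seteqP; split.
apply: (measure_unique G (fun=> setT)) => //.
- apply/seteqP; split=> B.
    apply: smallest_sub; first exact: smallest_sigma_algebra.
    move=> {}B; rewrite -bigcup_seq => -[i _ [Y mY <-]]; apply: sub_sigma_algebra.
    exists (fun j => if j == i then Y else setT) => [j|]; first by case: ifP.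
    rewrite setTI; apply/seteqP; split => x /=; last by move=> /(_ i); rewrite eqxx.
    by move=> Yx j; case: eqP => [->|].
  apply: smallest_sub; first exact: sigma_algebra_measurable.
  move=> {}B [C mC ->].
  apply: (measurable_forall (F := fun i => (@tnth n T ^~ i) @^-1` C i)) => i.
  by rewrite -[X in measurable X]setTI; exact: measurable_tnth.
- move=> _ _ [C mC ->] [D mD ->]; exists (fun i => C i `&` D i).
    by move=> i; exact: measurableI.
  apply/seteqP; split => x /=; first by move=> [h1 h2] i; split.
  by move=> h; split=> i; have [] := h i.
- by apply/seteqP; split => // x _; exists 0%N.
- by move=> B [C mC ->]; exact: m12.
Qed.

End finite_rectangles.

Section iid_normal_sets.
Context d (T : measurableType d) (R : realType) (P : probability T R).
Context (J : finType) (W : J -> T -> R).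
Hypothesis mW : forall j, measurable_fun setT (W j).

Lemma iid_normalP : iid_normal P W <->
  forall A : J -> set R, (forall j, measurable (A j)) ->
  P [set w | forall j, A j (W j w)] = (\prod_j fine (gauss (0 : R) 1 (A j)))%:E.
Proof.
have mWA (A : J -> set R) : (forall j, measurable (A j)) -> measurable [set w | forall j, A j (W j w)].
  move=> mA; apply: measurable_forall => j.
  by rewrite -[X in measurable X]setTI; exact: mW.
have key (A : J -> set R) : (forall j, measurable (A j)) ->
    (\int[P]_w (\prod_j \1_(A j) (W j w)))%R = fine (P [set w | forall j, A j (W j w)]).
  move=> mA; rewrite /Rintegral -(setIT [set w | _]) -integral_indic//; last exact: mWA.
  congr fine; apply: eq_integral => w _; congr EFin; rewrite indicE.
  have [/set_mem h|h] := boolP (w \in _).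
    by rewrite big1// => j _; rewrite indicE mem_set//; exact: h.
  move: h; rewrite notin_setE => /existsNP[j nj]; rewrite (bigD1 j)//= indicE memNset//.
  by rewrite mul0r.
split=> [[_ h] A mA|h].
  by rewrite -h// key// fineK// fin_num_measure//; exact: mWA.
by split=> // A mA; rewrite key// h.
Qed.

End iid_normal_sets.

Section whitening.
Context d (T : measurableType d) (R : realType) (P : probability T R) (k : nat).
Context (S Q : 'M[R]_k) (SQ : S = Q *m Q^T) (Qu : Q \in unitmx).

Definition whiten (x : k.-tuple R) : 'cV[R]_k := invmx Q *m vec x.

Lemma measurable_whiten i : measurable_fun setT (fun x => whiten x i 0).
Proof.
under eq_fun do rewrite mxE; apply: measurable_sum => j; apply: measurable_funM => //.
by under eq_fun do rewrite mxE; exact: measurable_tnth.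
Qed.

Lemma measurable_whiten_RV (X : {RV P >-> k.-tuple R}) i :
  measurable_fun setT (fun w => whiten (X w) i 0).
Proof.
apply: (measurableT_comp (f := fun x => whiten x i 0)); first exact: measurable_whiten.
exact: measurable_funPT.
Qed.

Lemma vec_whiten x : vec x = Q *m whiten x.
Proof. by rewrite mulmxA mulmxV// mul1mx. Qed.

Lemma whiten_iid (X : {RV P >-> k.-tuple R}) : gaussian X S ->
  iid_normal P (fun i w => whiten (X w) i 0).
Proof.
move=> XS; apply: cramer_wold; first by move=> i; exact: measurable_whiten_RV.
move=> a t; pose av : 'cV[R]_k := \col_i a i.
have e w : \sum_j a j * whiten (X w) j 0 = (((invmx Q)^T *m av)^T *m vec (X w)) 0 0.
  rewrite trmx_mul trmxK -mulmxA -/(whiten _) lin_formE.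
  by apply: eq_bigr => j _; rewrite [av _ _]mxE.
under eq_Rintegral do rewrite e.
rewrite (gaussian_cos _ _ XS); congr (_ * std_cos _).
rewrite /quad SQ trmx_mul trmxK !mulmxA mulmxKV// -(mulmxA _ Q^T) -trmx_mul mulVmx//.
rewrite trmx1 mulmx1 lin_formE; apply: eq_bigr => j _.
by rewrite !mxE expr2.
Qed.

Context (X V : nat -> {RV P >-> k.-tuple R}).
Hypothesis hX : forall t, gaussian (X t) S.
Hypothesis hiid : independent_seq P (fun t => pair_RV (X t) (V t)).

Lemma independent_seq_ord n (A : 'I_n -> set (k.-tuple R * k.-tuple R)) :
  (forall t, measurable (A t)) ->
  P [set w | forall t, A t (X t w, V t w)] =
    (\prod_(t < n) P [set w | A t (X t w, V t w)])%E.
Proof.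
move=> mA.
pose A' t := if insub t is Some t' then A t' else setT.
have A'E (t : 'I_n) : A' t = A t by rewrite /A' valK.
have mA' t : measurable (A' t) by rewrite /A'; case: insub => // t'.
have := hiid (iota_uniq 0 n) mA'.
have -> : (\prod_(t <- iota 0 n) P (pair_RV (X t) (V t) @^-1` A' t))%E =
    (\prod_(t < n) P [set w | A t (X t w, V t w)])%E.
  rewrite -{1}(subn0 n) -/(index_iota 0 n) big_mkord.
  by apply: eq_bigr => t _; rewrite A'E.
move=> <-; congr (P _); apply/seteqP; split => w /=.
  move=> h t /=; rewrite mem_iota => /andP[_ tn].
  by have := h (Ordinal tn); rewrite -A'E.
by move=> h t; rewrite -A'E; apply: h; rewrite /= mem_iota/=.
Qed.

Lemma block_iid n : iid_normal P (fun (ti : 'I_n * 'I_k) w => whiten (X ti.1 w) ti.2 0).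
Proof.
apply/iid_normalP => [ti|A mA]; first exact: measurable_whiten_RV.
pose B (t : 'I_n) : set (k.-tuple R * k.-tuple R) :=
  [set xv | forall i, A (t, i) (whiten xv.1 i 0)].
have mB t : measurable (B t).
  apply: measurable_forall => i.
  rewrite -[X in measurable X]setTI.
  exact: (measurableT_comp (measurable_whiten i) measurable_fst).
transitivity (P [set w | forall t, B t (X t w, V t w)]).
  by congr (P _); apply/seteqP; split => w /= h; [move=> t i; exact: h (t, i)|case=> t i; exact: h].
rewrite independent_seq_ord//.
have Bt t : P [set w | B t (X t w, V t w)] = (\prod_i fine (gauss (0 : R) 1 (A (t, i))))%:E.
  have /iid_normalP h := whiten_iid (hX t).
  by apply: h => // i; exact: measurable_whiten_RV.
rewrite (eq_bigr _ (fun t _ => Bt t)).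
rewrite prodEFin; congr EFin; rewrite pair_big/=.
by apply: eq_bigr => -[].
Qed.

Lemma state_block_measurable n : measurable_fun setT (state_block X n).
Proof.
apply/measurable_fun_tnthP => i; rewrite (_ : _ \o _ = X i); first exact: measurable_funPT.
by apply/funext => w /=; rewrite tnth_mktuple.
Qed.

Hypothesis hXV : forall t, independent2 P (X t) (V t).

(** Both sides are measures in the event on the block, so rectangles suffice. There, independence of
    the pairs at different times gives a product in which [B] occurs in the factor at time [t] only,
    and independence within that pair splits it off. *)
Lemma block_noise_independent n (t : 'I_n) : independent2 P (state_block X n) (V t).
Proof.
move=> A B mA mB; have mS := @state_block_measurable n.
have mV : measurable (V t @^-1` B).
  by rewrite -[X in measurable X]setTI; exact: measurable_funPT.
have p0 : (0 <= fine (P (V t @^-1` B))) by rewrite fine_ge0.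
have pE : P (V t @^-1` B) = (fine (P (V t @^-1` B)))%:E by rewrite fineK// fin_num_measure.
pose m1 : {measure set n.-tuple (k.-tuple R) -> \bar R} :=
  measure_function_pushforward__canonical__measure_function_Measure (mrestr P mV) mS.
pose m2 : {measure set n.-tuple (k.-tuple R) -> \bar R} := mscale (NngNum p0)
  (measure_function_pushforward__canonical__measure_function_Measure P mS).
suff : m1 A = m2 A by rewrite /m1 /m2 /= /mscale /= /pushforward /mrestr /= -pE muleC.
apply: tuple_measure_unique => //.
  rewrite /m1 /= /pushforward /mrestr /= setTI.
  exact: le_lt_trans (probability_le1 _ _) (ltry 1).
move=> C mC; rewrite /m1 /m2 /= /mscale /= /pushforward /mrestr /= -pE.
have sE w (s : 'I_n) : tnth (state_block X n w) s = X s w by rewrite tnth_mktuple.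
pose C1 (s : 'I_n) : set (k.-tuple R * k.-tuple R) := C s `*` setT.
pose C2 (s : 'I_n) : set (k.-tuple R * k.-tuple R) := C s `*` (if s == t then B else setT).
have := @independent_seq_ord n C1 (fun s => measurableX (mC s) measurableT).
have := @independent_seq_ord n C2 (fun s => measurableX (mC s) _).
have mBs s : measurable (if s == t then B else setT) by case: ifP.
move=> /(_ mBs) h2 h1.
rewrite (_ : state_block X n @^-1` _ `&` _ = [set w | forall s, C2 s (X s w, V s w)]); last first.
  apply/seteqP; split => w /=.
    by move=> [h Bw] s; split => /=; [rewrite -sE; exact: h|case: eqP => // ->].
  by move=> h; split => [s|]; [rewrite sE; exact: (h s).1|have [_] := h t; rewrite /= eqxx].
rewrite (_ : state_block X n @^-1` _ = [set w | forall s, C1 s (X s w, V s w)]); last first.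
  apply/seteqP; split => w /=; first by move=> h s; split => //=; rewrite -sE; exact: h.
  by move=> h s; rewrite sE; exact: (h s).1.
rewrite h1 h2 (bigD1 t)//= [in RHS](bigD1 t)//= muleA; congr (_ * _)%E.
  rewrite /C2 /C1 eqxx muleC.
  have := hXV t (mC t) mB; rewrite [X in P X](_ : _ = [set w | (C t `*` B) (X t w, V t w)])//.
  move=> ->; congr (P _ * _)%E.
  by apply/seteqP; split => w //= [].
apply: eq_bigr => s /negbTE st; rewrite /C2 /C1 st.
by [].
Qed.

End whitening.

(** * Best responses *)

Section psd_theory.
Context (R : realType) (k : nat).
Implicit Types A B : 'M[R]_k.

Lemma trmxD_mx m n (A B : 'M[R]_(m, n)) : (A + B)^T = A^T + B^T.
Proof. by apply/matrixP => i j; rewrite !mxE. Qed.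

Lemma trmxZ_mx m n a (A : 'M[R]_(m, n)) : (a *: A)^T = a *: A^T.
Proof. by apply/matrixP => i j; rewrite !mxE. Qed.

Lemma quadD A B v : quad (A + B) v = quad A v + quad B v.
Proof. by rewrite /quad mulmxDr mulmxDl mxE. Qed.

Lemma quadZ a A v : quad (a *: A) v = a * quad A v.
Proof. by rewrite /quad -scalemxAr -scalemxAl mxE. Qed.

Lemma quadB A B v : quad (A - B) v = quad A v - quad B v.
Proof. by rewrite quadD -scaleN1r quadZ mulN1r. Qed.

Lemma psdD A B : psd A -> psd B -> psd (A + B).
Proof.
move=> [At A0] [Bt B0]; split; first by rewrite trmxD_mx At Bt.
by move=> v; rewrite quadD addr_ge0.
Qed.

Lemma psdZ a A : 0 <= a -> psd A -> psd (a *: A).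
Proof.
move=> a0 [At A0]; split; first by rewrite trmxZ_mx At.
by move=> v; rewrite quadZ mulr_ge0.
Qed.

Lemma psd_sum (I : Type) (r : seq I) (F : I -> 'M[R]_k) :
  (forall i, psd (F i)) -> psd (\sum_(i <- r) F i).
Proof. by move=> F0; elim/big_rec: _ => [|i A _]; [exact: psd0|exact: psdD]. Qed.

End psd_theory.

Section trace.
Context (R : realType) (k : nat).
Implicit Types (W A B : 'M[R]_k).

Lemma tr_mulZ W a A : \tr (W *m (a *: A)) = a * \tr (W *m A).
Proof. by rewrite -scalemxAr mxtraceZ. Qed.

Lemma tr_mulD W A B : \tr (W *m (A + B)) = \tr (W *m A) + \tr (W *m B).
Proof. by rewrite mulmxDr mxtraceD. Qed.

Lemma tr_mul_sum W (I : Type) (r : seq I) (p : pred I) (F : I -> 'M[R]_k) :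
  \tr (W *m \sum_(i <- r | p i) F i) = \sum_(i <- r | p i) \tr (W *m F i).
Proof. by rewrite mulmx_sumr raddf_sum. Qed.

Lemma block_avg_cst n A : (0 < n)%N -> A = n%:R^-1 *: \sum_(t < n) A.
Proof.
move=> n0; have nn0 : (n%:R : R) != 0 by rewrite pnatr_eq0 -lt0n.
by rewrite sumr_const card_ord -(scaler_nat n A) scalerA mulVf// scale1r.
Qed.

End trace.

Section best_responses.
Context d (T : measurableType d) (R : realType) (P : probability T R).
Context (k : nat) (X V : nat -> {RV P >-> k.-tuple R}).
Context (B SX SV We : 'M[R]_k).
Hypothesis hWe : We^T = We.
Hypothesis hX : forall t, gaussian (X t) SX.
Hypothesis hV : forall t, gaussian (V t) SV.
Hypothesis hXV : forall t, independent2 P (X t) (V t).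
Hypothesis hiid : independent_seq P (fun t => pair_RV (X t) (V t)).

HB.instance Definition _ n :=
  isMeasurableFun.Build _ _ _ _ (state_block X n) (@state_block_measurable _ _ _ _ _ X n).

Context (n : nat) (f : n.-tuple (k.-tuple R) -> nat) (N : nat).
Hypothesis mf : measurable_fun setT f.
Hypothesis fN : forall x, (f x <= N)%N.
Implicit Types g : nat -> 'I_n -> 'cV[R]_k.

(** With finitely many messages, every function of the message is bounded; this is what makes all
    estimates square integrable. *)
Lemma bmf_code_tuple (G : nat -> R) : bounded_measurable (fun x => G (f x)).
Proof.
split; first by apply: (measurableT_comp (f := G)) => // _ B' _.
exists (\sum_(m < N.+1) `|G m|) => x.
have fx : (f x < N.+1)%N by rewrite ltnS.
by rewrite (bigD1 (Ordinal fx))//= lerDl sumr_ge0.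
Qed.

Lemma bmf_code (G : nat -> R) : bounded_measurable (fun w => G (f (state_block X n w))).
Proof.
apply: (@bmf_comp _ _ _ _ _ (fun x => G (f x)) (state_block X n)); first exact: state_block_measurable.
exact: bmf_code_tuple.
Qed.

Definition code_error g (t : 'I_n) (w : T) : 'cV[R]_k := vec (X t w) - estimate X f g t w.

Lemma L2v_estimate g t : L2v P (estimate X f g t).
Proof. by move=> i; apply: L2_bmf; exact: (bmf_code (fun m => g m t i 0)). Qed.

Lemma L2v_code_error g t : L2v P (code_error g t).
Proof. by apply: L2vB; [exact: gaussian_L2v (hX t)|exact: L2v_estimate]. Qed.

(** Equivalently, the estimate at [t] is a version of E[X_t | M]: the message is discrete, so
    testing the error against all functions [G] of it is testing against its sigma-algebra. *)
Definition orthogonal_code g := forall (t : 'I_n) (G : nat -> R) i,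
  (\int[P]_w (G (f (state_block X n w)) * code_error g t w i 0) = 0)%R.

Lemma orthogonal_cov2 g (t : 'I_n) m (D : nat -> 'cV[R]_m) : orthogonal_code g ->
  cov2 P (fun w => D (f (state_block X n w))) (code_error g t) = 0.
Proof.
move=> og; apply/matrixP => i j; rewrite !mxE.
exact: (og t (fun m => D m i 0) j).
Qed.

Lemma L2v_code m (D : nat -> 'cV[R]_m) : L2v P (fun w => D (f (state_block X n w))).
Proof. by move=> i; apply: L2_bmf; exact: (bmf_code (fun m => D m i 0)). Qed.

Lemma cov2_pythagoras m (E D : T -> 'cV[R]_m) : L2v P E -> L2v P D -> cov2 P D E = 0 ->
  cov2 P (fun w => E w + D w) (fun w => E w + D w) = cov2 P E E + cov2 P D D.
Proof.
move=> LE LD DE; have ED : cov2 P E D = 0 by rewrite -cov2T DE trmx0.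
rewrite (cov2Dl LE LD (L2vD LE LD)) (cov2Dr LE LE LD) (cov2Dr LD LE LD).
by rewrite DE ED addr0 add0r.
Qed.

Lemma orthogonal_pythagoras g t (D : nat -> 'cV[R]_k) : orthogonal_code g ->
  cov2 P (fun w => code_error g t w + D (f (state_block X n w)))
         (fun w => code_error g t w + D (f (state_block X n w))) =
  cov2 P (code_error g t) (code_error g t) +
  cov2 P (fun w => D (f (state_block X n w))) (fun w => D (f (state_block X n w))).
Proof.
move=> og; apply: cov2_pythagoras; [exact: L2v_code_error|exact: L2v_code|].
exact: orthogonal_cov2.
Qed.

Definition block_error_cov g : 'M[R]_k :=
  n%:R^-1 *: \sum_(t < n) cov2 P (code_error g t) (code_error g t).

Lemma tr_mul_block_error_cov W g : \tr (W *m block_error_cov g) =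
  n%:R^-1 * \sum_(t < n) \tr (W *m cov2 P (code_error g t) (code_error g t)).
Proof. by rewrite /block_error_cov tr_mulZ tr_mul_sum. Qed.

Lemma block_distortionE (W : 'M[R]_k) (Y : 'I_n -> T -> 'cV[R]_k) :
  (forall t, L2v P (Y t)) ->
  (n%:R^-1%:E * \sum_(t < n) 'E_P[fun w => quad W (Y t w)])%E =
  (\tr (W *m (n%:R^-1 *: \sum_(t < n) cov2 P (Y t) (Y t))))%:E.
Proof.
move=> LY; rewrite tr_mulZ EFinM; congr (_ * _)%E.
rewrite tr_mul_sum -sumEFin; apply: eq_bigr => t _.
have [iq <-] := quad_cov2 W (LY t).
by rewrite unlock EFin_Rintegral.
Qed.

Lemma decoder_distortionE (Wd : 'M[R]_k) g :
  decoder_distortion X Wd f g = (\tr (Wd *m block_error_cov g))%:E.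
Proof. by apply: block_distortionE => t; exact: L2v_code_error. Qed.

(** By Pythagoras another reconstruction adds a positive semidefinite matrix to each error
    covariance, so conditional means are optimal for all such weights at once. It serves for the
    weight [Wd] of the decoder and for [K^-1] in the coding part. *)
Lemma orthogonal_code_best (W : 'M[R]_k) g g' : psd W -> orthogonal_code g ->
  \tr (W *m block_error_cov g) <= \tr (W *m block_error_cov g').
Proof.
move=> [_ W0] og; rewrite (tr_mul_block_error_cov W g) (tr_mul_block_error_cov W g').
rewrite ler_wpM2l ?invr_ge0//; apply: ler_sum => t _ /=.
have -> : code_error g' t = (fun w => code_error g t w +
    (fun m => g m t - g' m t) (f (state_block X n w))).
  by apply/funext => w; rewrite /code_error /estimate addrA subrK.
rewrite (orthogonal_pythagoras t (fun m => g m t - g' m t) og) tr_mulD lerDl.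
have [_ <-] := quad_cov2 W (L2v_code (fun m => g m t - g' m t)).
by apply: Rintegral_ge0 => w _; exact: W0.
Qed.

Lemma orthogonal_best_response (Wd : 'M[R]_k) g : psd Wd -> orthogonal_code g ->
  best_response X Wd f g.
Proof.
by move=> hW og g'; rewrite !decoder_distortionE lee_fin; exact: orthogonal_code_best.
Qed.

(** First variation. Let [c] be the correlation of the error with a test function [G] of the
    message, and shift the estimate at time [t] by s G c. Up to the factor 1/n the distortion
    changes by - 2 s c^T Wd c + s^2 b, which is negative for small s > 0 unless c = 0. *)
Lemma best_response_orthogonal (Wd : 'M[R]_k) g : posdef Wd ->
  best_response X Wd f g -> orthogonal_code g.
Proof.
move=> [Wt Wp] br t G.
have n0 : (0 < n)%N by apply: leq_ltn_trans (ltn_ord t).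
pose c : 'cV[R]_k := \col_i (\int[P]_w (G (f (state_block X n w)) * code_error g t w i 0))%R.
suff c0 : c = 0 by move=> i; move/matrixP: c0 => /(_ i 0); rewrite !mxE.
apply/eqP/negPn/negP => /Wp cW.
have LE := L2v_code_error g t.
pose D m : 'cV[R]_k := G m *: c; have LD := L2v_code D.
have covDE : cov2 P (fun w => D (f (state_block X n w))) (code_error g t) = c *m c^T.
  apply/matrixP => i j; rewrite !mxE big_ord1 !mxE -RintegralZl//; last first.
    exact: L2_mul_integrable (L2_bmf P (bmf_code G)) (LE j).
  by apply: eq_Rintegral => w _; rewrite !mxE mulrAC mulrC mulrA mulrAC.
pose b := \tr (Wd *m cov2 P (fun w => D (f (state_block X n w))) (fun w => D (f (state_block X n w)))).
have b0 : 0 <= b.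
  rewrite /b; have [_ <-] := quad_cov2 Wd LD; apply: Rintegral_ge0 => w _.
  exact: (posdef_psd (conj Wt Wp)).2.
have trc : \tr (Wd *m (c *m c^T)) = quad Wd c.
  by rewrite mulmxA mxtrace_mulC mulmxA /mxtrace big_ord1.
have key (s : R) : 0 <= - (2 * s * quad Wd c) + s ^+ 2 * b.
  pose g' m t' := if t' == t then g m t + s *: D m else g m t'.
  have := br g'; rewrite (decoder_distortionE Wd g) (decoder_distortionE Wd g') lee_fin.
  rewrite (tr_mul_block_error_cov Wd g) (tr_mul_block_error_cov Wd g').
  rewrite ler_pM2l ?invr_gt0 ?ltr0n//.
  rewrite (bigD1 t)//= [leRHS](bigD1 t)//=.
  have e' t' : t' != t -> \tr (Wd *m cov2 P (code_error g' t') (code_error g' t')) =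
      \tr (Wd *m cov2 P (code_error g t') (code_error g t')).
    move=> /negbTE tt'; suff -> : code_error g' t' = code_error g t' by [].
    by apply/funext => w; rewrite /code_error /estimate /g' tt'.
  rewrite (eq_bigr _ e') lerD2r {e'}.
  have -> : code_error g' t = (fun w => code_error g t w + (- s)%:M *m D (f (state_block X n w))).
    apply/funext => w; rewrite /code_error /estimate /g' eqxx mul_scalar_mx scaleNr.
    by rewrite opprD addrA.
  have LsD := L2v_mul (- s)%:M LD.
  have covED : cov2 P (code_error g t) (fun w => D (f (state_block X n w))) = c *m c^T.
    by rewrite -cov2T covDE trmx_mul trmxK.
  rewrite (cov2Dl LE LsD (L2vD LE LsD)) (cov2Dr LE LE LsD) (cov2Dr LsD LE LsD).
  rewrite (cov2_mull _ LD LE) (cov2_mull _ LD LsD) (cov2_mulr _ LD LE) (cov2_mulr _ LD LD) covDE covED tr_scalar_mx !mul_scalar_mx !mul_mx_scalar.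
  rewrite !tr_mulD !tr_mulZ -/b trc.
  by lra.
(* The minimizer is quad Wd c / b, but [b] may vanish; with b + 1 the value is still negative. *)
have := key (quad Wd c / (b + 1)).
have bp : 0 < b + 1 by lra.
have -> : - (2 * (quad Wd c / (b + 1)) * quad Wd c) + (quad Wd c / (b + 1)) ^+ 2 * b =
   - (quad Wd c ^+ 2 * (b + 2) / (b + 1) ^+ 2).
  by field; rewrite gt_eqF.
rewrite oppr_ge0 leNgt => /negP; apply.
by rewrite divr_gt0 ?exprn_gt0// mulr_gt0 ?exprn_gt0//; lra.
Qed.

Lemma orthogonal_code_exists : exists g, orthogonal_code g.
Proof.
pose p m := fine (P [set w | f (state_block X n w) = m]).
(* The mean of the state over the cell of message [m]. For a cell of probability 0 the quotient is 0
   by convention; the integral over such a cell vanishes whatever the value. *)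
pose g m (t : 'I_n) : 'cV[R]_k := \col_i
  ((\int[P]_w ((\1_[set m] (f (state_block X n w)) : R) * vec (X t w) i 0)) / p m)%R.
exists g => t G i.
have LX := gaussian_L2v (hX t) i.
have iX (H : nat -> R) : P.-integrable setT (EFin \o (fun w => H (f (state_block X n w)) * vec (X t w) i 0)).
  by apply: L2_mul_integrable => //; apply: L2_bmf; exact: bmf_code.
have mfm m : measurable [set w | f (state_block X n w) = m].
  have mS : measurable_fun setT (state_block X n) by exact: state_block_measurable.
  have := measurableT_comp mf mS; move=> /(_ measurableT [set m]); rewrite setTI.
  by apply.
have pE m : (\int[P]_w (\1_[set m] (f (state_block X n w)) : R))%R = p m.
  rewrite /Rintegral /p -[in RHS](setIT [set w | _]) -integral_indic//.
have one m : (\int[P]_w ((\1_[set m] (f (state_block X n w)) : R) * code_error g t w i 0))%R = 0.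
  transitivity (\int[P]_w (((\1_[set m] (f (state_block X n w)) : R) * vec (X t w) i 0) - g m t i 0 * \1_[set m] (f (state_block X n w))))%R.
    apply: eq_Rintegral => w _; rewrite !mxE indicE.
    have [/set_mem/= ->|_] := boolP (_ \in _); last by rewrite !mul0r mulr0 subr0.
    by rewrite !mul1r mulr1.
  rewrite RintegralB//; last by apply: integrableZr; apply: bmf_integrable; exact: bmf_code.
  rewrite RintegralZl//; last by apply: bmf_integrable; exact: bmf_code.
  rewrite pE mxE; have [p0|p0] := eqVneq (p m) 0; last by rewrite divfK// subrr.
  rewrite p0 mulr0 subr0; apply: (@EFin_inj R).
  rewrite -EFin_Rintegral; last exact: (iX (\1_[set m])).
  rewrite (_ : (fun w => _) = ((fun w => (vec (X t w) i 0)%:E) \_ [set w | f (state_block X n w) = m])).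
    rewrite -integral_mkcond null_set_integral//.
      by apply: measurable_funTS; apply/measurable_EFinP; exact: LX.1.
    by rewrite -[LHS]fineK ?fin_num_measure// -/(p m) p0.
  apply/funext => w; rewrite /patch indicE -[w \in _]/(f (state_block X n w) \in [set m]).
  by case: ifPn => _; rewrite ?mul1r ?mul0r.
have iE m : P.-integrable setT (EFin \o (fun w => (\1_[set m] (f (state_block X n w)) : R) * code_error g t w i 0)).
  apply: L2_mul_integrable; first by apply: L2_bmf; exact: bmf_code.
  exact: L2v_code_error.
have [_ e] := Rintegral_sum (index_enum 'I_N.+1) (fun m : 'I_N.+1 => integrableZr (G m) (iE m)).
transitivity (\int[P]_w (\sum_(m < N.+1) G m * ((\1_[set nat_of_ord m] (f (state_block X n w)) : R) * code_error g t w i 0)))%R.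
  apply: eq_Rintegral => w _.
  have fx : (f (state_block X n w) < N.+1)%N by rewrite ltnS.
  rewrite (bigD1 (Ordinal fx))//= indicE mem_set// mul1r big1 ?addr0// => m mf'.
  rewrite indicE memNset ?mul0r ?mulr0//= => e'; move/eqP: mf'; apply.
  by apply: val_inj.
rewrite e big1// => m _; rewrite RintegralZl ?one ?mulr0//.
Qed.

Lemma block_error_cov_psd g : psd (block_error_cov g).
Proof.
apply: psdZ; first by rewrite invr_ge0.
by apply: psd_sum => t; apply: psd_cov2; exact: L2v_code_error.
Qed.

Lemma cov2_state g t : orthogonal_code g ->
  SX = cov2 P (code_error g t) (code_error g t) +
       cov2 P (estimate X f g t) (estimate X f g t).
Proof.
move=> og; rewrite -(gaussian_cov2 (hX t)).
rewrite -(orthogonal_pythagoras t (fun m => g m t) og).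
by congr cov2; apply/funext => w; rewrite /code_error /estimate subrK.
Qed.

Lemma block_error_cov_le g : (0 < n)%N -> orthogonal_code g ->
  psd (SX - block_error_cov g).
Proof.
move=> n0 og.
have -> : SX - block_error_cov g =
    n%:R^-1 *: \sum_(t < n) cov2 P (estimate X f g t) (estimate X f g t).
  rewrite {1}(block_avg_cst SX n0).
  rewrite /block_error_cov -scalerBr -sumrB; congr (_ *: _); apply: eq_bigr => t _.
  by rewrite {1}(cov2_state t og) addrC addKr.
apply: psdZ; first by rewrite invr_ge0.
by apply: psd_sum => t; apply: psd_cov2; exact: L2v_estimate.
Qed.

Lemma noise_code_cov2 (t : 'I_n) m (H : n.-tuple (k.-tuple R) -> 'cV[R]_m) :
  L2v P (fun w => H (state_block X n w)) ->
  (forall i, measurable_fun setT (fun x => H x i 0)) ->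
  cov2 P (fun w => H (state_block X n w)) (fun w => vec (V t w)) = 0.
Proof.
move=> LH mH; apply/matrixP => i j; rewrite !mxE.
have mV : measurable_fun setT (fun v : k.-tuple R => vec v j 0).
  by under eq_fun do rewrite mxE; exact: measurable_tnth.
have := independent2_integral (block_noise_independent hiid hXV t) (mH i) mV
  (L2_integrable (LH i)) (L2_integrable (gaussian_L2v (hV t) j)).
by move=> ->; rewrite (gaussian_mean (hV t)) mulr0.
Qed.

(** The error of the encoder is V + (B - I) X + E, where E is the error of the decoder. The noise is
    independent of the whole block, hence uncorrelated with the rest; and the covariance of X with E
    is [K], because X is E plus the estimate, which is orthogonal to E. *)
Lemma encoder_error_cov2 g t : orthogonal_code g ->
  let K := cov2 P (code_error g t) (code_error g t) in
  let Y w := B *m vec (X t w) + vec (V t w) - estimate X f g t w in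
  L2v P Y /\ cov2 P Y Y =
    (B - 1%:M) *m SX *m (B - 1%:M)^T + SV + ((B - 1%:M) *m K + K *m (B - 1%:M)^T + K).
Proof.
move=> og K Y.
have LX : L2v P (fun w => vec (X t w)) by exact: gaussian_L2v.
have LV : L2v P (fun w => vec (V t w)) by exact: gaussian_L2v.
have LE := L2v_code_error g t.
pose A w := (B - 1%:M) *m vec (X t w) + code_error g t w.
have LBX := L2v_mul (B - 1%:M) LX.
have LA : L2v P A by exact: L2vD.
pose H (x : n.-tuple (k.-tuple R)) : 'cV[R]_k :=
  (B - 1%:M) *m vec (tnth x t) + (vec (tnth x t) - g (f x) t).
have HA : A = (fun w => H (state_block X n w)).
  by apply/funext => w; rewrite /A /H /code_error /estimate tnth_mktuple.
have mvec i : measurable_fun setT (fun x : n.-tuple (k.-tuple R) => vec (tnth x t) i 0).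
  under eq_fun do rewrite mxE.
  apply: (measurableT_comp (f := fun y : k.-tuple R => tnth y i)); exact: measurable_tnth.
have mH i : measurable_fun setT (fun x => H x i 0).
  under eq_fun do rewrite !mxE.
  apply: measurable_funD.
    by apply: measurable_sum => j; apply: measurable_funM => //; exact: mvec.
  apply: measurable_funB; first by have := mvec i; under eq_fun do rewrite mxE.
  exact: (bmf_code_tuple (fun m => g m t i 0)).1.
have AV : cov2 P A (fun w => vec (V t w)) = 0.
  by rewrite HA; apply: noise_code_cov2 => //; rewrite -HA.
have YE : Y = (fun w => vec (V t w) + A w).
  apply/funext => w; rewrite /Y /A /code_error mulmxBl mul1mx.
  move: (B *m vec (X t w)) (vec (V t w)) (vec (X t w)) (estimate X f g t w) => a b c e.
  by apply/matrixP => i j; rewrite !mxE; ring.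
split; first by rewrite YE; exact: L2vD.
rewrite YE (cov2_pythagoras LV LA AV) (gaussian_cov2 (hV t)).
have LH : L2v P (estimate X f g t) by exact: L2v_estimate.
have XE : cov2 P (fun w => vec (X t w)) (code_error g t) = K.
  have -> : (fun w => vec (X t w)) = (fun w => code_error g t w + estimate X f g t w).
    by apply/funext => w; rewrite /code_error subrK.
  by rewrite (cov2Dl LE LH LE) (orthogonal_cov2 t (fun m => g m t) og) addr0.
have EX : cov2 P (code_error g t) (fun w => vec (X t w)) = K by rewrite -cov2T XE cov2T.
rewrite /A (cov2Dl LBX LE LA) (cov2Dr LBX LBX LE) (cov2Dr LE LBX LE).
rewrite !(cov2_mull _ LX) // !(cov2_mulr _ LX) // XE EX (gaussian_cov2 (hX t)) -/K mulmxA.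
by rewrite addrA (addrA SV) (addrC SV) -!addrA.
Qed.

(** The origin of the modified weight: with D = B - I, cyclicity of the trace turns the cross terms
    We D K and We K D^T into (We D + D^T We) K. *)
Lemma encoder_distortionE g : (0 < n)%N -> orthogonal_code g ->
  encoder_distortion X V B We f g =
  (\tr (We *m ((B - 1%:M) *m SX *m (B - 1%:M)^T + SV)) +
   \tr ((We *m (B - 1%:M) + (B - 1%:M)^T *m We + We) *m block_error_cov g))%:E.
Proof.
move=> n0 og; rewrite /encoder_distortion /block_distortion block_distortionE => [|t]; last first.
  exact: (encoder_error_cov2 t og).1.
congr EFin; have tr3 (D K : 'M[R]_k) : \tr (We *m (D *m K + K *m D^T + K)) =
    \tr ((We *m D + D^T *m We + We) *m K).
  rewrite !tr_mulD !mulmxDl !mxtraceD !mulmxA; congr (_ + _ + _).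
  by rewrite mxtrace_mulC mulmxA.
rewrite tr_mul_block_error_cov tr_mulZ tr_mul_sum.
rewrite (eq_bigr _ (fun t _ => congr1 (fun A => \tr (We *m A)) (encoder_error_cov2 t og).2)).
under eq_bigr do rewrite tr_mulD tr3.
rewrite big_split/= mulrDr; congr (_ + _).
by rewrite -tr_mul_sum -tr_mulZ -block_avg_cst.
Qed.

End best_responses.

(** * Converse *)

Section congruence.
Context (R : realType) (k : nat) (Q : 'M[R]_k) (Qu : Q \in unitmx).
Implicit Types (l : 'rV[R]_k).

Lemma invmx_congr l : (forall i, l 0 i != 0) ->
  invmx (Q *m diag_mx l *m Q^T) = (invmx Q)^T *m diag_mx (\row_i (l 0 i)^-1) *m invmx Q.
Proof.
move=> l0; set A := _ *m Q^T; set C := RHS.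
have CA : C *m A = 1%:M.
  rewrite /A /C !mulmxA mulmxKV// -!mulmxA.
  rewrite (mulmxA (diag_mx _) (diag_mx l)) mulmx_diag.
  have -> : \row_i ((\row_i0 (l 0 i0)^-1) 0 i * l 0 i) = const_mx 1.
    by apply/rowP => i; rewrite !mxE mulVf.
  by rewrite diag_const_mx mul1mx -trmx_mul mulmxV// trmx1.
have [_ Au] := mulmx1_unit CA.
by rewrite -[LHS]mul1mx -CA -mulmxA mulmxV// mulmx1.
Qed.

Lemma det_congr l : \det (Q *m diag_mx l *m Q^T) = \det Q ^+ 2 * \prod_i l 0 i.
Proof. by rewrite !det_mulmx det_tr det_diag mulrAC expr2. Qed.

Lemma tr_diag_congr l (K : 'M[R]_k) :
  \tr ((invmx Q)^T *m diag_mx l *m invmx Q *m K) =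
  \sum_i l 0 i * (invmx Q *m K *m (invmx Q)^T) i i.
Proof.
rewrite -!mulmxA mxtrace_mulC -!mulmxA (mulmxA (invmx Q)).
by apply: eq_bigr => i _; rewrite mul_diag_mx mxE.
Qed.

Lemma quad_diag_congr l v : quad (Q *m diag_mx l *m Q^T) v = \sum_i l 0 i * (Q^T *m v) i 0 ^+ 2.
Proof.
rewrite /quad !mulmxA -[v^T *m Q]trmxK trmx_mul trmxK -mulmxA -(mulmxA _ (diag_mx l)).
rewrite mxE; apply: eq_bigr => i _; rewrite mul_diag_mx !mxE; ring.
Qed.

Lemma diag_congr_posdef l : posdef (Q *m diag_mx l *m Q^T) -> forall i, 0 < l 0 i.
Proof.
move=> [_ Kp] i; pose v : 'cV[R]_k := (invmx Q)^T *m delta_mx i 0.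
have Qv : Q^T *m v = delta_mx i 0 by rewrite mulmxA -trmx_mul mulVmx// trmx1 mul1mx.
have v0 : v != 0.
  apply: contraTneq isT => v0; move: Qv; rewrite v0 mulmx0 => /matrixP/(_ i 0)/eqP.
  by rewrite !mxE !eqxx/= eq_sym oner_eq0.
have := Kp v v0; rewrite quad_diag_congr (bigD1 i)//= Qv big1 => [|j /negbTE ji].
  by rewrite mxE !eqxx expr1n mulr1 addr0.
by rewrite mxE ji expr0n mulr0.
Qed.

Lemma diag_congr_psd l : psd (Q *m diag_mx l *m Q^T) -> forall i, 0 <= l 0 i.
Proof.
move=> [_ Kp] i; pose v : 'cV[R]_k := (invmx Q)^T *m delta_mx i 0.
have Qv : Q^T *m v = delta_mx i 0 by rewrite mulmxA -trmx_mul mulVmx// trmx1 mul1mx.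
have := Kp v; rewrite quad_diag_congr (bigD1 i)//= Qv big1 => [|j /negbTE ji].
  by rewrite mxE !eqxx expr1n mulr1 addr0.
by rewrite mxE ji expr0n mulr0.
Qed.

Lemma posdef_diag_congr l : (forall i, 0 < l 0 i) -> posdef (Q *m diag_mx l *m Q^T).
Proof.
move=> l0; split; first by rewrite !trmx_mul trmxK tr_diag_mx mulmxA.
move=> v v0; rewrite quad_diag_congr.
have Qtu : Q^T \in unitmx by rewrite unitmx_tr.
have [i vi] : exists i, (Q^T *m v) i 0 != 0.
  apply/existsP; apply: contra_neqT v0 => /existsPn vi.
  rewrite -[v]mul1mx -(mulVmx Qtu) -mulmxA; apply/eqP; rewrite -[X in _ == X](mulmx0 _ (invmx Q^T)).
  apply/eqP; congr mulmx; apply/matrixP => i j; rewrite ord1 [RHS]mxE.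
  exact/eqP/negPn/vi.
rewrite (bigD1 i)//= ltr_pwDl//; first by rewrite mulr_gt0// lt_def sqrf_eq0 vi sqr_ge0.
by apply: sumr_ge0 => j _; rewrite mulr_ge0 ?sqr_ge0// ltW.
Qed.

Lemma posdef_det (S : 'M[R]_k) : S = Q *m Q^T -> 0 < \det S.
Proof.
move=> ->; rewrite det_mulmx det_tr -expr2 lt_def sqr_ge0 andbT sqrf_eq0.
by rewrite -unitfE -unitmxE.
Qed.

End congruence.

Lemma le_Rintegral d (T : measurableType d) (R : realType) (P : probability T R) (f g : T -> R) :
  P.-integrable setT (EFin \o f) -> P.-integrable setT (EFin \o g) ->
  (forall w, f w <= g w) -> (\int[P]_w f w <= \int[P]_w g w)%R.
Proof.
move=> fi gi fg; rewrite -subr_ge0 -RintegralB//.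
by apply: Rintegral_ge0 => w _; rewrite subr_ge0.
Qed.

(** * Likelihood ratios of normal laws *)

Section likelihood_ratio.
Context (R : realType).
Local Notation N := (gauss (0 : R) 1).

(* The density of N(g, l) with respect to N(0, 1). *)
Definition normal_ratio (l g x : R) : R :=
  (Num.sqrt l)^-1 * expR (2^-1 * x ^+ 2 - (x - g) ^+ 2 / (2 * l)).

Lemma normal_ratio_ge0 l g x : 0 <= normal_ratio l g x.
Proof. by rewrite mulr_ge0 ?invr_ge0 ?sqrtr_ge0 ?expR_ge0. Qed.

Lemma normal_ratio_expR l g x : 0 < l ->
  normal_ratio l g x = expR (2^-1 * x ^+ 2 - 2^-1 * ((x - g) ^+ 2 / l) - 2^-1 * ln l).
Proof.
move=> l0; rewrite /normal_ratio [in RHS]expRD mulrC; congr (expR _ * _).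
  by congr (_ - _); rewrite invfM mulrA [in RHS]mulrC mulrAC -mulrA mulrC.
have s0 : 0 < Num.sqrt l by rewrite sqrtr_gt0.
rewrite -{2}(sqr_sqrtr (ltW l0)) lnXn// -[ln _ *+ 2]mulr_natl mulKf//.
by rewrite expRN lnK.
Qed.

Lemma measurable_normal_ratio l g : measurable_fun setT (normal_ratio l g).
Proof.
apply: measurable_funM => //; apply: measurableT_comp; first exact: measurable_expR.
apply: measurable_funB; first by apply: measurable_funM => //; exact: measurable_sqr.
apply: measurable_funM => //; apply: measurable_funX; exact: measurable_funB.
Qed.

Lemma normal_ratio_pdf l g x : 0 < l ->
  normal_ratio l g x * normal_pdf 0 1 x = normal_pdf g (Num.sqrt l) x.
Proof.
move=> l0; have s0 : Num.sqrt l != 0 by rewrite gt_eqF ?sqrtr_gt0.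
rewrite !normal_pdf_expR ?oner_eq0// normr1 invr1 mulr1.
rewrite ger0_norm ?sqrtr_ge0// sqr_sqrtr ?ltW// subr0 expr1n.
rewrite /normal_ratio; set s := (Num.sqrt l)^-1; set p := normal_peak 1.
rewrite (_ : - (x - g) ^+ 2 / (l *+ 2) =
  2^-1 * x ^+ 2 - (x - g) ^+ 2 / (2 * l) + - x ^+ 2 / 2).
  by rewrite (expRD (2^-1 * x ^+ 2 - (x - g) ^+ 2 / (2 * l))); ring.
by rewrite -[l *+ 2]mulr_natl; field; rewrite gt_eqF.
Qed.

Lemma integral_normal_ratio l g : 0 < l ->
  (\int[N]_x (normal_ratio l g x)%:E = 1)%E.
Proof.
move=> l0; apply: (@integral_std_pdf _ _ 1 g (Num.sqrt l)) => //.
- exact: measurable_normal_ratio.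
- by move=> x; exact: normal_ratio_ge0.
by move=> x; rewrite mul1r normal_ratio_pdf.
Qed.

(** Relative to two independent standard normals, this is the density of a pair with correlation
    sqrt (1 - l), and that law is exchangeable. The symmetry lets source points and codewords, or
    input and output of a channel, swap roles. *)
Lemma normal_ratioC l x y : 0 < l <= 1 ->
  normal_ratio l (Num.sqrt (1 - l) * y) x = normal_ratio l (Num.sqrt (1 - l) * x) y.
Proof.
move=> /andP[l0 l1]; rewrite /normal_ratio; congr (_ * expR _).
have a2 : Num.sqrt (1 - l) ^+ 2 = 1 - l by rewrite sqr_sqrtr// subr_ge0.
rewrite !sqrrB !exprMn a2.
by field; rewrite gt_eqF.
Qed.

End likelihood_ratio.

(** A dual form of the rate: for positive definite [K] the supremum of the left side over [Psi] is
    ln (det S / det K), attained at Psi = K. Each inequality is affine in [K]. *)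
Definition rate_bound (R : realType) k (S K : 'M[R]_k) (r : R) : Prop :=
  forall Psi : 'M[R]_k, posdef Psi ->
    ln (\det S / \det Psi) + k%:R - \tr (invmx Psi *m K) <= 2 * r.

Section converse.
Context d (T : measurableType d) (R : realType) (P : probability T R).
Context (k : nat) (X V : nat -> {RV P >-> k.-tuple R}) (SX : 'M[R]_k).
Hypothesis hSX : posdef SX.
Hypothesis hX : forall t, gaussian (X t) SX.
Hypothesis hiid : independent_seq P (fun t => pair_RV (X t) (V t)).
Context (n : nat) (f : n.-tuple (k.-tuple R) -> nat) (N : nat).
Hypothesis n0 : (0 < n)%N.
Hypothesis mf : measurable_fun setT f.
Hypothesis f1 : forall x, (0 < f x)%N.
Hypothesis fN : forall x, (f x <= N)%N.
Context (g : nat -> 'I_n -> 'cV[R]_k).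

Section diagonal.
Context (Q : 'M[R]_k) (l : 'rV[R]_k).
Hypotheses (SQ : SX = Q *m Q^T) (Qu : Q \in unitmx) (l0 : forall i, 0 < l 0 i).

Let x (ti : 'I_n * 'I_k) w := whiten Q (X ti.1 w) ti.2 0.
Let ratio m w := \prod_ti normal_ratio (l 0 ti.2) ((invmx Q *m g m ti.1) ti.2 0) (x ti w).
Let c := \sum_i ln (l 0 i).

Let ratio_expectation m : P.-integrable setT (EFin \o ratio m) /\ (\int[P]_w ratio m w = 1)%R.
Proof.
have e : (\int[P]_w (ratio m w)%:E = 1)%E.
  rewrite (@iid_normal_ge0_integral _ _ _ _ _ x
    (fun ti y => normal_ratio (l 0 ti.2) ((invmx Q *m g m ti.1) ti.2 0) y) (fun=> 1)).
  - by rewrite big1.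
  - exact: block_iid hX hiid n.
  - by move=> ti; exact: measurable_normal_ratio.
  - by move=> ti y; exact: normal_ratio_ge0.
  - by move=> ti; exact: integral_normal_ratio.
have ir : P.-integrable setT (EFin \o ratio m).
  apply: (ge0_integrable (c := 1)) => //.
    apply: measurable_prod => ti _.
    apply: (measurableT_comp (f := normal_ratio _ _)); first exact: measurable_normal_ratio.
    exact: measurable_whiten_RV.
  by move=> w; apply: prodr_ge0 => ti _; exact: normal_ratio_ge0.
by split=> //; apply: EFin_inj; rewrite -EFin_Rintegral.
Qed.

Let L w := \sum_(t < n) (2^-1 * quad 1%:M (whiten Q (X t w)) -
  2^-1 * quad (diag_mx (\row_i (l 0 i)^-1)) (invmx Q *m code_error X f g t w) - 2^-1 * c).

Let ratioE w : ratio (f (state_block X n w)) w = expR (L w).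
Proof.
rewrite /ratio /L expR_sum -(pair_bigA _ (fun (t : 'I_n) (i : 'I_k) => normal_ratio (l 0 i)
  ((invmx Q *m g (f (state_block X n w)) t) i 0) (x (t, i) w)))/=.
apply: eq_bigr => t _.
have q (D : 'rV[R]_k) v : quad (diag_mx D) v = \sum_i D 0 i * v i 0 ^+ 2.
  by rewrite /quad -mulmxA mxE; apply: eq_bigr => i _; rewrite mul_diag_mx !mxE; ring.
rewrite -diag_const_mx !q /c !mulr_sumr -!sumrB expR_sum; apply: eq_bigr => i _.
rewrite normal_ratio_expR; last exact: l0.
have -> : (const_mx 1 : 'rV[R]_k) 0 i = 1 by rewrite mxE.
have -> : (\row_j (l 0 j)^-1) 0 i = (l 0 i)^-1 by rewrite mxE.
have -> : (invmx Q *m code_error X f g t w) i 0 =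
    x (t, i) w - (invmx Q *m g (f (state_block X n w)) t) i 0.
  by rewrite /code_error /estimate mulmxBr [LHS]mxE; congr (_ + _); rewrite mxE.
by rewrite mul1r [(l 0 i)^-1 * _]mulrC.
Qed.

Let LK t : L2v P (fun w => invmx Q *m code_error X f g t w).
Proof. by apply: L2v_mul; exact: (L2v_code_error hX mf fN). Qed.

Let LX t : L2v P (fun w => whiten Q (X t w)).
Proof. by apply: L2v_mul; exact: gaussian_L2v. Qed.

Let L_expectation : P.-integrable setT (EFin \o L) /\
  (\int[P]_w L w = n%:R * (2^-1 * (k%:R - c -
    \sum_i (l 0 i)^-1 * (invmx Q *m block_error_cov X f g *m (invmx Q)^T) i i)))%R.
Proof.
pose a t w := 2^-1 * quad 1%:M (whiten Q (X t w)) : R.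
pose b t w := - 2^-1 * quad (diag_mx (\row_i (l 0 i)^-1)) (invmx Q *m code_error X f g t w) : R.
have [ia ea] : (forall t : 'I_n, P.-integrable setT (EFin \o a t)) /\
    (forall t : 'I_n, \int[P]_w a t w = 2^-1 * k%:R)%R.
  split=> t; have [i e] := quad_cov2 1%:M (LX t); first exact: integrableZr.
  rewrite RintegralZl// e mul1mx cov2_mull ?cov2_mulr; try exact: gaussian_L2v (hX t).
  - rewrite (gaussian_cov2 (hX t)) SQ !mulmxA mulVmx// mul1mx -trmx_mul mulVmx//.
    by rewrite trmx1 mxtrace1.
  - exact: LX.
have [ib eb] : (forall t : 'I_n, P.-integrable setT (EFin \o b t)) /\
    (forall t : 'I_n, \int[P]_w b t w = - 2^-1 * \tr ((invmx Q)^T *m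
      diag_mx (\row_i (l 0 i)^-1) *m invmx Q *m cov2 P (code_error X f g t) (code_error X f g t)))%R.
  split=> t; have [i e] := quad_cov2 (diag_mx (\row_i (l 0 i)^-1)) (LK t); first exact: integrableZr.
  have LE : L2v P (code_error X f g t) by exact: (L2v_code_error hX mf fN).
  rewrite RintegralZl// e (cov2_mull _ LE (LK t)) (cov2_mulr _ LE LE); congr (_ * _).
  by rewrite !mulmxA mxtrace_mulC !mulmxA.
have LE : L = (fun w => \sum_(t < n) (a t w + (b t w + - (2^-1 * c)))).
  by apply/funext => w; apply: eq_bigr => t _; rewrite /b mulNr addrA.
have icst : P.-integrable setT (EFin \o (fun _ : T => - (2^-1 * c))).
  exact: bmf_integrable (bmf_cst _ _).
have iab (t : 'I_n) : P.-integrable setT (EFin \o (fun w => a t w + (b t w + - (2^-1 * c)))).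
  by apply: integrableDr => //; exact: integrableDr.
have [iL eL] := Rintegral_sum (index_enum 'I_n) iab.
rewrite LE; split => //; rewrite eL.
transitivity (\sum_(t < n) (2^-1 * (k%:R - c) - 2^-1 * \tr ((invmx Q)^T *m
      diag_mx (\row_i (l 0 i)^-1) *m invmx Q *m cov2 P (code_error X f g t) (code_error X f g t)))).
  apply: eq_bigr => t _; rewrite RintegralD//; last exact: integrableDr.
  by rewrite RintegralD// ea eb Rintegral_prob_cst; ring.
have -> : \sum_i (l 0 i)^-1 * (invmx Q *m block_error_cov X f g *m (invmx Q)^T) i i =
    \tr ((invmx Q)^T *m diag_mx (\row_i (l 0 i)^-1) *m invmx Q *m block_error_cov X f g).
  by rewrite tr_diag_congr; apply: eq_bigr => i _; rewrite [X in _ = X * _]mxE.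
have nn0 : (n%:R : R) != 0 by rewrite pnatr_eq0 -lt0n.
rewrite tr_mul_block_error_cov sumrB sumr_const card_ord -[_ *+ n]mulr_natl -mulr_sumr.
by move: (\sum_(t < n) _) => u; field.
Qed.

Lemma converse_diag : n%:R * (2^-1 * (k%:R - c -
    \sum_i (l 0 i)^-1 * (invmx Q *m block_error_cov X f g *m (invmx Q)^T) i i)) <= ln N%:R.
Proof.
have N0 : (0 < N)%N.
  by apply: leq_trans (f1 [tuple [tuple 0 | _ < k] | _ < n]) (fN _).
have [iL <-] := L_expectation.
have [iS eS] := Rintegral_sum (index_enum 'I_N) (fun m : 'I_N => (ratio_expectation m.+1).1).
have NR : (0 : R) < N%:R by rewrite ltr0n.
(* The tangent line of ln at [N], evaluated at the sum of the ratios: Jensen's inequality done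
   pointwise. Its expectation is exactly ln N, as each of the [N] ratios has mean 1. Messages start
   at 1, hence [m.+1]. *)
pose U w := (ln N%:R - 1 : R) + N%:R^-1 * \sum_(m < N) ratio m.+1 w.
have iU : P.-integrable setT (EFin \o U).
  by apply: integrableDr; [exact: bmf_integrable (bmf_cst _ _)|exact: integrableZr].
have -> : ln N%:R = (\int[P]_w U w)%R.
  rewrite RintegralD//; [|exact: bmf_integrable (bmf_cst _ _)|exact: integrableZr].
  rewrite Rintegral_prob_cst RintegralZl// eS.
  rewrite (eq_bigr (fun=> 1)) => [|m _]; last exact: (ratio_expectation m.+1).2.
  by rewrite sumr_const card_ord mulVf ?gt_eqF// subrK.
apply: le_Rintegral => // w.
have := expR_ge1Dx (L w - ln N%:R); rewrite expRD expRN lnK ?posrE// -ratioE => h.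
have sm : ratio (f (state_block X n w)) w <= \sum_(m < N) ratio m.+1 w.
  have fx : ((f (state_block X n w)).-1 < N)%N by rewrite prednK.
  rewrite (bigD1 (Ordinal fx))//= prednK// lerDl; apply: sumr_ge0 => m _.
  by apply: prodr_ge0 => ti _; exact: normal_ratio_ge0.
have : ratio (f (state_block X n w)) w / N%:R <= N%:R^-1 * \sum_(m < N) ratio m.+1 w.
  by rewrite mulrC ler_pM2l// invr_gt0.
by rewrite /U; lra.
Qed.

End diagonal.

Lemma converse_rate_bound r : ln N%:R <= n%:R * r -> rate_bound SX (block_error_cov X f g) r.
Proof.
move=> Nr Psi pPsi.
have [Q [l [Qu SQ PQ]]] := simultaneous_diagonalization hSX pPsi.1.
have l0 : forall i, 0 < l 0 i by apply: (diag_congr_posdef Qu); rewrite -PQ.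
have := le_trans (converse_diag SQ Qu l0) Nr.
have nR : (0 : R) < n%:R by rewrite ltr0n.
rewrite ler_pM2l// ler_pdivrMl// => h; apply: le_trans h.
have Q2 : 0 < \det Q ^+ 2 by have := posdef_det Qu SQ; rewrite SQ det_mulmx det_tr -expr2.
have pl : 0 < \prod_i l 0 i by apply: prodr_gt0.
rewrite {1}SQ PQ det_congr det_mulmx det_tr -expr2 (invmx_congr Qu) ?tr_diag_congr => [|i]; last first.
  by rewrite gt_eqF.
rewrite invfM mulrA divff ?gt_eqF// mul1r lnV ?posrE//.
have -> : ln (\prod_i l 0 i) = \sum_i ln (l 0 i).
  apply: (expR_inj); rewrite lnK ?posrE// expR_sum; apply: eq_bigr => i _.
  by rewrite lnK ?posrE.
have -> : \sum_i (\row_j (l 0 j)^-1) 0 i * (invmx Q *m block_error_cov X f g *m (invmx Q)^T) i i =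
   \sum_i (l 0 i)^-1 * (invmx Q *m block_error_cov X f g *m (invmx Q)^T) i i.
  by apply: eq_bigr => i _; rewrite mxE.
by lra.
Qed.

End converse.

(** * One-shot covering *)

Lemma probability_inhabited d (E : measurableType d) (R : realType) (mu : probability E R) :
  exists _ : E, True.
Proof.
apply: contrapT => /forallNP no; have := @probability_setT _ _ _ mu.
rewrite (_ : setT = set0) ?measure0; last by apply/seteqP; split=> // x _; exact: (no x).
by move/eqP; rewrite eq_sym onee_eq0.
Qed.

Section greedy_cover.
Context d (E : measurableType d) (R : realType) (mu : probability E R).

(** Sets are chosen greedily rather than drawn at random: each new one removes a fraction [v] of the
    excess of the uncovered mass over the floor [b], so this excess is at most (1 - v)^M after [M]
    choices. *)
Lemma greedy_cover (I : Type) (i0 : I) (C : I -> set E) (S : set E) (v b : R) :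
  (forall i, measurable (C i)) -> measurable S -> 0 <= v <= 1 -> 0 <= b ->
  (forall S', measurable S' -> S' `<=` S ->
    exists i, v * (fine (mu S') - b) <= fine (mu (S' `&` C i))) ->
  forall M, exists c : nat -> I,
    measurable (S `\` [set x | exists2 m, (m < M)%N & C (c m) x]) /\
    fine (mu (S `\` [set x | exists2 m, (m < M)%N & C (c m) x])) <= b + (1 - v) ^+ M.
Proof.
move=> mC mS /andP[v0 v1] b0 step; elim=> [|M [c [mr IH]]].
  exists (fun=> i0); have -> : S `\` [set x | exists2 m, (m < 0)%N & C i0 x] = S.
    by apply/seteqP; split => [x []|x Sx] //; split=> // -[].
  split=> //; rewrite expr0 (le_trans _ (_ : 1 <= _)) ?lerDr//.
  by rewrite -lee_fin fineK ?fin_num_measure//; exact: probability_le1.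
set S' := S `\` _ in mr IH.
have [i hi] := step _ mr (@subDsetl _ _ _).
exists (fun m => if m == M then i else c m).
have -> : S `\` [set x | exists2 m, (m < M.+1)%N & C (if m == M then i else c m) x] = S' `\` C i.
  apply/seteqP; split=> x.
    move=> [Sx nx]; split; first split=> // -[m mM cm].
      by apply: nx; exists m; [exact: ltnW|rewrite ltn_eqF].
    by move=> Cx; apply: nx; exists M => //; rewrite eqxx.
  move=> [[Sx nx] nCx]; split=> // -[m]; rewrite ltnS leq_eqVlt => /orP[/eqP ->|mM].
    by rewrite eqxx.
  by rewrite ltn_eqF// => Cm; apply: nx; exists m.
have mSC : measurable (S' `\` C i) by exact: measurableD.
split=> //.
have eS : fine (mu S') = fine (mu (S' `&` C i)) + fine (mu (S' `\` C i)).
  rewrite -fineD ?fin_num_measure//; last exact: measurableI.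
  by rewrite addeC -measureDI.
have : fine (mu (S' `\` C i)) - b <= (1 - v) * (fine (mu S') - b).
  by move: hi eS; lra.
have v1' : 0 <= 1 - v by lra.
have : (1 - v) * (fine (mu S') - b) <= (1 - v) * (1 - v) ^+ M.
  by apply: ler_wpM2l => //; move: IH; lra.
by rewrite -exprS; lra.
Qed.

End greedy_cover.

Section chernoff.
Context (R : realType).
Local Notation N := (gauss (0 : R) 1).

Lemma integral_ratio_expR (a l g : R) : 0 < l -> a < 2^-1 ->
  (\int[N]_x (expR (a * ((x - g) ^+ 2 / l)) * normal_ratio l g x)%:E =
    ((Num.sqrt (1 - 2 * a))^-1)%:E)%E.
Proof.
move=> l0 a2; have u0 : 0 < 1 - 2 * a by lra.
have l'0 : 0 < l / (1 - 2 * a) by rewrite divr_gt0.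
transitivity (\int[N]_x ((Num.sqrt (1 - 2 * a))^-1%:E *
    (normal_ratio (l / (1 - 2 * a)) g x)%:E)%E)%E.
  apply: eq_integral => x _; rewrite -EFinM; congr EFin.
  have -> : normal_ratio l g x = (Num.sqrt (1 - 2 * a) * Num.sqrt (l / (1 - 2 * a)))^-1 *
      expR (2^-1 * x ^+ 2 - (x - g) ^+ 2 / (2 * l)).
    by rewrite -sqrtrM ?(ltW u0)// [X in Num.sqrt X]mulrC divfK// gt_eqF.
  rewrite invfM mulrCA -!mulrA -expRD; congr (_ * (_ * expR _)).
  by field; rewrite !gt_eqF.
rewrite ge0_integralZl//; last 2 first.
- by apply/measurable_EFinP; exact: measurable_normal_ratio.
- by move=> x _; rewrite lee_fin normal_ratio_ge0.
by rewrite integral_normal_ratio// mule1.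
Qed.

Lemma invsqrt_expR (a : R) : `|a| <= 8^-1 -> (Num.sqrt (1 - 2 * a))^-1 <= expR (a + 2 * a ^+ 2).
Proof.
move=> a8; apply: le_trans (invsqrt_le a8) _; rewrite -addrA; exact: expR_ge1Dx.
Qed.

End chernoff.

Section covering.
Context d (E : measurableType d) (R : realType) (mu : probability E R).
Context (J : finType) (W : J -> E -> R) (l : J -> R).
Hypothesis iidW : iid_normal mu W.
Hypothesis l01 : forall j, 0 < l j <= 1.
Context (s a : R) (s0 : 0 <= s) (a01 : 0 <= a <= 8^-1).

Let l0 j : 0 < l j. Proof. by case/andP: (l01 j). Qed.
Let mW j : measurable_fun setT (W j). Proof. exact: iidW.1. Qed.

(** Another source point [y] serves as codeword after shrinking: under [mu] its coordinates are then
    N(0, 1 - l), the reproduction law of the test channel, so the codebook needs no other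
    probability space. *)
Definition codeword (y : E) (j : J) : R := Num.sqrt (1 - l j) * W j y.

Definition weighted_dist (c : J -> R) (x : E) : R := \sum_j (W j x - c j) ^+ 2 / l j.

(** The density, relative to the product of [mu] with itself, of the joint law of source point and
    codeword under the test channel; both marginals are [mu]. *)
Let rho (x y : E) : R := \prod_j normal_ratio (l j) (codeword y j) (W j x).
(** The Chernoff bound for a deviation [s] with parameter [a]; every coordinate contributes 2 a^2,
    by [invsqrt_expR]. *)
Let be := expR (2 * #|J|%:R * a ^+ 2 - a * s) : R.
Let nrm (x : E) : R := \sum_j W j x ^+ 2.

Lemma measurable_weighted_dist c : measurable_fun setT (weighted_dist c).
Proof.
apply: measurable_sum => j; apply: measurable_funM => //.
by apply: measurable_funX; apply: measurable_funB.
Qed.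

Let rho_ge0 x y : 0 <= rho x y.
Proof. by apply: prodr_ge0 => j _; exact: normal_ratio_ge0. Qed.

Let rhoC x y : rho x y = rho y x.
Proof. by apply: eq_bigr => j _; exact: normal_ratioC. Qed.

Let rho_measurable y : measurable_fun setT (rho ^~ y).
Proof.
apply: measurable_prod => j _.
by apply: (measurableT_comp (f := normal_ratio _ _)); [exact: measurable_normal_ratio|].
Qed.

Let rho_integral y : (\int[mu]_x (rho x y)%:E = 1)%E.
Proof.
rewrite (@iid_normal_ge0_integral _ _ _ _ _ W (fun j => normal_ratio (l j) (codeword y j)) (fun=> 1)) ?big1//.
- by move=> j; exact: measurable_normal_ratio.
- by move=> j x; exact: normal_ratio_ge0.
- by move=> j; exact: integral_normal_ratio.
Qed.

Let prod_invsqrt (t : R) : `|t| = a ->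
  expR (- (t * #|J|%:R)) * expR (- (a * s)) * \prod_(j : J) (Num.sqrt (1 - 2 * t))^-1 <= be.
Proof.
move=> ta; have t2 : t ^+ 2 = a ^+ 2 by rewrite -ta real_normK ?num_real.
have : \prod_(j : J) (Num.sqrt (1 - 2 * t))^-1 <= expR (\sum_(j : J) (t + 2 * t ^+ 2)).
  rewrite expR_sum; apply: ler_prod => j _; rewrite invr_ge0 sqrtr_ge0/=.
  by apply: invsqrt_expR; rewrite ta; case/andP: a01.
move=> h; apply: le_trans (ler_wpM2l _ h) _; first by rewrite mulr_ge0 ?expR_ge0.
by rewrite -!expRD ler_expR sumr_const -[_ *+ _]mulr_natl t2 /be; lra.
Qed.

(* Chernoff bound for the channel with input codeword y. *)
Let tail_channel t y : `|t| = a ->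
  mu.-integrable setT (EFin \o (fun x => expR (t * (weighted_dist (codeword y) x - #|J|%:R) - a * s) * rho x y)) /\
  (\int[mu]_x (expR (t * (weighted_dist (codeword y) x - #|J|%:R) - a * s) * rho x y) <= be)%R.
Proof.
move=> ta; have t2 : t < 2^-1.
  by apply: le_lt_trans (ler_norm t) _; rewrite ta; case/andP: a01 => _ h; lra.
pose F j x := expR (t * ((x - codeword y j) ^+ 2 / l j)) * normal_ratio (l j) (codeword y j) x.
have mF j : measurable_fun setT (F j).
  apply: measurable_funM; last exact: measurable_normal_ratio.
  apply: measurableT_comp; first exact: measurable_expR.
  apply: measurable_funM => //; apply: measurable_funM => //.
  by apply: measurable_funX; apply: measurable_funB.
have F0 j x : 0 <= F j x by rewrite mulr_ge0 ?expR_ge0 ?normal_ratio_ge0.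
have e := iid_normal_ge0_integral iidW mF F0 (fun j => integral_ratio_expR (codeword y j) (l0 j) t2).
have E1 x : expR (t * (weighted_dist (codeword y) x - #|J|%:R) - a * s) * rho x y =
    (expR (- (t * #|J|%:R)) * expR (- (a * s))) * \prod_j F j (W j x).
  rewrite /F big_split/= -expR_sum -mulr_sumr -/(weighted_dist _ _) -/(rho _ _).
  by rewrite mulrBr !expRD; ring.
have iF : mu.-integrable setT (EFin \o (fun x => \prod_j F j (W j x))).
  apply: ge0_integrable e; first by apply: measurable_prod => j _; exact: measurableT_comp.
  by move=> x; apply: prodr_ge0.
under eq_fun do rewrite E1.
split; first exact: integrableZr.
rewrite RintegralZl// (_ : (\int[mu]_x _)%R = \prod_(j : J) (Num.sqrt (1 - 2 * t))^-1).
  exact: prod_invsqrt.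
by apply: EFin_inj; rewrite -EFin_Rintegral.
Qed.

Let tail_norm : fine (mu [set x | #|J|%:R + s < nrm x]) <= be.
Proof.
case/andP: (a01) => a0 a8; have a2 : a < 2^-1 by lra.
pose F (j : J) (x : R) := expR (a * x ^+ 2).
have mF j : measurable_fun setT (F j).
  by apply: measurableT_comp; [exact: measurable_expR|apply: measurable_funM => //; exact: measurable_sqr].
have F0 j x : 0 <= F j x by exact: expR_ge0.
have e := iid_normal_ge0_integral iidW mF F0 (fun j => integral_std_expR_sqr a2).
have iF : mu.-integrable setT (EFin \o (fun x => \prod_j F j (W j x))).
  apply: ge0_integrable e; first by apply: measurable_prod => j _; exact: measurableT_comp.
  by move=> x; apply: prodr_ge0.
have mA : measurable [set x | #|J|%:R + s < nrm x].
  rewrite -[X in measurable X]setTI.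
  have := @measurable_fun_ltr _ _ _ setT (fun=> #|J|%:R + s) nrm.
  move=> /(_ _ _ measurableT [set true]); apply => //.
  by apply: measurable_sum => j; exact: measurable_funX.
have -> : fine (mu [set x | #|J|%:R + s < nrm x]) =
    (\int[mu]_x (\1_[set x | #|J|%:R + s < nrm x] x : R))%R.
  by rewrite /Rintegral integral_indic ?setIT.
apply: le_trans (prod_invsqrt (ger0_norm a0)).
have <- : (\int[mu]_x \prod_j F j (W j x))%R = \prod_(j : J) (Num.sqrt (1 - 2 * a))^-1.
  by apply: EFin_inj; rewrite -EFin_Rintegral.
rewrite -RintegralZl//; apply: le_Rintegral.
- by apply: bmf_integrable; exact: bmf_indic.
- exact: integrableZr.
move=> x; rewrite /F -expR_sum -mulr_sumr -/(nrm x) -!expRD indicE.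
have [/set_mem/= h|_] := boolP (_ \in _); last exact: expR_ge0.
rewrite -[leLHS]expR0 ler_expR.
have : 0 <= a * (nrm x - (#|J|%:R + s)) by rewrite mulr_ge0// subr_ge0 ltW.
lra.
Qed.

Let typical y := [set x | #|J|%:R - s <= weighted_dist (codeword y) x <= #|J|%:R + s].
Let small := [set x | nrm x <= #|J|%:R + s].
Let v := expR (- s + 2^-1 * \sum_j ln (l j)) : R.

Let measurable_typical y : measurable (typical y).
Proof.
have md := measurable_weighted_dist (codeword y).
have -> : typical y = [set x | #|J|%:R - s <= weighted_dist (codeword y) x] `&`
    [set x | weighted_dist (codeword y) x <= #|J|%:R + s].
  by apply/seteqP; split=> x /=; [move/andP|move=> h; exact/andP].
apply: measurableI; rewrite -[X in measurable X]setTI.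
  have := @measurable_fun_ler _ _ _ setT (fun=> #|J|%:R - s) (weighted_dist (codeword y)).
  by move=> /(_ _ _ measurableT [set true]); apply.
have := @measurable_fun_ler _ _ _ setT (weighted_dist (codeword y)) (fun=> #|J|%:R + s).
by move=> /(_ _ _ measurableT [set true]); apply.
Qed.

Let measurable_small : measurable small.
Proof.
rewrite -[X in measurable X]setTI.
have := @measurable_fun_ler _ _ _ setT nrm (fun=> #|J|%:R + s).
move=> /(_ _ _ measurableT [set true]); apply => //.
by apply: measurable_sum => j; exact: measurable_funX.
Qed.

(** The exponent of [rho] is half of the squared norm minus the weighted distance minus the sum of
    the ln l_j. On these sets the first two differ by at most 2 s, and [v] is the inverse of the
    resulting bound. *)
Let rho_typical x y : typical y x -> small x -> v * rho x y <= 1.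
Proof.
move=> /andP[d1 d2] xs.
have -> : rho x y = expR (2^-1 * nrm x - 2^-1 * weighted_dist (codeword y) x - 2^-1 * \sum_j ln (l j)).
  rewrite /nrm /weighted_dist !mulr_sumr -!sumrB expR_sum; apply: eq_bigr => j _.
  by rewrite normal_ratio_expR.
have {}xs : nrm x <= #|J|%:R + s by [].
rewrite /v -expRD -[leRHS]expR0 ler_expR.
move: (nrm x) (weighted_dist _ x) (\sum_j ln (l j)) (#|J|%:R : R) xs d1 d2 => *; lra.
Qed.

(** Averaged over [y], the channel from [y] gives S' the mass mu S', so some [y] gives it at least
    half; the factor 1/2 makes the contradiction with the average strict. At most 2 be of this mass
    is atypical, by the two Chernoff tails, and on the typical part the density is at most 1 / v. *)
Let step S' : measurable S' -> S' `<=` small ->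
  exists y, 2^-1 * v * (fine (mu S') - 4 * be) <= fine (mu (S' `&` typical y)).
Proof.
move=> mS' S'small.
pose f (z : E * E) : \bar R := ((\1_S' z.1 : R) * rho z.1 z.2)%:E.
have f0 z : (0 <= f z)%E by rewrite lee_fin mulr_ge0// indicE.
have mf : measurable_fun setT f.
  apply/measurable_EFinP; apply: measurable_funM.
    exact: measurableT_comp (bmf_indic R mS').1 measurable_fst.
  apply: measurable_prod => j _; apply: measurable_funM => //.
  apply: measurableT_comp; first exact: measurable_expR.
  have m1 : measurable_fun setT (fun z : E * E => W j z.1) by exact: measurableT_comp.
  have m2 : measurable_fun setT (fun z : E * E => W j z.2) by exact: measurableT_comp.
  apply: measurable_funB; first by apply: measurable_funM => //; exact: measurable_funX.
  apply: measurable_funM => //; apply: measurable_funX; apply: measurable_funB => //.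
  exact: measurable_funM.
have i1 y : mu.-integrable setT (EFin \o (fun x => rho x y)).
  exact: ge0_integrable (rho_integral y).
have iS y : mu.-integrable setT (EFin \o (fun x => (\1_S' x : R) * rho x y)).
  apply: le_integrable (i1 y) => //.
    by apply/measurable_EFinP; apply: measurable_funM.
  move=> x _ /=; rewrite lee_fin normrM ler_piMl// indicE.
  by case: (x \in S'); rewrite ?normr1 ?normr0.
have tonelli : (\int[mu]_y \int[mu]_x f (x, y) = mu S')%E.
  rewrite -(fubini_tonelli f)//.
  rewrite -[in RHS](setIT S') -(integral_indic mu measurableT mS'); apply: eq_integral => x _.
  transitivity ((\1_S' x : R)%:E * \int[mu]_y (rho y x)%:E)%E.
    have mr : measurable_fun setT (fun y => (rho y x)%:E) by exact/measurable_EFinP.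
    have r0 y : setT y -> (0 <= (rho y x)%:E)%E by rewrite lee_fin.
    have S0 : (0 <= (\1_S' x : R)%:E)%E by rewrite lee_fin indicE.
    rewrite -[RHS](ge0_integralZl mu measurableT mr r0 S0).
    by apply: eq_integral => y _; rewrite /f /= EFinM (rhoC x y).
  by rewrite rho_integral mule1.
have [y Ay] : exists y, fine (mu S') / 2 <= (\int[mu]_x ((\1_S' x : R) * rho x y))%R.
  apply: contrapT => /forallNP no.
  have no' y : (\int[mu]_x f (x, y) <= (fine (mu S') / 2)%:E)%E.
    rewrite (_ : (\int[mu]_x f (x, y))%E = (\int[mu]_x ((\1_S' x : R) * rho x y))%R%:E).
      by rewrite lee_fin leNgt; apply/negP => /ltW; exact: no.
    exact: (EFin_Rintegral (iS y)).
  have [y0 _] := probability_inhabited mu.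
  have pS : 0 < fine (mu S').
    rewrite lt_def fine_ge0// andbT; apply/negP => /eqP p0; apply: (no y0).
    by rewrite p0 mul0r; apply: Rintegral_ge0 => x _; rewrite mulr_ge0// indicE.
  have : (mu S' <= (fine (mu S') / 2)%:E)%E.
    rewrite -{1}tonelli -[leRHS]mule1 -(@probability_setT _ _ _ mu) -integral_cst//.
    apply: ge0_le_integral => //.
    - by move=> y _; apply: integral_ge0.
    - exact: measurable_fun_fubini_tonelli_G.
  rewrite -{1}[mu S']fineK ?fin_num_measure// lee_fin; lra.
exists y; case/andP: (a01) => a0 a8.
have [it1 t1] := tail_channel y (ger0_norm a0).
have [it2 t2] := tail_channel y (etrans (normrN a) (ger0_norm a0)).
have mSy : measurable (S' `&` typical y) by exact: measurableI.
have iI : mu.-integrable setT (EFin \o (fun x => v^-1 * (\1_(S' `&` typical y) x : R))).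
  by apply: integrableZr; apply: bmf_integrable; exact: bmf_indic.
have vp : 0 < v by exact: expR_gt0.
have : (\int[mu]_x ((\1_S' x : R) * rho x y) <= v^-1 * fine (mu (S' `&` typical y)) + (be + be))%R.
  have -> : fine (mu (S' `&` typical y)) = (\int[mu]_x (\1_(S' `&` typical y) x : R))%R.
    by rewrite /Rintegral integral_indic ?setIT.
  apply: le_trans (lerD (lexx _) (lerD t1 t2)).
  rewrite -RintegralZl//; last by apply: bmf_integrable; exact: bmf_indic.
  rewrite -RintegralD// -RintegralD//; last exact: integrableDr.
  apply: le_Rintegral => //; first by apply: integrableDr => //; exact: integrableDr.
  move=> x; rewrite !indicE in_setI.
  have e1 : 0 <= expR (a * (weighted_dist (codeword y) x - #|J|%:R) - a * s) * rho x y.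
    by rewrite mulr_ge0 ?expR_ge0.
  have e2 : 0 <= expR (- a * (weighted_dist (codeword y) x - #|J|%:R) - a * s) * rho x y.
    by rewrite mulr_ge0 ?expR_ge0.
  have [/set_mem xS|xS] := boolP (x \in S'); last first.
    by rewrite mul0r mulr0 add0r addr_ge0.
  rewrite mul1r; have [/set_mem xt|xt] := boolP (x \in typical y).
    rewrite /= mulr1; apply: ler_wpDr; first exact: addr_ge0.
    by rewrite -[leRHS]mul1r ler_pdivlMr// mulrC; exact: rho_typical (S'small _ xS).
  rewrite /= mulr0 add0r; move: xt; rewrite notin_setE /typical/= => /negP.
  rewrite negb_and -!ltNge => /orP[h|h].
    apply: ler_wpDl => //; rewrite -[leLHS]mul1r ler_wpM2r// -[leLHS]expR0 ler_expR.
    rewrite (_ : _ - _ = a * ((#|J|%:R - s) - weighted_dist (codeword y) x)); last by ring.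
    by rewrite mulr_ge0// subr_ge0 ltW.
  apply: ler_wpDr => //; rewrite -[leLHS]mul1r ler_wpM2r// -[leLHS]expR0 ler_expR.
  rewrite (_ : _ - _ = a * (weighted_dist (codeword y) x - (#|J|%:R + s))); last by ring.
  by rewrite mulr_ge0// subr_ge0 ltW.
move=> h.
have -> : 2^-1 * v * (fine (mu S') - 4 * be) = (fine (mu S') / 2 - 2 * be) * v by field.
by rewrite -ler_pdivlMr// mulrC; lra.
Qed.

Lemma covering (M : nat) : exists c : nat -> J -> R,
  let U := [set x | forall m, (m < M)%N -> #|J|%:R + s < weighted_dist (c m) x] in
  measurable U /\
  fine (mu U) <= 5 * expR (2 * #|J|%:R * a ^+ 2 - a * s) +
    (1 - 2^-1 * expR (- s + 2^-1 * \sum_j ln (l j))) ^+ M.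
Proof.
have [y0 _] := probability_inhabited mu.
have v01 : 0 <= 2^-1 * v <= 1.
  rewrite mulr_ge0 ?expR_ge0//=.
  have : v <= 1; last lra.
  rewrite -[leRHS]expR0 ler_expR.
  have : \sum_j ln (l j) <= 0.
    by apply: sumr_le0 => j _; rewrite ln_le0//; case/andP: (l01 j).
  by move: s0; lra.
have be0 : 0 <= 4 * be by rewrite mulr_ge0 ?expR_ge0.
have [c [mc hc]] := greedy_cover y0 measurable_typical measurable_small v01 be0 step M.
exists (fun m => codeword (c m)) => U.
have mU : measurable U.
  rewrite (_ : U = \bigcap_(m in `I_M) [set x | #|J|%:R + s < weighted_dist (codeword (c m)) x]).
    apply: bigcap_measurableType => // m _.
    rewrite -[X in measurable X]setTI.
    have := @measurable_fun_ltr _ _ _ setT (fun=> #|J|%:R + s) (weighted_dist (codeword (c m))).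
    move=> /(_ _ _ measurableT [set true]); apply => //; exact: measurable_weighted_dist.
  by apply/seteqP; split=> x h m => /h.
split=> //.
have UU : U `<=` [set x | #|J|%:R + s < nrm x] `|`
    (small `\` [set x | exists2 m, (m < M)%N & typical (c m) x]).
  move=> x Ux; have [xs|xs] := leP (nrm x) (#|J|%:R + s); last by left.
  right; split=> // -[m mM /andP[_ h]]; have := Ux _ mM; rewrite ltNge.
  by rewrite /= h.
have mA : measurable [set x | #|J|%:R + s < nrm x].
  rewrite (_ : [set x | _] = ~` small); first exact: measurableC.
  by apply/seteqP; split=> x /=; rewrite ltNge => /negP.
(* One [be] for the points of large norm, four for the floor of the greedy cover: together the
   constant 5. *)
apply: (@le_trans _ _ (be + (4 * be + (1 - 2^-1 * v) ^+ M))); last by rewrite /be; lra.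
apply: le_trans (lerD tail_norm hc).
rewrite -fineD ?fin_num_measure// fine_le ?fin_numD ?fin_num_measure//.
apply: le_trans (measureU2 _ mA mc).
by apply: le_measure => //; rewrite inE//; exact: measurableU.
Qed.

End covering.

(** * Codes from the covering *)

Section first_index.
Context d (E : measurableType d) (C : nat -> E -> bool).

(** Message 1 is reserved for uncovered points and codeword [m] is sent as m + 2; so [M] codewords
    cost M + 1 messages, and 0 does not occur. *)
Fixpoint cover_index (M : nat) (x : E) : nat :=
  if M is M'.+1 then if C M' x then M'.+2 else cover_index M' x else 1.

Lemma cover_index_gt0 M x : (0 < cover_index M x)%N.
Proof. by elim: M => //= M IH; case: ifP. Qed.

Lemma cover_index_le M x : (cover_index M x <= M.+1)%N.
Proof. by elim: M => //= M IH; case: ifP => // _; exact: leqW. Qed.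

Lemma measurable_cover_index M : (forall m, measurable_fun setT (C m)) ->
  measurable_fun setT (cover_index M).
Proof.
move=> mC; elim: M => [|M IH] /=; first exact: measurable_cst.
exact: measurable_fun_ifT.
Qed.

Lemma cover_indexP M x : (cover_index M x = 1%N /\ forall m, (m < M)%N -> ~~ C m x) \/
  (exists2 m, cover_index M x = m.+2 & C m x).
Proof.
elim: M => [|M IH] /=; first by left.
have [CM|/negbT nCM] := ifP; first by right; exists M.
case: IH => [[-> h]|[m -> Cm]]; last by right; exists m.
by left; split=> // m; rewrite ltnS leq_eqVlt => /orP[/eqP ->|/h].
Qed.

End first_index.

Section covering_code.
Context d (T : measurableType d) (R : realType) (P : probability T R).
Context (k : nat) (X V : nat -> {RV P >-> k.-tuple R}) (SX K Q : 'M[R]_k) (l : 'rV[R]_k).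
Hypotheses (SQ : SX = Q *m Q^T) (Qu : Q \in unitmx).
Hypotheses (KQ : K = Q *m diag_mx l *m Q^T) (l01 : forall i, 0 < l 0 i <= 1).
Hypothesis hX : forall t, gaussian (X t) SX.
Hypothesis hiid : independent_seq P (fun t => pair_RV (X t) (V t)).

Let l0 i : 0 < l 0 i. Proof. by case/andP: (l01 i). Qed.

Definition tuple_coord n (ti : 'I_n * 'I_k) (x : n.-tuple (k.-tuple R)) : R :=
  whiten Q (tnth x ti.1) ti.2 0.

Lemma measurable_tuple_coord n (ti : 'I_n * 'I_k) : measurable_fun setT (tuple_coord ti).
Proof.
apply: (measurableT_comp (f := fun x : k.-tuple R => whiten Q x ti.2 0)).
  exact: measurable_whiten.
exact: measurable_tnth.
Qed.

Lemma tuple_coord_iid n : iid_normal (distribution P (state_block X n)) (@tuple_coord n).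
Proof.
apply/iid_normalP => [ti|A mA]; first exact: measurable_tuple_coord.
have /iid_normalP h := block_iid SQ Qu hX hiid n.
rewrite -h//; last by move=> ti; exact: measurable_whiten_RV.
rewrite /distribution /pushforward; congr (P _); apply/seteqP.
by split=> w /= h' ti; have := h' ti; rewrite /tuple_coord tnth_mktuple.
Qed.

Let L := \sum_i (l 0 i)^-1.

(** The integral equals 64 sqrt 2. The integrand dominates the fourth power of the coordinate, by
    [integral_std_sqr_expR]. *)
Lemma whiten_fourth (t : nat) i :
  P.-integrable setT (EFin \o (fun w => 64 * expR (4^-1 * whiten Q (X t w) i 0 ^+ 2))) /\
  (\int[P]_w (64 * expR (4^-1 * whiten Q (X t w) i 0 ^+ 2)) <= 128)%R.
Proof.
have iidW := whiten_iid SQ Qu (hX t).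
have a2 : (4^-1 : R) < 2^-1 by lra.
have mE : measurable_fun setT (fun x : R => expR (4^-1 * x ^+ 2)).
  by have := measurable_expR_sqr (4^-1 : R) 0; under eq_fun do rewrite addr0.
have e := iid_normal_coord i iidW mE (fun x => expR_ge0 _) (integral_std_expR_sqr a2).
have ie : P.-integrable setT (EFin \o (fun w => expR (4^-1 * whiten Q (X t w) i 0 ^+ 2))).
  apply: ge0_integrable e => [|w]; last exact: expR_ge0.
  by apply: measurableT_comp mE _; exact: measurable_whiten_RV.
split; first exact: integrableZr.
rewrite RintegralZl// (_ : (\int[P]_w _)%R = (Num.sqrt (1 - 2 * 4^-1))^-1); last first.
  by apply: EFin_inj; rewrite -EFin_Rintegral.
have -> : (1 - 2 * 4^-1 : R) = 2^-1 by lra.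
have : (Num.sqrt 2^-1)^-1 <= (2 : R); last lra.
rewrite -[leRHS]invrK lef_pV2 ?posrE ?sqrtr_gt0 ?invr_gt0//.
have {1}-> : (2^-1 : R) = Num.sqrt (2^-1 ^+ 2) by rewrite sqrtr_sqr ger0_norm// invr_ge0.
by rewrite ler_sqrt//; lra.
Qed.

Lemma quad_invmx_state n (c : 'I_n * 'I_k -> R) (y : n.-tuple (k.-tuple R)) (g : 'I_n -> 'cV[R]_k) :
  (forall t, g t = Q *m \col_i c (t, i)) ->
  \sum_(t < n) quad (invmx K) (vec (tnth y t) - g t) =
  weighted_dist (@tuple_coord n) (fun ti => l 0 ti.2) c y.
Proof.
move=> gc; transitivity (\sum_(t < n) \sum_i (tuple_coord (t, i) y - c (t, i)) ^+ 2 / l 0 i); last first.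
  by rewrite pair_bigA; apply: eq_bigr => -[].
apply: eq_bigr => t _; rewrite KQ invmx_congr// => [|i]; last by rewrite gt_eqF.
rewrite -{2}[invmx Q]trmxK quad_diag_congr; apply: eq_bigr => i _.
rewrite mxE mulrC; congr (_ ^+ 2 * _).
by rewrite trmxK gc mulmxBr mulmxA mulVmx// mul1mx [LHS]mxE; congr (_ + _); rewrite mxE [in LHS]mxE.
Qed.

(** A covered block costs at most n k + s. An uncovered one is decoded as 0 and costs y^2 / l per
    coordinate; there y^2 <= A + y^4 / A separates the probability of the uncovered set, times [A],
    from a bounded fourth moment divided by [A]. *)
Lemma covering_code n M (s a A : R) : 0 <= s -> 0 <= a <= 8^-1 -> 0 < A -> (0 < n)%N ->
  exists f : n.-tuple (k.-tuple R) -> nat, exists g : nat -> 'I_n -> 'cV[R]_k,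
  [/\ measurable_fun setT f, forall x, (0 < f x)%N, forall x, (f x <= M.+1)%N &
    n%:R * \tr (invmx K *m block_error_cov X f g) <= n%:R * k%:R + s + n%:R * L *
      (A * (5 * expR (2 * (n%:R * k%:R) * a ^+ 2 - a * s) +
        (1 - 2^-1 * expR (- s + 2^-1 * (n%:R * \sum_i ln (l 0 i)))) ^+ M) + 128 / A)].
Proof.
move=> s0 a01 A0 n0.
have [c [mU pU]] := covering (tuple_coord_iid n) (fun ti => l01 ti.2) s0 a01 M.
set U := [set x | _] in mU pU.
have cJ : (#|{: 'I_n * 'I_k}|%:R : R) = n%:R * k%:R by rewrite card_prod !card_ord natrM.
have sJ : \sum_(ti : 'I_n * 'I_k) ln (l 0 ti.2) = n%:R * \sum_i ln (l 0 i).
  rewrite -(pair_bigA _ (fun (t : 'I_n) i => ln (l 0 i)))/=.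
  by rewrite sumr_const card_ord mulr_natl.
rewrite cJ sJ in pU; set p := (X in _ <= X) in pU *.
pose wd := weighted_dist (@tuple_coord n) (fun ti => l 0 ti.2).
pose C m (x : n.-tuple (k.-tuple R)) := wd (c m) x <= n%:R * k%:R + s.
pose f := cover_index C M.
have mC m : measurable_fun setT (C m).
  have mw : measurable_fun setT (wd (c m)).
    exact: (measurable_weighted_dist (fun ti => l 0 ti.2) (tuple_coord_iid n) (c m)).
  exact: (measurable_fun_ler mw (measurable_cst _)).
have mf : measurable_fun setT f by exact: measurable_cover_index.
have f0 x : (0 < f x)%N by exact: cover_index_gt0.
have fM x : (f x <= M.+1)%N by exact: cover_index_le.
pose gam m : 'I_n * 'I_k -> R := if m is m'.+2 then c m' else fun=> 0.
pose g m (t : 'I_n) : 'cV[R]_k := Q *m \col_i gam m (t, i).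
exists f, g; split=> //.
have LE t : L2v P (code_error X f g t) by exact: (L2v_code_error hX mf fM).
have iD t := (quad_cov2 (invmx K) (LE t)).1.
have [iS eS] := Rintegral_sum (index_enum 'I_n) iD.
have nn0 : (n%:R : R) != 0 by rewrite pnatr_eq0 -lt0n.
rewrite tr_mul_block_error_cov mulVKf//.
under eq_bigr do rewrite -(quad_cov2 _ (LE _)).2.
rewrite -eS.
have mUP : measurable (state_block X n @^-1` U).
  by rewrite -[X in measurable X]setTI; exact: measurable_funPT.
pose F4 (ti : 'I_n * 'I_k) w := 64 * expR (4^-1 * whiten Q (X ti.1 w) ti.2 0 ^+ 2).
pose H (ti : 'I_n * 'I_k) w := (l 0 ti.2)^-1 * (A * (\1_(state_block X n @^-1` U) w : R) + A^-1 * F4 ti w).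
have i1 : P.-integrable setT (EFin \o (\1_(state_block X n @^-1` U) : T -> R)).
  by apply: bmf_integrable; exact: bmf_indic.
have iH ti : P.-integrable setT (EFin \o H ti).
  apply: integrableZr; apply: integrableDr; first exact: integrableZr.
  by apply: integrableZr; exact: (whiten_fourth ti.1 ti.2).1.
have eH ti : (\int[P]_w H ti w <= (l 0 ti.2)^-1 * (A * p + 128 / A))%R.
  have iF := (whiten_fourth ti.1 ti.2).1; have bF := (whiten_fourth ti.1 ti.2).2.
  rewrite RintegralZl//; last by apply: integrableDr; exact: integrableZr.
  rewrite ler_pM2l ?invr_gt0// RintegralD//; try exact: integrableZr.
  rewrite RintegralZl// RintegralZl//; apply: lerD.
    rewrite ler_pM2l// (le_trans _ pU)//.
    by rewrite /Rintegral integral_indic// setIT.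
  by rewrite mulrC ler_pM2r// invr_gt0.
have [iHs eHs] := Rintegral_sum (index_enum ('I_n * 'I_k)%type) iH.
have -> : n%:R * L * (A * p + 128 / A) =
    \sum_(ti : 'I_n * 'I_k) (l 0 ti.2)^-1 * (A * p + 128 / A).
  rewrite -(pair_bigA _ (fun (t : 'I_n) i => (l 0 i)^-1 * (A * p + 128 / A)))/=.
  by under [RHS]eq_bigr do rewrite -mulr_suml -/L; rewrite sumr_const card_ord -[RHS]mulr_natl mulrA.
have icst : P.-integrable setT (EFin \o (fun _ : T => n%:R * k%:R + s : R)).
  by apply: bmf_integrable; exact: bmf_cst.
apply: (@le_trans _ _ (\int[P]_w ((n%:R * k%:R + s) + \sum_ti H ti w))%R); last first.
  by rewrite RintegralD// Rintegral_prob_cst lerD2l eHs; apply: ler_sum.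
apply: le_Rintegral => //; first exact: integrableDr.
move=> w; set x := state_block X n w.
have -> : \sum_(t < n) quad (invmx K) (code_error X f g t w) = wd (gam (f x)) x.
  rewrite -[RHS](quad_invmx_state (c := gam (f x)) x (g := g (f x)))//; apply: eq_bigr => t _.
  by rewrite /x tnth_mktuple.
have H0 ti : 0 <= H ti w.
  have i0 : 0 <= (l 0 ti.2)^-1 by rewrite invr_ge0 ltW.
  have A'0 : 0 <= A^-1 by rewrite invr_ge0 ltW.
  have F40 : 0 <= F4 ti w by apply: mulr_ge0 => //; exact: expR_ge0.
  have I0 : 0 <= (\1_(state_block X n @^-1` U) w : R) by rewrite indicE.
  exact: mulr_ge0 i0 (addr_ge0 (mulr_ge0 (ltW A0) I0) (mulr_ge0 A'0 F40)).
have [[f1 nC]|[m fm Cm]] := cover_indexP C M x; last first.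
  by rewrite /f fm /=; apply: ler_wpDr => //; exact: sumr_ge0.
apply: ler_wpDl; first by rewrite addr_ge0// mulr_ge0.
rewrite /f f1 /=; apply: ler_sum => ti _.
rewrite /H subr0 mulrC ler_pM2l ?invr_gt0// indicE mem_set; last first.
  by move=> m mM; rewrite cJ ltNge; exact: nC.
have -> : tuple_coord ti x = whiten Q (X ti.1 w) ti.2 0 by rewrite /tuple_coord tnth_mktuple.
rewrite mulr1 /F4; move: (whiten _ _ _ _) => y.
have h : A^-1 * y ^+ 4 <= A^-1 * (64 * expR (4^-1 * y ^+ 2)).
  by rewrite ler_pM2l ?invr_gt0//; exact: integral_std_sqr_expR.
apply: (@le_trans _ _ (A + A^-1 * y ^+ 4)); last by rewrite lerD2l.
(* Multiplied by [A], the claim reads A^2 + y^4 - A y^2 >= 0, which follows by completing the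
   square. *)
rewrite -subr_ge0 -(pmulr_rge0 _ A0) mulrBr mulrDr mulrA divff ?gt_eqF// mul1r.
have -> : A * A + y ^+ 4 - A * y ^+ 2 = (A - 2^-1 * y ^+ 2) ^+ 2 + 3 / 4 * (y ^+ 2) ^+ 2 by field.
by rewrite addr_ge0 ?sqr_ge0// mulr_ge0 ?sqr_ge0//; lra.
Qed.

Lemma exp_decay (u : R) : 0 < u -> expR (- u) <= u^-1.
Proof.
move=> u0; rewrite expRN lef_pV2 ?posrE ?expR_gt0//.
by have := expR_ge1Dx u; lra.
Qed.

(** With slack s = n d1 the Chernoff exponent is linear in n, and about exp (n (R0 + 2 d1))
    codewords exceed the inverse covering fraction, of order exp (n (R0 + d1)), by the factor exp (n
    d1). Through [exp_decay] both error terms are O(1/n), with total constant [C1]. *)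
Lemma rate_achieving_codes (delta : R) : 0 < delta -> exists n0, forall n, (n0 <= n)%N ->
  exists (f : n.-tuple (k.-tuple R) -> nat) (g : nat -> 'I_n -> 'cV[R]_k),
  [/\ is_encoder (- (2^-1 * \sum_i ln (l 0 i)) + delta) f, orthogonal_code X f g &
    \tr (invmx K *m block_error_cov X f g) <= k%:R + delta].
Proof.
move=> d0; set R0 := - (2^-1 * \sum_i ln (l 0 i)).
have R0p : 0 <= R0.
  rewrite oppr_ge0 pmulr_rle0// sumr_le0// => i _; apply: ln_le0; by case/andP: (l01 i).
(* In the rate, two thirds go to the size of the codebook and one to the extra message; in the
   distortion, one third each to the slack [s], to the uncovered probability and to the fourth
   moment. *)
pose d1 := delta / 3; have d10 : 0 < d1 by rewrite divr_gt0.
have L0 : 0 <= L by apply: sumr_ge0 => i _; rewrite invr_ge0 ltW.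
(* The cap 1/8 is the range of [invsqrt_expR]; the other bound gives 2 k a <= d1 / 2, so the
   Chernoff exponent is at most - n a d1 / 2. *)
pose a := Num.min 8^-1 (d1 / (4 * (k%:R + 1))).
have k10 : (0 : R) < k%:R + 1 by rewrite ltr_wpDl.
have a0 : 0 < a by rewrite lt_min invr_gt0 ltr0n/= divr_gt0// mulr_gt0.
have a8 : a <= 8^-1 by rewrite ge_min lexx.
have ak : 2 * k%:R * a <= d1 / 2.
  have : a <= d1 / (4 * (k%:R + 1)) by rewrite ge_min lexx orbT.
  rewrite ler_pdivlMr ?mulr_gt0// => h.
  by have := ltW a0; move: h; lra.
(* Makes the fourth moment term L * 128 / A at most d1; L + 1 keeps [A] positive when L = 0. *)
pose A := 128 * (L + 1) / d1.
have A0 : 0 < A by rewrite divr_gt0// mulr_gt0// ltr_wpDl.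
pose C1 := 10 / (a * d1) + 2 / d1.
have C10 : 0 < C1 by rewrite addr_gt0// divr_gt0// mulr_gt0.
exists (Num.trunc (L * A * C1 / d1 + d1^-1)).+1 => n hn.
have n0 : (0 < n)%N by apply: leq_trans hn.
have nR : (0 : R) < n%:R by rewrite ltr0n.
have {}hn : L * A * C1 / d1 + d1^-1 <= n%:R.
  apply: le_trans (ltW (truncnS_gt _)) _; by rewrite ler_nat.
have LAC : 0 <= L * A * C1 / d1
  by apply: divr_ge0; [apply: mulr_ge0; [exact: (mulr_ge0 L0 (ltW A0))|exact: ltW]|exact: ltW].
have nd1 : 1 <= n%:R * d1.
  rewrite -ler_pdivrMr// div1r; apply: le_trans hn; by rewrite lerDr.
have nd0 : 0 < n%:R * d1 by exact: mulr_gt0.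
have nLAC : L * A * C1 / n%:R <= d1.
  rewrite ler_pdivrMr// -ler_pdivrMl// mulrC; apply: le_trans hn.
  by rewrite lerDl invr_ge0 ltW.
pose y := expR (n%:R * (R0 + 2 * d1)).
have y1 : 1 <= y.
  by rewrite -[leLHS]expR0 ler_expR; apply: mulr_ge0; [exact: ltW|move: R0p d10; lra].
pose M := Num.trunc y.
have My : M%:R <= y by rewrite truncn_le// ltW// expR_gt0.
have yM : y - 1 <= M%:R by rewrite lerBlDr natr1; apply: ltW; exact: truncnS_gt.
have s0 : 0 <= n%:R * d1 by exact: ltW.
have a01 : 0 <= a <= 8^-1 by rewrite a8 ltW.
have [f [g [mf f0 fM H]]] := covering_code M s0 a01 A0 n0.
set p := 5 * _ + _ in H.
have pC : p <= C1 / n%:R.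
  have b1 : expR (2 * (n%:R * k%:R) * a ^+ 2 - a * (n%:R * d1)) <= 2 / (n%:R * (a * d1)).
    apply: (@le_trans _ _ (expR (- (n%:R * (a * d1) / 2)))).
      rewrite ler_expR.
      have : 0 <= n%:R * a * (d1 / 2 - 2 * k%:R * a).
        by apply: mulr_ge0; [exact: mulr_ge0 (ltW nR) (ltW a0)|rewrite subr_ge0].
      by lra.
    apply: le_trans (exp_decay _) _; first by rewrite divr_gt0// !mulr_gt0.
    by rewrite invf_div.
  have b2 : (1 - 2^-1 * expR (- (n%:R * d1) + 2^-1 * (n%:R * \sum_i ln (l 0 i)))) ^+ M <= 2 / (n%:R * d1).
    set v := expR _.
    have vE : v = expR (- (n%:R * (d1 + R0))) by congr expR; rewrite /R0; ring.
    have v1 : v <= 1.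
      by rewrite vE -[leRHS]expR0 ler_expR oppr_le0; apply: mulr_ge0; [exact: ltW|move: R0p d10; lra].
    have vM : n%:R * d1 <= v * M%:R.
      have : v * (y - 1) <= v * M%:R by rewrite ler_wpM2l ?expR_ge0.
      have : v * y = expR (n%:R * d1) by rewrite vE -expRD; congr expR; ring.
      have := expR_ge1Dx (n%:R * d1); lra.
    apply: (@le_trans _ _ (expR (- (2^-1 * v)) ^+ M)).
      apply: lerXn2r; rewrite ?nnegrE ?expR_ge0//; first by lra.
      exact: expR_ge1Dx.
    rewrite -expRM_natl; apply: (@le_trans _ _ (expR (- (n%:R * d1 / 2)))).
      by rewrite ler_expR; lra.
    apply: le_trans (exp_decay _) _; first by rewrite divr_gt0.
    by rewrite invf_div.
  apply: le_trans (lerD (ler_wpM2l _ b1) b2) _ => //.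
  by rewrite /C1 le_eqVlt; apply/orP; left; apply/eqP; field; rewrite !gt_eqF.
have enc : is_encoder (R0 + delta) f.
  split=> // x; split=> //; apply: (@le_trans _ _ (M.+1%:R)); first by rewrite ler_nat.
  rewrite -natr1; apply: (@le_trans _ _ (y + 1)); first by rewrite lerD2r.
  have -> : n%:R * (R0 + delta) = n%:R * (R0 + 2 * d1) + n%:R * d1 by rewrite /d1; field.
  (* The extra message is paid for by y + 1 <= y (1 + n d1), as both y and n d1 are at least 1. *)
  rewrite expRD -/y; apply: (@le_trans _ _ (y * (1 + n%:R * d1))).
    by rewrite mulrDr mulr1 lerD2l; nra.
  by rewrite ler_wpM2l ?expR_ge0// expR_ge1Dx.
(* Replacing the codebook points by the cell means leaves the encoder unchanged and can only lower
   the [K^-1]-weighted cost. *)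
have [g' og] := orthogonal_code_exists hX mf fM.
exists f, g'; split=> //.
have Kp : posdef K by rewrite KQ; exact: posdef_diag_congr.
have Kip : psd (invmx K).
  rewrite KQ invmx_congr// => [|i]; last by rewrite gt_eqF.
  rewrite -{2}[invmx Q]trmxK; apply/posdef_psd/posdef_diag_congr.
    by rewrite unitmx_tr unitmx_inv.
  by move=> i; rewrite mxE invr_gt0.
apply: le_trans (orthogonal_code_best hX mf fM g Kip og) _.
rewrite -(ler_pM2l nR); apply: le_trans H _.
have -> : n%:R * k%:R + n%:R * d1 + n%:R * L * (A * p + 128 / A) =
  n%:R * (k%:R + d1 + (L * A * p + L * 128 / A)) by ring.
rewrite ler_pM2l// -addrA lerD2l.
have : L * A * p <= d1.
  apply: le_trans nLAC; rewrite -[leRHS]mulrA; apply: ler_wpM2l => //; exact: mulr_ge0 (ltW A0).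
have : L * 128 / A <= d1.
  rewrite /A invf_div mulrA ler_pdivrMr; last by rewrite mulr_gt0// ltr_wpDl.
  by have := ltW d10; lra.
by rewrite /d1; lra.
Qed.

End covering_code.

(** * Compactness of the constraint set *)

Lemma psd_entry_le (R : realType) k (S K : 'M[R]_k) i j : psd K -> psd (S - K) ->
  `|K i j| <= S i i + S j j.
Proof.
move=> [Kt K0] [_ SK0].
have e (M : 'M[R]_k) (p q : 'I_k) :
    (((delta_mx p 0 : 'cV[R]_k)^T *m M *m (delta_mx q 0 : 'cV[R]_k)) 0 0 : R) = M p q.
  rewrite -mulmxA delta_lin_form mxE (bigD1 q)//= big1 ?addr0 => [|l /negbTE lq].
    by rewrite mxE !eqxx mulr1.
  by rewrite mxE lq mulr0.
have diag p : 0 <= K p p <= S p p.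
  have := K0 (delta_mx p 0); have := SK0 (delta_mx p 0).
  by rewrite quadB /quad !e subr_ge0 => -> ->.
have quad2 (a b : R) : quad K (a *: delta_mx i 0 + b *: delta_mx j 0) =
    a ^+ 2 * K i i + 2 * (a * b) * K i j + b ^+ 2 * K j j.
  rewrite /quad trmxD_mx !trmxZ_mx !(mulmxDl, mulmxDr) -!scalemxAr -!scalemxAl.
  have sc (s : R) (M : 'M[R]_1) : (s *: M) 0 0 = s * M 0 0 by rewrite mxE.
  have Kji : K j i = K i j by rewrite -[in LHS]Kt mxE.
  by rewrite [LHS]mxE [X in X + _]mxE [X in _ + X]mxE !sc !e Kji; ring.
have := K0 (1 *: delta_mx i 0 + 1 *: delta_mx j 0).
have := K0 (1 *: delta_mx i 0 + (-1) *: delta_mx j 0).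
rewrite !quad2 ler_norml; move: (diag i) (diag j) => /andP[? ?] /andP[? ?] ? ?.
by apply/andP; split; lra.
Qed.

Section limit_of_matrices.
Context (R : realType) (k : nat) (U : set_system nat) (UU : UltraFilter U).
Context (u : nat -> 'M[R]_k) (K : 'M[R]_k).
Hypothesis uK : forall i j, (fun n => u n i j) @ U --> K i j.

Lemma cvg_ultra_le (f g : nat -> R) (a b : R) : f @ U --> a -> g @ U --> b ->
  (forall n, f n <= g n) -> a <= b.
Proof.
move=> fa gb fg; rewrite -subr_ge0; apply: (cvgr_to_ge (cvgB gb fa)).
by apply: nearW => n; rewrite subr_ge0.
Qed.

Lemma cvg_sum_real (I : Type) (r : seq I) (f : I -> nat -> R) (a : I -> R) :
  (forall i, f i @ U --> a i) -> (fun n => \sum_(i <- r) f i n) @ U --> \sum_(i <- r) a i.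
Proof.
move=> fa; elim: r => [|i r IH].
  by rewrite big_nil; under eq_fun do rewrite big_nil; exact: cvg_cst.
by rewrite big_cons; under eq_fun do rewrite big_cons; exact: cvgD.
Qed.

Lemma cvg_tr_mul (A : 'M[R]_k) : (fun n => \tr (A *m u n)) @ U --> \tr (A *m K).
Proof.
have E (M : 'M[R]_k) : \tr (A *m M) = \sum_i \sum_j A i j * M j i.
  by apply: eq_bigr => i _; rewrite mxE.
rewrite E; under eq_fun do rewrite E.
apply: cvg_sum_real => i; apply: cvg_sum_real => j.
apply: cvgM; [exact: cvg_cst|exact: uK].
Qed.

Lemma psd_limit : (forall n, psd (u n)) -> psd K.
Proof.
move=> pu; split.
  apply/matrixP => i j; rewrite mxE; apply/le_anti/andP.
  have e n : u n j i = u n i j by rewrite -[in RHS](pu n).1 mxE.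
  by split; [apply: (cvg_ultra_le (@uK j i) (@uK i j))|apply: (cvg_ultra_le (@uK i j) (@uK j i))] => n;
    rewrite e.
move=> v; have q (M : 'M[R]_k) : quad M v = \tr ((v *m v^T) *m M).
  by rewrite -mulmxA mxtrace_mulC /quad /mxtrace big_ord1.
rewrite q; apply: (cvg_ultra_le (cvg_cst 0) (@cvg_tr_mul (v *m v^T))) => n.
by rewrite -q; exact: (pu n).2.
Qed.

End limit_of_matrices.

(** The entries stay in compact intervals by [psd_entry_le]. An ultrafilter finer than the filter at
    infinity yields limits of all entries at once, in place of successive subsequences, and every
    constraint is a non-strict inequality that is continuous in the entries. *)
Lemma rate_bound_closed (R : realType) k (S W : 'M[R]_k) (c r : R) :
  (forall e, 0 < e -> exists K, [/\ psd K, psd (S - K), \tr (W *m K) <= c + e &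
    rate_bound S K (r + e)]) ->
  exists K, [/\ psd K, psd (S - K), \tr (W *m K) <= c & rate_bound S K r].
Proof.
move=> h.
have h' n : exists K, [/\ psd K, psd (S - K), \tr (W *m K) <= c + harmonic n &
    rate_bound S K (r + harmonic n)] by apply: h; exact: harmonic_gt0.
have [u hu] := choice h'.
have [U [UU FU]] := @ultraFilterLemma nat \oo _.
have lim i j : exists x : R, (fun n => u n i j) @ U --> x.
  pose C := S i i + S j j.
  have cpt : compact `[- C, C] by exact: segment_compact.
  have uC : ((fun n => u n i j) @ U) (`[- C, C]%classic : set R).
    rewrite /fmap /=; apply: filterE => n /=; rewrite in_itv/= -ler_norml.
    by case: (hu n) => p1 p2 _ _; exact: psd_entry_le.
  have [x [_ clx]] := cpt _ _ uC; exists x => A Ax.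
  have [//|nA] := in_ultra_setVsetC ((fun n => u n i j) @^-1` A) UU.
  by have [y []] := clx (~` A) A nA Ax.
pose K : 'M[R]_k := \matrix_(i, j) sval (cid (lim i j)).
have uK i j : (fun n => u n i j) @ U --> K i j by rewrite mxE; exact: svalP (cid (lim i j)).
have harm : (@harmonic R) @ U --> (0 : R).
  by apply: cvg_trans (@cvg_harmonic R); move=> A; exact: FU.
have tends (a : R) : (fun n => a + harmonic n) @ U --> a.
  by rewrite -[X in _ --> X]addr0; apply: cvgD => //; exact: cvg_cst.
exists K; split.
- by apply: (psd_limit UU uK) => n; case: (hu n).
- apply: (psd_limit (u := fun n => S - u n) UU) => [i j|n]; last by case: (hu n).
  rewrite !mxE (_ : (fun n => _) = (fun n => S i j - u n i j)); last by apply/funext => n; rewrite !mxE.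
  apply: cvgB; first exact: cvg_cst.
  by have := uK i j; rewrite mxE.
- apply: (cvg_ultra_le UU (cvg_tr_mul UU uK (A := W)) (tends c)) => n.
  by case: (hu n).
move=> Psi pPsi.
rewrite lerBlDr.
have lhs : (fun _ : nat => ln (\det S / \det Psi) + k%:R) @ U --> ln (\det S / \det Psi) + k%:R.
  exact: cvg_cst.
have rhs : (fun n => 2 * (r + harmonic n) + \tr (invmx Psi *m u n)) @ U -->
    2 * r + \tr (invmx Psi *m K).
  apply: cvgD; last exact: cvg_tr_mul.
  by apply: cvgM; [exact: cvg_cst|exact: tends].
apply: (cvg_ultra_le UU lhs rhs) => n; case: (hu n) => _ _ _ /(_ _ pPsi).
by rewrite lerBlDr.
Qed.

(** * From rate bounds to the Gaussian rate and back *)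

Section rate_bound_theory.
Context (R : realType) (k : nat) (S : 'M[R]_k) (hS : posdef S).

Lemma ln_prod (F : 'I_k -> R) : (forall i, 0 < F i) -> ln (\prod_i F i) = \sum_i ln (F i).
Proof.
move=> F0; apply: expR_inj; rewrite lnK ?posrE ?prodr_gt0// expR_sum.
by apply: eq_bigr => i _; rewrite lnK ?posrE.
Qed.

Lemma ln_le_sub1 (x : R) : 0 < x -> ln x <= x - 1.
Proof. by move=> x0; have := @le_ln1Dx R (x - 1); rewrite (addrC 1) subrK; apply; lra. Qed.

Lemma ln_det_ratio (Q : 'M[R]_k) (l : 'rV[R]_k) : S = Q *m Q^T -> Q \in unitmx ->
  (forall i, 0 < l 0 i) ->
  ln (\det S / \det (Q *m diag_mx l *m Q^T)) = - \sum_i ln (l 0 i).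
Proof.
move=> SQ Qu l0.
have Q2 : 0 < \det Q ^+ 2 by have := posdef_det Qu SQ; rewrite SQ det_mulmx det_tr -expr2.
have pl : 0 < \prod_i l 0 i by apply: prodr_gt0.
rewrite SQ det_congr det_mulmx det_tr -expr2 invfM mulrA divff ?gt_eqF// mul1r lnV ?posrE//.
by rewrite ln_prod.
Qed.

(** For Psi = K + h S the bound yields - sum_i ln (l_i + h) <= 2 r, with l_i the eigenvalues of [K]
    relative to [S]. A zero l_i would send the left side to +oo as h tends to 0; so [K] is positive
    definite, and Psi = K gives the claim. *)
Lemma rate_bound_gaussian_rate K (r : R) : psd K -> rate_bound S K r ->
  (gaussian_rate S K <= r%:E)%E.
Proof.
move=> pK rb.
have [Q [l [Qu SQ KQ]]] := simultaneous_diagonalization hS pK.1.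
have l0 : forall i, 0 <= l 0 i by apply: (diag_congr_psd Qu); rewrite -KQ.
have key (h : R) : 0 < h -> - \sum_i ln (l 0 i + h) <= 2 * r.
  move=> h0; pose m : 'rV[R]_k := \row_i (l 0 i + h).
  have m0 i : 0 < m 0 i by rewrite mxE ltr_wpDl.
  have := rb _ (posdef_diag_congr Qu m0); rewrite ln_det_ratio// invmx_congr// => [|i]; last by rewrite gt_eqF.
  rewrite tr_diag_congr; have -> : invmx Q *m K *m (invmx Q)^T = diag_mx l.
    by rewrite KQ !mulmxA mulVmx// mul1mx -mulmxA -trmx_mul mulVmx// trmx1 mulmx1.
  have : \sum_i (\row_i0 (m 0 i0)^-1) 0 i * diag_mx l i i <= \sum_(i < k) 1.
    apply: ler_sum => i _; rewrite !mxE eqxx mulr1n mulrC ler_pdivrMr ?mul1r; last by rewrite ltr_wpDl.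
    by rewrite lerDl ltW.
  rewrite sumr_const card_ord; under [X in - X]eq_bigr do rewrite mxE.
  lra.
have lp i : 0 < l 0 i.
  rewrite lt_def l0 andbT; apply/eqP => li.
  (* Here - ln h exceeds |2 r| by one more than the sum of the l_j, which bounds the other
     logarithms because ln x <= x - 1 and h <= 1. *)
  pose h := expR (- (`|2 * r| + \sum_j l 0 j + 1)) : R.
  have h0 : 0 < h by exact: expR_gt0.
  have sl : 0 <= \sum_j l 0 j by exact: sumr_ge0.
  have h1 : h <= 1 by rewrite -[leRHS]expR0 ler_expR oppr_le0 !addr_ge0.
  have := key h h0; rewrite (bigD1 i)//= li add0r expRK.
  have : \sum_(j < k | j != i) ln (l 0 j + h) <= \sum_(j < k | j != i) l 0 j.
    by apply: ler_sum => j _; have := ln_le_sub1 (ltr_wpDl (l0 j) h0); lra.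
  have : \sum_j l 0 j = \sum_(j < k | j != i) l 0 j by rewrite (bigD1 i)//= li add0r.
  have := ler_norm (2 * r); lra.
have pK' : posdef K by rewrite KQ; exact: posdef_diag_congr.
have dK : \det K != 0.
  by rewrite -unitfE -unitmxE posdef_unitmx.
rewrite /gaussian_rate (negbTE dK) lee_fin.
have := rb _ pK'; rewrite mulVmx ?posdef_unitmx// mxtrace1; lra.
Qed.

(** In coordinates where [Psi] is the identity and [K] is diagonal, this is ln l_i <= l_i - 1 summed
    over i. It makes [rate_bound_closed] applicable to near-minimizers of the optimization
    problem. *)
Lemma rate_bound_self K : posdef K -> rate_bound S K (2^-1 * ln (\det S / \det K)).
Proof.
move=> pK Psi pPsi.
have [Q [l [Qu PQ KQ]]] := simultaneous_diagonalization pPsi pK.1.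
have l0 : forall i, 0 < l 0 i by apply: (diag_congr_posdef Qu); rewrite -KQ.
have pP : 0 < \det Psi by exact: (posdef_det Qu PQ).
have pl : 0 < \prod_i l 0 i by exact: prodr_gt0.
have dK : \det K = \det Psi * \prod_i l 0 i.
  by rewrite KQ PQ det_congr det_mulmx det_tr expr2.
have pS : 0 < \det S.
  have [Q' [l' [Qu' SQ' _]]] := simultaneous_diagonalization hS hS.1.
  exact: (posdef_det Qu' SQ').
rewrite mulrA divff ?mul1r ?pnatr_eq0// dK !ln_div ?posrE ?mulr_gt0// lnM ?posrE// ln_prod//.
have -> : \tr (invmx Psi *m K) = \sum_i l 0 i.
  have -> : Psi = Q *m diag_mx (const_mx 1) *m Q^T by rewrite diag_const_mx mulmx1.
  rewrite invmx_congr => [||i]; [|by []|by rewrite mxE oner_eq0].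
  rewrite tr_diag_congr; apply: eq_bigr => i _.
  have -> : invmx Q *m K *m (invmx Q)^T = diag_mx l.
    by rewrite KQ !mulmxA mulVmx// mul1mx -mulmxA -trmx_mul mulVmx// trmx1 mulmx1.
  by rewrite !mxE invr1 mul1r eqxx.
have : \sum_i ln (l 0 i) <= \sum_(i < k) (l 0 i - 1).
  by apply: ler_sum => i _; exact: ln_le_sub1.
rewrite sumrB sumr_const card_ord; lra.
Qed.

End rate_bound_theory.

(** * Coding theorem *)

Lemma ln_1B_ge (R : realType) (y : R) : `|y| <= 2^-1 -> - (y + 2 * y ^+ 2) <= ln (1 - y).
Proof.
rewrite ler_norml => /andP[y1 y2]; have y0 : 0 < 1 - y by lra.
have := ln_le_sub1 (_ : 0 < (1 - y)^-1); rewrite invr_gt0 => /(_ y0).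
rewrite lnV ?posrE// => h; have : (1 - y)^-1 - 1 <= y + 2 * y ^+ 2; last by lra.
rewrite lerBlDr -[X in X <= _]mul1r ler_pdivrMr//.
have -> : (y + 2 * y ^+ 2 + 1) * (1 - y) = 1 + y ^+ 2 * (1 - 2 * y) by ring.
by rewrite lerDl mulr_ge0 ?sqr_ge0//; lra.
Qed.

(* Near-optimal rate and K-weighted distortion force the error covariance to be
   close to K: apply the converse with Psi^-1 = K^-1 - s W for small s > 0. *)
Lemma trace_continuity (R : realType) k (S K W : 'M[R]_k) (e : R) :
  posdef S -> posdef K -> W^T = W -> 0 < e ->
  exists2 delta, 0 < delta & forall M r, rate_bound S M r ->
    2 * r <= ln (\det S / \det K) + delta -> \tr (invmx K *m M) <= k%:R + delta ->
    \tr (W *m M) <= \tr (W *m K) + e.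
Proof.
move=> pS pK Wt e0.
have KWK : (K *m W *m K)^T = K *m W *m K by rewrite !trmx_mul pK.1 Wt mulmxA.
(* Diagonalizing [K] together with K W K writes both K^-1 and W as Q^-T D Q^-1 with D diagonal, so
   that K^-1 - s W can be inverted coordinatewise. *)
have [Q [w [Qu KQ WQ]]] := simultaneous_diagonalization pK KWK.
have Ku := posdef_unitmx pK.
have iK : invmx K = (invmx Q)^T *m invmx Q.
  have -> : K = Q *m diag_mx (const_mx 1) *m Q^T by rewrite diag_const_mx mulmx1.
  rewrite invmx_congr// => [|i]; last by rewrite mxE oner_eq0.
  have -> : \row_i ((const_mx 1 : 'rV[R]_k) 0 i)^-1 = const_mx 1 :> 'rV[R]_k.
    by apply/rowP => i; rewrite !mxE invr1.
  by rewrite diag_const_mx mulmx1.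
have QQ : Q^T *m (invmx Q)^T = 1%:M by rewrite -trmx_mul mulVmx// trmx1.
have WE : W = (invmx Q)^T *m diag_mx w *m invmx Q.
  transitivity (invmx K *m (K *m W *m K) *m invmx K).
    by rewrite !mulmxA mulVmx// mul1mx -mulmxA mulmxV// mulmx1.
  rewrite WQ iK -!mulmxA (mulmxA Q^T) QQ mul1mx !mulmxA.
  by rewrite -(mulmxA (invmx Q)^T) mulVmx// mulmx1.
pose m M i := (invmx Q *m M *m (invmx Q)^T) i i.
have trW M : \tr (W *m M) = \sum_i w 0 i * m M i by rewrite WE tr_diag_congr.
have trK M : \tr (invmx K *m M) = \sum_i m M i.
  have -> : invmx K = (invmx Q)^T *m diag_mx (const_mx 1) *m invmx Q.
    by rewrite diag_const_mx mulmx1 iK.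
  by rewrite tr_diag_congr; apply: eq_bigr => i _; rewrite mxE mul1r.
have mK i : m K i = 1.
  by rewrite /m KQ !mulmxA mulVmx// mul1mx QQ mxE eqxx.
pose A := \sum_i `|w 0 i|; pose A2 := \sum_i w 0 i ^+ 2.
have A0 : 0 <= A by apply: sumr_ge0.
have A20 : 0 <= A2 by apply: sumr_ge0 => i _; exact: sqr_ge0.
(* The first bound gives |s w_i| <= 1/2, the range of [ln_1B_ge]; the second makes the second-order
   term 2 s A2 at most e / 2. *)
pose s := Num.min (2 * (1 + A))^-1 (e / (4 * (1 + A2))).
have s0 : 0 < s.
  by rewrite lt_min invr_gt0 divr_gt0 ?mulr_gt0//; lra.
have sw i : `|s * w 0 i| <= 2^-1.
  rewrite normrM gtr0_norm//.
  have s1 : s <= (2 * (1 + A))^-1 by rewrite ge_min lexx.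
  have wA : `|w 0 i| <= 1 + A.
    by rewrite /A (bigD1 i)//= [1 + _]addrC -addrA lerDl addr_ge0// sumr_ge0.
  apply: le_trans (ler_pM _ _ s1 wA) _ => //; first exact: ltW.
  by rewrite invfM -mulrA mulVf ?mulr1// gt_eqF//; lra.
have s2 : 2 * s * A2 <= e / 2.
  have : s <= e / (4 * (1 + A2)) by rewrite ge_min lexx orbT.
  rewrite ler_pdivlMr ?mulr_gt0//; last by lra.
  by have := ltW s0; lra.
(* The tolerances in the rate and in the distortion together cost s e / 2; the second-order term
   takes the other half. *)
exists (s * e / 4); first by rewrite divr_gt0// mulr_gt0.
move=> M r rb hr hM.
have p1 i : 0 < 1 - s * w 0 i by have := sw i; rewrite ler_norml => /andP[]; lra.
pose l : 'rV[R]_k := \row_i (1 - s * w 0 i)^-1.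
have l0 i : 0 < l 0 i by rewrite mxE invr_gt0.
have dK : 0 < \det K by exact: (posdef_det Qu KQ).
have dS : 0 < \det S.
  have [Q' [l' [Qu' SQ' _]]] := simultaneous_diagonalization pS pS.1.
  exact: (posdef_det Qu' SQ').
have pPsi := posdef_diag_congr Qu l0.
have dPsi : 0 < \det (Q *m diag_mx l *m Q^T).
  rewrite det_congr mulr_gt0 ?prodr_gt0//.
  by move: dK; rewrite KQ det_mulmx det_tr -expr2.
have := rb _ pPsi.
have -> : ln (\det S / \det (Q *m diag_mx l *m Q^T)) =
    ln (\det S / \det K) + \sum_i ln (1 - s * w 0 i).
  have := ln_det_ratio KQ Qu l0; rewrite !ln_div ?posrE//.
  have -> : \sum_i ln (l 0 i) = - \sum_i ln (1 - s * w 0 i).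
    by rewrite -sumrN; apply: eq_bigr => i _; rewrite mxE lnV ?posrE.
  lra.
rewrite invmx_congr// => [|i]; last by rewrite gt_eqF.
have -> : \tr ((invmx Q)^T *m diag_mx (\row_i (l 0 i)^-1) *m invmx Q *m M) =
    \tr (invmx K *m M) - s * \tr (W *m M).
  rewrite tr_diag_congr trK trW mulr_sumr -sumrB; apply: eq_bigr => i _.
  have -> : (\row_i0 (l 0 i0)^-1) 0 i = 1 - s * w 0 i by rewrite !mxE invrK.
  by rewrite /m; ring.
have : \sum_i - (s * w 0 i + 2 * (s * w 0 i) ^+ 2) <= \sum_i ln (1 - s * w 0 i).
  by apply: ler_sum => i _; exact: ln_1B_ge.
have -> : \sum_i - (s * w 0 i + 2 * (s * w 0 i) ^+ 2) = - (s * \tr (W *m K) + s * (2 * s * A2)).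
  rewrite trW /A2 !mulr_sumr -big_split/= -sumrN; apply: eq_bigr => i _.
  by rewrite mK; ring.
move=> h1 h2; rewrite -(ler_pM2l s0).
have : s * (2 * s * A2) <= s * (e / 2) by rewrite ler_pM2l.
lra.
Qed.

Section coding.
Context d (T : measurableType d) (R : realType) (P : probability T R).
Context (k : nat) (B SX SV We Wd : 'M[R]_k) (X V : nat -> {RV P >-> k.-tuple R}).
Hypotheses (hSX : posdef SX) (hWe : We^T = We) (hWd : posdef Wd).
Hypothesis hX : forall t, gaussian (X t) SX.
Hypothesis hV : forall t, gaussian (V t) SV.
Hypothesis hXV : forall t, independent2 P (X t) (V t).
Hypothesis hiid : independent_seq P (fun t => pair_RV (X t) (V t)).

Let C0 := (B - 1%:M) *m SX *m (B - 1%:M)^T + SV.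
Let Wt := We *m (B - 1%:M) + (B - 1%:M)^T *m We + We.

Let Wt_sym : Wt^T = Wt.
Proof.
rewrite /Wt; move: (B - 1%:M) => D; rewrite !trmxD_mx !trmx_mul trmxK hWe.
by rewrite [X in X + _]addrC.
Qed.

Lemma encoder_bound r n (f : n.-tuple (k.-tuple R) -> nat) : is_encoder r f ->
  exists N, [/\ forall x, (0 < f x)%N, forall x, (f x <= N)%N & ln (N%:R : R) <= n%:R * r].
Proof.
move=> [mf fr]; exists (Num.trunc (expR (n%:R * r))); split=> [x|x|].
- by case: (fr x).
- by rewrite truncn_ge_nat ?expR_ge0//; case: (fr x).
have [f1 fx] := fr [tuple [tuple 0 | _ < k] | _ < n].
have N0 : (0 < Num.trunc (expR (n%:R * r)))%N.
  by rewrite truncn_gt0; apply: le_trans fx; rewrite ler1n.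
rewrite -[leRHS]expRK ler_ln ?posrE ?expR_gt0 ?ltr0n//.
by rewrite truncn_le// expR_ge0.
Qed.

Lemma encoder_rate_bound r n (f : n.-tuple (k.-tuple R) -> nat) g : (0 < n)%N ->
  is_encoder r f -> rate_bound SX (block_error_cov X f g) r.
Proof.
move=> n0 er; have [N [f0 fN Nr]] := encoder_bound er.
exact: (converse_rate_bound hSX hX hiid n0 er.1 f0 fN g Nr).
Qed.

Lemma achievable_feasible De r : achievable X V B We Wd De r ->
  exists2 K, feasible B SX SV We De K & (gaussian_rate SX K <= r%:E)%E.
Proof.
move=> [f [g [fg lims]]].
have [K [pK pSK trK rK]] : exists K, [/\ psd K, psd (SX - K),
    \tr (Wt *m K) <= De - \tr (We *m C0) & rate_bound SX K r].
  apply: rate_bound_closed => e e0.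
  (* The limit superior is an infimum of suprema over tails, so the distortion is below De + e on
     some tail. One positive [n] in it is enough, since the converse holds for every single code. *)
  have [n [n0 dn]] : exists n, (0 < n)%N /\
      (encoder_distortion X V B We (f n) (g n) <= (De + e)%:E)%E.
    have : (limn_esup (fun n => encoder_distortion X V B We (f n) (g n)) < (De + e)%:E)%E.
      by apply: le_lt_trans lims _; rewrite lte_fin ltrDl.
    move=> /ereal_inf_lt[_ [A oA <-] sA].
    have [n [An n0]] := filter_ex (filterI oA (nbhs_infty_gt 0)).
    exists n; split=> //; apply: le_trans (ltW sA); apply: ereal_sup_ubound.
    by exists n.
  have [er br] := fg n; have [N [f0 fN Nr]] := encoder_bound er.
  have og := best_response_orthogonal hX er.1 fN hWd br.
  exists (block_error_cov X (f n) (g n)); split.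
  - exact: (block_error_cov_psd hX er.1 fN).
  - exact: (block_error_cov_le hX er.1 fN).
  - by move: dn; rewrite (encoder_distortionE _ _ hX hV hXV hiid er.1 fN)// lee_fin -/C0 -/Wt; lra.
  - move=> Psi pPsi; have := encoder_rate_bound (g n) n0 er pPsi; lra.
exists K; last exact: rate_bound_gaussian_rate.
by split=> //; rewrite /loewner_le subr0.
Qed.

Lemma is_encoder_le r r' n (f : n.-tuple (k.-tuple R) -> nat) : r <= r' ->
  is_encoder r f -> is_encoder r' f.
Proof.
move=> rr [mf h]; split=> // x; have [f1 fx] := h x; split=> //.
by apply: le_trans fx _; rewrite ler_expR ler_wpM2l.
Qed.

Let valid r n (fg : (n.-tuple (k.-tuple R) -> nat) * (nat -> 'I_n -> 'cV[R]_k)) :=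
  is_encoder r fg.1 /\ best_response X Wd fg.1 fg.2.

Let dist n (fg : (n.-tuple (k.-tuple R) -> nat) * (nat -> 'I_n -> 'cV[R]_k)) :=
  encoder_distortion X V B We fg.1 fg.2.

Let valid_exists r n : 0 <= r -> exists fg, @valid r n fg.
Proof.
move=> r0; pose f (x : n.-tuple (k.-tuple R)) := 1%N.
have er : is_encoder r f.
  split; first exact: measurable_cst.
  by move=> x; split=> //; rewrite -[leLHS]expR0 ler_expR mulr_ge0.
have [N [f0 fN Nr]] := encoder_bound er.
have [g og] := orthogonal_code_exists hX er.1 fN.
exists (f, g); split=> //; exact: (orthogonal_best_response hX er.1 fN (posdef_psd hWd) og).
Qed.

(** A diagonal choice: at blocklength [n], take a code that meets the tolerance 1/(m+1) for every m
    < n for which some code does; the tolerances are nested, so the smallest attainable one decides.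
    When none is attainable, the constant encoder is a valid code because r >= 0. *)
Lemma achievable_of_limit De r : 0 <= r ->
  (forall e, 0 < e -> exists n0, forall n, (n0 <= n)%N -> exists fg, @valid r n fg /\
    (dist fg <= (De + e)%:E)%E) ->
  achievable X V B We Wd De r.
Proof.
move=> r0 h.
have near_opt n : exists fg, @valid r n fg /\ forall m, (m < n)%N ->
    (exists fg', @valid r n fg' /\ (dist fg' <= (De + harmonic m)%:E)%E) ->
    (dist fg <= (De + harmonic m)%:E)%E.
  suff : forall M, exists fg, @valid r n fg /\ forall m, (m < M)%N ->
    (exists fg', @valid r n fg' /\ (dist fg' <= (De + harmonic m)%:E)%E) ->
    (dist fg <= (De + harmonic m)%:E)%E by apply.
  elim=> [|M [fg [vfg IH]]].
    by have [fg vfg] := valid_exists n r0; exists fg.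
  have [[fg' [vfg' dfg']]|no] := pselect (exists fg', @valid r n fg' /\
      (dist fg' <= (De + harmonic M)%:E)%E).
    exists fg'; split=> // m; rewrite ltnS => mM _; apply: le_trans dfg' _.
    by rewrite lee_fin lerD2l /harmonic/= lef_pV2 ?posrE ?ltr0n// ler_nat ltnS.
  exists fg; split=> // m; rewrite ltnS leq_eqVlt => /orP[/eqP ->|]; first by move=> /no.
  exact: IH.
pose c n := projT1 (cid (near_opt n)).
have cP n : @valid r n (c n) /\ forall m, (m < n)%N ->
    (exists fg', @valid r n fg' /\ (dist fg' <= (De + harmonic m)%:E)%E) ->
    (dist (c n) <= (De + harmonic m)%:E)%E by exact: (projT2 (cid (near_opt n))).
exists (fun n => (c n).1), (fun n => (c n).2); split; first by move=> n; exact: (cP n).1.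
apply/lee_addgt0Pr => e e0; rewrite -EFinD.
have [m me] : exists m, harmonic m <= e.
  by have /cvgrPdist_le/(_ _ e0)[m _ /(_ m (leqnn m))] := @cvg_harmonic R;
     rewrite sub0r normrN => h'; exists m; exact: le_trans (ler_norm _) h'.
have [n0 hn0] := h _ (harmonic_gt0 m).
apply: (@le_trans _ _ (ereal_sup ((fun n => dist (c n)) @` [set n | (maxn n0 m.+1 <= n)%N]))).
  apply: ereal_inf_lbound; exists [set n | (maxn n0 m.+1 <= n)%N] => //.
  exact: nbhs_infty_ge.
apply: ge_ereal_sup => x [n /=]; rewrite geq_max => /andP[nn0 nm] <-.
apply: le_trans ((cP n).2 m nm _) _; first exact: hn0.
by rewrite lee_fin lerD2l.
Qed.

Lemma feasible_achievable De K r : feasible B SX SV We De K ->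
  (gaussian_rate SX K < r%:E)%E -> achievable X V B We Wd De r.
Proof.
rewrite /feasible -/C0 -/Wt => -[K0 KS trK]; rewrite /loewner_le subr0 in K0.
rewrite /gaussian_rate; case: ifPn => // dK; rewrite lte_fin => hr.
have [Q [l [Qu SQ KQ]]] := simultaneous_diagonalization hSX K0.1.
have lge0 := diag_congr_psd Qu (l := l); rewrite -KQ in lge0; have {}lge0 := lge0 K0.
have l0 i : 0 < l 0 i.
  rewrite lt_def lge0 andbT; apply: contra_neqT dK => /negPn/eqP li.
  by rewrite KQ det_congr (bigD1 i)//= li mul0r mulr0.
have l1 i : l 0 i <= 1.
  have : psd (Q *m diag_mx (const_mx 1 - l) *m Q^T).
    have -> : diag_mx (const_mx 1 - l) = 1%:M - diag_mx l :> 'M[R]_k.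
      by rewrite -diag_const_mx; apply/matrixP => p q; rewrite !mxE -mulrnBl.
    by rewrite mulmxBr mulmxBl mulmx1 -SQ -KQ.
  by move/(diag_congr_psd Qu)/(_ i); rewrite !mxE subr_ge0.
have l01 i : 0 < l 0 i <= 1 by rewrite l0 l1.
have pK : posdef K by rewrite KQ; exact: posdef_diag_congr.
have rE : ln (\det SX / \det K) = - \sum_i ln (l 0 i) by rewrite KQ ln_det_ratio.
rewrite rE in hr; set R0 := 2^-1 * _ in hr.
have R00 : 0 <= R0.
  rewrite mulr_ge0 ?invr_ge0// oppr_ge0; apply: sumr_le0 => i _; exact: ln_le0.
apply: achievable_of_limit => [|e e0]; first by lra.
have [dl dl0 hdl] := trace_continuity hSX pK Wt_sym e0.
(* The first bound keeps the rate below [r]; the half is there because [trace_continuity] measures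
   twice the rate. *)
pose d1 := Num.min (r - R0) (dl / 2).
have d10 : 0 < d1 by rewrite lt_min subr_gt0 hr divr_gt0.
have d1r : d1 <= r - R0 by rewrite ge_min lexx.
have d1d : d1 <= dl / 2 by rewrite ge_min lexx orbT.
have [n0 hn0] := rate_achieving_codes SQ Qu KQ l01 hX hiid d10.
exists n0.+1 => n nn0; have [f [g [er og tr1]]] := hn0 n (ltnW nn0).
have n1 : (0 < n)%N by apply: leq_trans nn0.
have [N [f0 fN Nr]] := encoder_bound er.
exists (f, g); split.
  split=> /=; last exact: (orthogonal_best_response hX er.1 fN (posdef_psd hWd) og).
  by apply: is_encoder_le er; move: d1r; rewrite /R0; lra.
rewrite /dist /= (encoder_distortionE _ _ hX hV hXV hiid er.1 fN)// lee_fin -/C0 -/Wt.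
have : \tr (Wt *m block_error_cov X f g) <= \tr (Wt *m K) + e; last by lra.
apply: (hdl _ _ (encoder_rate_bound g n1 er)); last by lra.
by rewrite rE; move: d1d dl0; lra.
Qed.

Lemma strategic_rdE De : strategic_rd X V B We Wd De =
  ereal_inf [set gaussian_rate SX K | K in feasible B SX SV We De].
Proof.
apply/le_anti/andP; split.
- apply: le_ereal_inf_tmp => _ [K FK <-].
  have [->|/eqP dK] := eqVneq (gaussian_rate SX K) +oo%E; first exact: leey.
  have fK : gaussian_rate SX K \is a fin_num by move: dK; rewrite /gaussian_rate; case: ifP.
  rewrite -(fineK fK); apply/lee_addgt0Pr => e e0; rewrite -EFinD.
  apply: ereal_inf_lbound; exists (fine (gaussian_rate SX K) + e) => //=.
  by apply: (feasible_achievable FK); rewrite EFinD fineK// lteDl// lte_fin.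
- apply: le_ereal_inf_tmp => _ [r /= ach <-].
  have [K FK Kr] := achievable_feasible ach.
  by apply: le_trans Kr; apply: ereal_inf_lbound; exists K.
Qed.

(** An operational argument: a negative value would make a negative rate achievable, but at such a
    rate the message set is already empty at blocklength 1. *)
Lemma gaussian_rate_ge0 De K : feasible B SX SV We De K -> (0 <= gaussian_rate SX K)%E.
Proof.
move=> FK; rewrite leNgt; apply/negP => lt0.
have fK : gaussian_rate SX K \is a fin_num by move: lt0; rewrite /gaussian_rate; case: ifP.
move: lt0; rewrite -(fineK fK) lte_fin => lt0.
have [//|f [g [fg _]]] := feasible_achievable FK (r := fine (gaussian_rate SX K) / 2).
  by rewrite -[ltLHS](fineK fK) lte_fin; lra.
have [_ /(_ [tuple [tuple 0 | _ < k] | _ < 1])[f1 fr]] := (fg 1%N).1.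
have : (1 : R) <= expR (1%:R * (fine (gaussian_rate SX K) / 2)).
  by apply: le_trans fr; rewrite ler1n.
by rewrite -[leLHS]expR0 ler_expR mul1r; lra.
Qed.

(** Compactness is applied to the rate bounds, which stay finite at singular limits: near-minimizers
    satisfy them by [rate_bound_self], a limit satisfies them at the infimum, and
    [rate_bound_gaussian_rate] converts back. If the infimum is +oo, any feasible matrix attains
    it. *)
Lemma gaussian_rate_attained De : feasible B SX SV We De !=set0 ->
  exists2 K, feasible B SX SV We De K &
    ereal_inf [set gaussian_rate SX K | K in feasible B SX SV We De] = gaussian_rate SX K.
Proof.
move=> [K0 FK0]; set I := ereal_inf _.
have I0 : (0 <= I)%E by apply: le_ereal_inf_tmp => _ [K FK <-]; exact: gaussian_rate_ge0 FK.
have [Iy|Iy] := eqVneq I +oo%E.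
  exists K0 => //; apply/esym/eqP; rewrite Iy -leye_eq -Iy.
  by apply: ereal_inf_lbound; exists K0.
have fI : I \is a fin_num by rewrite ge0_fin_numE// lt_neqAle Iy leey.
have [K [pK pSK trK rK]] : exists K, [/\ psd K, psd (SX - K),
    \tr (Wt *m K) <= De - \tr (We *m C0) & rate_bound SX K (fine I)].
  apply: rate_bound_closed => e e0.
  have : (I < (fine I + e)%:E)%E by rewrite -[ltLHS](fineK fI) lte_fin ltrDl.
  move=> /ereal_inf_lt[_ [K FK <-] Ke].
  case: (FK); rewrite -/C0 -/Wt => pK KS trK; rewrite /loewner_le subr0 in pK.
  exists K; split=> //; first by lra.
  move: Ke; rewrite /gaussian_rate; case: ifPn => // dK; rewrite lte_fin => Ke.
  have pdK : posdef K.
    have [Q [l [Qu SQ KQ]]] := simultaneous_diagonalization hSX pK.1.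
    have lge0 := diag_congr_psd Qu (l := l); rewrite -KQ in lge0; have {}lge0 := lge0 pK.
    rewrite KQ; apply: posdef_diag_congr => // i.
    rewrite lt_def lge0 andbT; apply: contra_neqT dK => /negPn/eqP li.
    by rewrite KQ det_congr (bigD1 i)//= li mul0r mulr0.
  by move=> Psi pPsi; have := rate_bound_self hSX pdK pPsi; lra.
have FK : feasible B SX SV We De K by split=> //; rewrite /loewner_le subr0.
exists K => //; apply/le_anti/andP; split; first by apply: ereal_inf_lbound; exists K.
by rewrite -[leRHS](fineK fI); exact: rate_bound_gaussian_rate.
Qed.

End coding.

(** * Joint laws *)

Section joint_law.
Context d (T : measurableType d) (R : realType) (P : probability T R).
Context d1 d2 (T1 : measurableType d1) (T2 : measurableType d2).
Context (X : {RV P >-> T1}) (Y : {RV P >-> T2}).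
Hypothesis XY : independent2 P X Y.

Lemma joint_law (A : set (T1 * T2)) : measurable A ->
  (distribution P X \x distribution P Y)%E A = distribution P (pair_RV X Y) A.
Proof.
by move=> mA; apply: product_measure_unique.
Qed.

Lemma independent2_ge0_integral_pair (F : T1 * T2 -> \bar R) :
  measurable_fun setT F -> (forall z, 0 <= F z)%E ->
  (\int[P]_w F (X w, Y w) = \int[distribution P X]_x \int[distribution P Y]_y F (x, y))%E.
Proof.
move=> mF F0.
rewrite -[RHS](fubini_tonelli1 (m1 := distribution P X) (m2 := distribution P Y) F)//.
rewrite [RHS](@eq_measure_integral _ _ _ _ (distribution P (pair_RV X Y))); last first.
  by move=> A mA _; exact: joint_law.
by rewrite [RHS]ge0_integral_pushforward.
Qed.

End joint_law.

Lemma std_affine_ratio (R : realType) (l a : R) (G : R -> \bar R) : 0 < l ->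
  measurable_fun setT G -> (forall y, 0 <= G y)%E ->
  (\int[gauss (0 : R) 1]_y G (Num.sqrt l * y + a)%R =
   \int[gauss (0 : R) 1]_y (G y * (normal_ratio l a y)%:E))%E.
Proof.
move=> l0 mG G0; have s0 : Num.sqrt l != 0 by rewrite gt_eqF ?sqrtr_gt0.
rewrite [LHS](ge0_integral_std_affine a s0 mG G0) [LHS](ge0_integral_gauss _ _ mG G0).
rewrite [RHS](ge0_integral_gauss 0 1 (F := fun y => G y * (normal_ratio l a y)%:E)%E).
- by apply: eq_integral => y _; rewrite -muleA -EFinM normal_ratio_pdf.
- apply: emeasurable_funM => //; apply/measurable_EFinP; exact: measurable_normal_ratio.
- by move=> y; rewrite mule_ge0// lee_fin normal_ratio_ge0.
Qed.

Lemma measure_density (d : measure_display) (T : measurableType d) (R : realType)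
    (mu : {measure set T -> \bar R}) (h : T -> \bar R) :
  measurable_fun setT h -> (forall x, 0 <= h x)%E ->
  exists m : {measure set T -> \bar R}, forall A, m A = (\int[mu]_(x in A) h x)%E.
Proof.
move=> mh h0; pose m A := (\int[mu]_(x in A) h x)%E.
have m0 : m set0 = 0%E by rewrite /m integral_set0.
have mge0 A : (0 <= m A)%E by apply: integral_ge0.
have madd : semi_sigma_additive m by exact: semi_sigma_additive_nng_induced.
pose M := isMeasure.Build _ _ _ m m0 mge0 madd.
pose mm : {measure set T -> \bar R} := HB.pack m M.
by exists mm.
Qed.

Section tuple_of_vector.
Context d (T : measurableType d) (R : realType) (k : nat).

Definition tuple_of (v : 'cV[R]_k) : k.-tuple R := [tuple v i 0 | i < k].

Lemma tuple_ofK v : vec (tuple_of v) = v.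
Proof. by apply/colP => i; rewrite mxE tnth_mktuple. Qed.

Lemma vecK : cancel (@vec R k) tuple_of.
Proof. by move=> x; apply: eq_from_tnth => i; rewrite tnth_mktuple mxE. Qed.

Lemma measurable_tuple_of (f : T -> 'cV[R]_k) :
  (forall i, measurable_fun setT (fun w => f w i 0)) -> measurable_fun setT (tuple_of \o f).
Proof.
move=> mf; apply/measurable_fun_tnthP => i.
by rewrite (_ : _ \o _ = fun w => f w i 0)//; apply/funext => w /=; rewrite tnth_mktuple.
Qed.

Lemma measurable_mulmx_col (f : T -> 'cV[R]_k) (M : 'M[R]_k) :
  (forall i, measurable_fun setT (fun w => f w i 0)) ->
  forall i, measurable_fun setT (fun w => (M *m f w) i 0).
Proof.
move=> mf i; under eq_fun do rewrite mxE.
by apply: measurable_sum => j; exact: measurable_funM.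
Qed.

End tuple_of_vector.

(** * The joint law of a Gaussian channel *)

Section gaussian_channel.
Context d (T : measurableType d) (R : realType) (P : probability T R) (k : nat).
Context (S Q : 'M[R]_k) (SQ : S = Q *m Q^T) (Qu : Q \in unitmx).
Context (X Y : {RV P >-> k.-tuple R}).
Hypotheses (XS : gaussian X S) (YS : gaussian Y S) (XY : independent2 P X Y).
Context (l : 'rV[R]_k) (l01 : forall i, 0 <= l 0 i <= 1).
Local Notation N := (gauss (0 : R) 1).

Let x (i : 'I_k) w := whiten Q (X w) i 0.
Let y (i : 'I_k) w := whiten Q (Y w) i 0.

Let mx i : measurable_fun setT (x i). Proof. exact: measurable_whiten_RV. Qed.
Let my i : measurable_fun setT (y i). Proof. exact: measurable_whiten_RV. Qed.

Lemma whiten_distribution (Z : {RV P >-> k.-tuple R}) : gaussian Z S ->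
  iid_normal (distribution P Z) (fun i z => whiten Q z i 0).
Proof.
move=> ZS; apply/iid_normalP => [i|A mA]; first exact: measurable_whiten.
have /iid_normalP h := whiten_iid SQ Qu ZS.
by rewrite -h// => i; exact: measurable_whiten_RV.
Qed.

(** By Fubini, the factors matter only through their partial integrals [f i a] over the second
    coordinate. In [channel_law] this trades a shifted argument for a likelihood ratio. *)
Lemma independent_pair_integral (F F' : 'I_k -> R * R -> R) (f : 'I_k -> R -> R) :
  (forall i, measurable_fun setT (F i)) -> (forall i, measurable_fun setT (F' i)) ->
  (forall i z, 0 <= F i z) -> (forall i z, 0 <= F' i z) ->
  (forall i a, \int[N]_b (F i (a, b))%:E = (f i a)%:E)%E ->
  (forall i a, \int[N]_b (F' i (a, b))%:E = (f i a)%:E)%E ->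
  (\int[P]_w (\prod_i F i (x i w, y i w))%:E = \int[P]_w (\prod_i F' i (x i w, y i w))%:E)%E.
Proof.
move=> mF mF' F0 F'0 fF fF'.
have one (G : 'I_k -> R * R -> R) : (forall i, measurable_fun setT (G i)) ->
    (forall i z, 0 <= G i z) -> (forall i a, \int[N]_b (G i (a, b))%:E = (f i a)%:E)%E ->
    (\int[P]_w (\prod_i G i (x i w, y i w))%:E =
      \int[distribution P X]_a (\prod_i f i (whiten Q a i 0))%:E)%E.
  move=> mG G0 fG.
  have mH : measurable_fun setT (fun z : k.-tuple R * k.-tuple R =>
      (\prod_i G i (whiten Q z.1 i 0, whiten Q z.2 i 0))%:E).
    apply/measurable_EFinP; apply: measurable_prod => i _; apply: measurableT_comp => //.
    by apply: measurable_fun_pair;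
      [apply: (measurableT_comp (measurable_whiten Q i))|apply: (measurableT_comp (measurable_whiten Q i))].
  rewrite [LHS](independent2_ge0_integral_pair XY mH) => [|z]; last first.
    by rewrite lee_fin; apply: prodr_ge0.
  apply: eq_integral => a _ /=.
  apply: (@iid_normal_ge0_integral _ _ _ _ _ (fun i z => whiten Q z i 0)
    (fun i b => G i (whiten Q a i 0, b)) (fun i => f i (whiten Q a i 0)) (whiten_distribution YS)) => // i.
  exact: measurable_fun_pair2.
by rewrite one// one.
Qed.

(** The output of the test channel in whitened coordinates, scaled to unit variance: without a
    division by 1 - l, the value l_i = 1 is allowed. *)
Definition channel_output (w : T) : 'cV[R]_k :=
  \col_i (Num.sqrt (1 - l 0 i) * x i w + Num.sqrt (l 0 i) * y i w).

Let v (i : 'I_k) w := channel_output w i 0.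

Let mv i : measurable_fun setT (v i).
Proof.
rewrite /v /channel_output; under eq_fun do rewrite mxE.
by apply: measurable_funD; apply: measurable_funM.
Qed.

Let xi1 w : k.-tuple (R * R) := [tuple (x i w, v i w) | i < k].
Let xi0 w : k.-tuple (R * R) := [tuple (x i w, y i w) | i < k].

Let mxi1 : measurable_fun setT xi1.
Proof.
apply/measurable_fun_tnthP => i.
rewrite (_ : _ \o _ = fun w => (x i w, v i w)); last by apply/funext => w /=; rewrite tnth_mktuple.
exact: measurable_fun_pair.
Qed.

Let mxi0 : measurable_fun setT xi0.
Proof.
apply/measurable_fun_tnthP => i.
rewrite (_ : _ \o _ = fun w => (x i w, y i w)); last by apply/funext => w /=; rewrite tnth_mktuple.
exact: measurable_fun_pair.
Qed.

Let ratio i (z : R * R) := normal_ratio (l 0 i) (Num.sqrt (1 - l 0 i) * z.1) z.2.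

Let mratio i : measurable_fun setT (ratio i).
Proof.
apply: measurable_funM => //; apply: measurableT_comp; first exact: measurable_expR.
apply: measurable_funB; first by apply: measurable_funM => //; exact: measurable_funX.
by apply: measurable_funM => //; apply: measurable_funX; apply: measurable_funB => //; exact: measurable_funM.
Qed.

(** Given x_i the output is N(sqrt (1 - l_i) x_i, l_i), that is, the law of y_i reweighted by a
    likelihood ratio. The independent pair (x, y) thus serves as reference measure; rectangles
    reduce the claim to single coordinates. *)
Lemma channel_law (A : set (k.-tuple (R * R))) : (forall i, 0 < l 0 i) -> measurable A ->
  P [set w | A [tuple (x i w, v i w) | i < k]] =
  (\int[P]_(w in [set w | A [tuple (x i w, y i w) | i < k]])
    (\prod_i normal_ratio (l 0 i) (Num.sqrt (1 - l 0 i) * x i w) (y i w))%:E)%E.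
Proof.
move=> l0 mA.
have mrho : measurable_fun setT (fun w => \prod_i ratio i (x i w, y i w)).
  by apply: measurable_prod => i _; apply: measurableT_comp => //; exact: measurable_fun_pair.
have rho0 w : 0 <= \prod_i ratio i (x i w, y i w).
  by apply: prodr_ge0 => i _; exact: normal_ratio_ge0.
pose m1 : {measure set k.-tuple (R * R) -> \bar R} :=
  measure_function_pushforward__canonical__measure_function_Measure P mxi1.
have mrhoE : measurable_fun setT (fun w => (\prod_i ratio i (x i w, y i w))%:E).
  exact/measurable_EFinP.
have [m m2E] := measure_density P mrhoE rho0.
pose m2 : {measure set k.-tuple (R * R) -> \bar R} :=
  measure_function_pushforward__canonical__measure_function_Measure m mxi0.
suff -> : P [set w | A [tuple (x i w, v i w) | i < k]] = m2 A by rewrite /m2 /= /pushforward m2E.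
apply: (tuple_measure_unique (m1 := m1)) => //.
  by rewrite /m1 /= /pushforward preimage_setT probability_setT ltry.
move=> C mC; rewrite /m1 /m2 /= /pushforward m2E.
pose F i (z : R * R) : R := \1_(C i) (z.1, Num.sqrt (l 0 i) * z.2 + Num.sqrt (1 - l 0 i) * z.1).
pose F' i (z : R * R) : R := \1_(C i) z * ratio i z.
have mF i : measurable_fun setT (F i).
  apply: (measurableT_comp (bmf_indic R (mC i)).1); apply: measurable_fun_pair => //.
  by apply: measurable_funD; exact: measurable_funM.
have mF' i : measurable_fun setT (F' i) by apply: measurable_funM => //; exact: (bmf_indic R (mC i)).1.
have F0 i z : 0 <= F i z by rewrite /F indicE.
have F'0 i z : 0 <= F' i z by rewrite mulr_ge0 ?indicE ?normal_ratio_ge0.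
have bF i a : bounded_measurable (fun b => F i (a, b)).
  split; first exact: measurable_fun_pair2.
  by exists 1 => b; rewrite /F indicE; case: (_ \in _); rewrite ?normr1 ?normr0.
pose f i a := (\int[N]_b F i (a, b))%R.
have fF i a : (\int[N]_b (F i (a, b))%:E = (f i a)%:E)%E.
  exact: (EFin_Rintegral (bmf_integrable (T := measurableTypeR R) N (bF i a))).
have fF' i a : (\int[N]_b (F' i (a, b))%:E = (f i a)%:E)%E.
  rewrite -fF; pose G b : \bar R := ((\1_(C i) (a, b) : R)%:E).
  have mG : measurable_fun setT G.
    apply/measurable_EFinP; apply: (measurableT_comp (bmf_indic R (mC i)).1).
    exact: measurable_fun_pair.
  have G0 b : (0 <= G b)%E by rewrite lee_fin indicE.
  by rewrite [RHS](std_affine_ratio (Num.sqrt (1 - l 0 i) * a) (l0 i) mG G0).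
have := independent_pair_integral mF mF' F0 F'0 fF fF'.
have mC1 : measurable [set z : k.-tuple (R * R) | forall i, C i (tnth z i)].
  apply: measurable_forall => i; rewrite -[X in measurable X]setTI; exact: measurable_tnth.
have m11 : measurable (xi1 @^-1` [set z | forall i, C i (tnth z i)]).
  by rewrite -[X in measurable X]setTI; exact: mxi1.
have m00 : measurable (xi0 @^-1` [set z | forall i, C i (tnth z i)]).
  by rewrite -[X in measurable X]setTI; exact: mxi0.
have prod1 (I : 'I_k -> bool) : \prod_i (I i)%:R = ([forall i, I i])%:R :> R.
  case: forallP => [h|/existsNP[j /negP nj]]; first by rewrite big1// => i _; rewrite h.
  by rewrite (bigD1 j)//= (negbTE nj) mul0r.
have e1 w : \prod_i F i (x i w, y i w) = \1_(xi1 @^-1` [set z | forall i, C i (tnth z i)]) w.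
  rewrite indicE; under eq_bigr do rewrite /F indicE; rewrite prod1; congr ((nat_of_bool _)%:R).
  have e i : (x i w, Num.sqrt (l 0 i) * y i w + Num.sqrt (1 - l 0 i) * x i w) = tnth (xi1 w) i.
    by rewrite tnth_mktuple /v mxE addrC.
  apply/forallP/idP => [h|/set_mem/= h i]; last by rewrite /= e mem_set//; exact: h.
  by apply/mem_set => i; have := h i; rewrite /= e => /set_mem.
have e2 w : \prod_i F' i (x i w, y i w) =
    \1_(xi0 @^-1` [set z | forall i, C i (tnth z i)]) w * \prod_i ratio i (x i w, y i w).
  rewrite big_split/=; congr (_ * _).
  rewrite indicE; under eq_bigr do rewrite indicE; rewrite prod1; congr ((nat_of_bool _)%:R).
  have e i : (x i w, y i w) = tnth (xi0 w) i by rewrite tnth_mktuple.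
  apply/forallP/idP => [h|/set_mem/= h i]; last by rewrite /= e mem_set//; exact: h.
  by apply/mem_set => i; have := h i; rewrite /= e => /set_mem.
have -> : (\int[P]_w (\prod_i F i (x i w, y i w))%:E)%E =
    P (xi1 @^-1` [set z | forall i, C i (tnth z i)]).
  rewrite -[in RHS](setIT (xi1 @^-1` _)) -(integral_indic P measurableT m11).
  by apply: eq_integral => w _; rewrite e1.
move=> ->.
rewrite [RHS]integral_mkcond; apply: eq_integral => w _.
by rewrite e2 /patch indicE; case: ifPn => _; rewrite ?mul1r ?mul0r.
Qed.

End gaussian_channel.

(** * Gaussian test channels *)

Lemma iid_normal_point d (T : measurableType d) (R : realType) (P : probability T R)
    (J : finType) (W : J -> T -> R) (j : J) (c : R) :
  iid_normal P W -> P [set w | W j w = c] = 0%E.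
Proof.
move=> iid; have /iid_normalP h := iid.
have := h iid.1 (fun i => if i == j then [set c] else setT).
have mA i : measurable (if i == j then [set c] else setT : set R) by case: ifP => // _; exact: measurable_set1.
move=> /(_ mA); rewrite (bigD1 j)//= eqxx gaussE /normal_prob integral_set1 mul0r => e; apply: etrans e.
congr (P _); apply/seteqP; split=> w /= => [wc i|/(_ j)]; last by rewrite eqxx.
by case: eqP => // ->.
Qed.

Lemma measurable_lne_fin d (T : measurableType d) (R : realType) (f : T -> R) :
  measurable_fun setT f -> measurable_fun setT (fun x => lne (f x)%:E).
Proof.
move=> mf; apply: measurable_fun_ifT.
- exact: measurable_fun_ler.
- exact: measurable_cst.
- by apply/measurable_EFinP; apply: measurableT_comp => //; exact: measurable_ln.
Qed.

(** The Radon-Nikodym derivative is determined only [nu]-almost everywhere; it agrees with [h]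
    there, and domination carries this over to [mu], against which the logarithm is integrated. *)
Lemma relative_entropy_density d (T : measurableType d) (R : realType)
    (mu nu : probability T R) (h : T -> R) :
  measurable_fun setT h -> (forall z, 0 < h z) ->
  (forall C, measurable C -> mu C = \int[nu]_(z in C) (h z)%:E)%E ->
  relative_entropy mu nu = (\int[mu]_z (ln (h z))%:E)%E.
Proof.
move=> mh h0 muE.
have dom : mu `<< nu.
  apply/null_content_dominatesP => C mC nC; rewrite muE//.
  apply: null_set_integral => //; apply: measurable_funTS; exact/measurable_EFinP.
have dom' : charge_of_finite_measure mu `<< nu by [].
rewrite /relative_entropy asboolT//; set f := Radon_Nikodym _ _.
have fi : nu.-integrable setT f by exact: Radon_Nikodym_integrable.
have mf : measurable_fun setT f by exact: measurable_int fi.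
have ffin z : f z \is a fin_num by exact: Radon_Nikodym_fin_num.
have fae : ae_eq nu setT f (EFin \o h).
  apply: integral_ae_eq => // [|C _ mC]; first exact/measurable_EFinP.
  by rewrite -Radon_Nikodym_integral// -muE.
have fE : f = (fun z => (fine (f z))%:E) by apply/funext => z; rewrite fineK.
have mff : measurable_fun setT (fun z => fine (f z)).
  by apply/measurable_EFinP; move: mf; rewrite {1}fE.
have ae_mu : ae_eq mu setT (fun z => lne (f z)) (fun z => lne (h z)%:E).
  apply: (null_dominates_ae_eq measurableT dom).
  by apply: filterS fae => z hz /hz ->.
have mlf : measurable_fun setT (fun z => lne (f z)) by rewrite fE; exact: measurable_lne_fin.
rewrite (ae_eq_integral _ _ measurableT mlf (measurable_lne_fin mh) ae_mu).
by apply: eq_integral => z _; rewrite lne_EFin.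
Qed.

(** * Versions of conditional expectations *)

Section conditional_expectation.
Context d d' (T : measurableType d) (T' : measurableType d') (R : realType).
Context (P : probability T R) (U : {RV P >-> T'}) (Y : T -> R).

(** The event Z' < Z is generated by [U], so Z and Z' have the same integral over it although Z - Z'
    is positive on it. *)
Let cond_exp_le Z Z' : is_cond_exp P Y U Z -> is_cond_exp P Y U Z' ->
  {ae P, forall w, Z w <= Z' w}.
Proof.
move=> [mZ iZ eZ] [mZ' iZ' eZ'].
pose A := [set w | Z' w < Z w].
have mU : measurable_fun setT U by exact: measurable_funPT.
have sU B : g_sigma_algebra_preimage U B -> measurable B.
  by move=> [C mC <-]; exact: mU.
have sA : g_sigma_algebra_preimage U A.
  have mf (F : T -> R) : (forall B, measurable B -> g_sigma_algebra_preimage U (F @^-1` B)) ->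
      measurable_fun (setT : set (g_sigma_algebra_preimageType U)) F.
    by move=> h _ B mB; rewrite setTI; exact: h.
  have := measurable_fun_ltr (mf _ mZ') (mf _ mZ) measurableT (Y := [set true]) I.
  by rewrite setTI.
have mA := sU _ sA.
have iA F : P.-integrable setT (EFin \o F) -> P.-integrable A (EFin \o F).
  by move=> iF; apply: integrableS iF.
have d0 : (\int[P]_(w in A) `|(Z w - Z' w)%:E| = 0)%E.
  transitivity (\int[P]_(w in A) ((Z w)%:E - (Z' w)%:E))%E.
    apply: eq_integral => w /set_mem; rewrite /A/= => zz.
    by rewrite -EFinD ger0_norm// subr_ge0 ltW.
  rewrite integralB//; try exact: iA.
  rewrite eZ// -eZ'// subee//.
  exact: (integrable_fin_num mA (iA _ iZ')).
have md : measurable_fun A (fun w => (Z w - Z' w)%:E).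
  apply: measurable_funTS; apply/measurable_EFinP; apply: measurable_funB.
    by apply/measurable_EFinP; exact: measurable_int iZ.
  by apply/measurable_EFinP; exact: measurable_int iZ'.
have /(ae_eq_integral_abs P mA md) := d0; apply: filterS => w h.
rewrite leNgt; apply/negP => zz; have := h zz => -[] /eqP.
by rewrite subr_eq0 => /eqP e; move: zz; rewrite e ltxx.
Qed.

Lemma cond_exp_unique Z Z' : is_cond_exp P Y U Z -> is_cond_exp P Y U Z' ->
  {ae P, forall w, Z w = Z' w}.
Proof.
move=> h h'; apply: filterS2 (cond_exp_le h h') (cond_exp_le h' h) => w z z'.
by apply/le_anti; rewrite z z'.
Qed.

Lemma cond_expE Z : is_cond_exp P Y U Z ->
  is_cond_exp P Y U (cond_exp P Y U) /\ {ae P, forall w, cond_exp P Y U w = Z w}.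
Proof.
move=> h; have h' : is_cond_exp P Y U (cond_exp P Y U).
  by rewrite /cond_exp; case: xgetP => [//|/(_ Z)]; exact.
by split=> //; exact: cond_exp_unique.
Qed.

End conditional_expectation.

(** * Information and error covariance of the test channel *)

Section test_channel.
Context d (T : measurableType d) (R : realType) (P : probability T R) (k : nat).
Context (S Q : 'M[R]_k) (SQ : S = Q *m Q^T) (Qu : Q \in unitmx).
Context (X Y : {RV P >-> k.-tuple R}).
Hypotheses (XS : gaussian X S) (YS : gaussian Y S) (XY : independent2 P X Y).
Context (l : 'rV[R]_k) (l01 : forall i, 0 <= l 0 i <= 1).

Let x (i : 'I_k) w := whiten Q (X w) i 0.
Let y (i : 'I_k) w := whiten Q (Y w) i 0.
Let mx i : measurable_fun setT (x i). Proof. exact: measurable_whiten_RV. Qed.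
Let my i : measurable_fun setT (y i). Proof. exact: measurable_whiten_RV. Qed.
Let a i := Num.sqrt (1 - l 0 i).
Let b i := Num.sqrt (l 0 i).
Let a2 i : a i ^+ 2 = 1 - l 0 i.
Proof. by rewrite sqr_sqrtr// subr_ge0; case/andP: (l01 i). Qed.
Let b2 i : b i ^+ 2 = l 0 i.
Proof. by rewrite sqr_sqrtr//; case/andP: (l01 i). Qed.

Let v := channel_output Q X Y l.
Let vE i w : v w i 0 = a i * x i w + b i * y i w. Proof. by rewrite mxE. Qed.

(* The error of estimating x from v, normalized to unit variance: together with
   v it is obtained from (x, y) by a rotation. *)
Definition channel_error (w : T) : 'cV[R]_k := \col_i (b i * x i w - a i * y i w).

Let mv i : measurable_fun setT (fun w => v w i 0).
Proof.
under eq_fun do rewrite vE.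
by apply: measurable_funD; apply: measurable_funM.
Qed.

(** The addition formula and independence, with sines written as cosines shifted by pi / 2. The sine
    term drops out because the sine integral of the form in [X] vanishes. *)
Lemma normal_cos_pair (s r : 'I_k -> R) (t : R) :
  (\int[P]_w cos (\sum_i s i * x i w + (\sum_i r i * y i w + t)) =
    cos t * std_cos (\sum_i (s i ^+ 2 + r i ^+ 2)))%R.
Proof.
have lin (Z : {RV P >-> k.-tuple R}) (q : 'I_k -> R) : gaussian Z S -> forall u,
    bounded_measurable (fun z : k.-tuple R => cos (\sum_i q i * whiten Q z i 0 + u)) /\
    (\int[P]_w cos (\sum_i q i * whiten Q (Z w) i 0 + u) = cos u * std_cos (\sum_i q i ^+ 2))%R.
  move=> ZS u; split.
    apply: bmf_cos_comp.
    exact: (@measurable_linear_form _ _ R _ (fun i z => whiten Q z i 0) q xpredT u (measurable_whiten Q)).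
  pose qv : 'cV[R]_k := \col_i q i.
  have e w : \sum_j q j * whiten Q (Z w) j 0 = (((invmx Q)^T *m qv)^T *m vec (Z w)) 0 0.
    rewrite trmx_mul trmxK -mulmxA -/(whiten _ _) lin_formE.
    by apply: eq_bigr => j _; rewrite [qv _ _]mxE.
  under eq_Rintegral do rewrite e.
  rewrite (gaussian_cos _ _ ZS); congr (_ * std_cos _).
  rewrite /quad SQ trmx_mul trmxK !mulmxA mulmxKV// -(mulmxA _ Q^T) -trmx_mul mulVmx//.
  by rewrite trmx1 mulmx1 lin_formE; apply: eq_bigr => j _; rewrite !mxE expr2.
have [bx0 ex0] := lin X s XS 0; have [by0 ey0] := lin Y r YS t.
have [bx1 ex1] := lin X s XS (- (pi / 2)); have [by1 ey1] := lin Y r YS (t - pi / 2).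
have sin_cos (z : R) : sin z = cos (z - pi / 2) by rewrite cosB cos_pihalf sin_pihalf mulr0 mulr1 add0r.
have e w : cos (\sum_i s i * x i w + (\sum_i r i * y i w + t)) =
    cos (\sum_i s i * x i w + 0) * cos (\sum_i r i * y i w + t) +
    (-1) * (cos (\sum_i s i * x i w + - (pi / 2)) * cos (\sum_i r i * y i w + (t - pi / 2))).
  by rewrite cosD addr0 [sin _]sin_cos [X in _ - _ * X]sin_cos -addrA mulN1r.
have cmp (Z : {RV P >-> k.-tuple R}) (h : k.-tuple R -> R) : bounded_measurable h ->
    bounded_measurable (fun w => h (Z w)).
  by move=> bh; apply: bmf_comp bh; exact: measurable_funPT.
under eq_Rintegral do rewrite e.
have b1 := bmfM (cmp X _ bx0) (cmp Y _ by0); have b2' := bmfM (cmp X _ bx1) (cmp Y _ by1).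
rewrite (bmf_RintegralD P b1 (bmfZ (-1) b2')) (bmf_RintegralZ P (-1) b2').
rewrite (independent2_integral XY bx0.1 by0.1 (bmf_integrable P (cmp X _ bx0)) (bmf_integrable P (cmp Y _ by0))).
rewrite (independent2_integral XY bx1.1 by1.1 (bmf_integrable P (cmp X _ bx1)) (bmf_integrable P (cmp Y _ by1))).
rewrite ex0 ey0 ex1 cosN cos_pihalf !mul0r mulr0 addr0 cos0 mul1r.
rewrite big_split/= std_cosD; first by ring.
- by apply: sumr_ge0 => i _; exact: sqr_ge0.
- by apply: sumr_ge0 => i _; exact: sqr_ge0.
Qed.

Definition rotated (j : bool * 'I_k) (w : T) : R :=
  if j.1 then channel_error w j.2 0 else v w j.2 0.

Lemma rotated_iid : iid_normal P rotated.
Proof.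
apply: cramer_wold => [[[] i]|c t]; rewrite /rotated/=.
- under eq_fun do rewrite mxE.
  by apply: measurable_funB; apply: measurable_funM.
- exact: mv.
(* The coefficients [c] pulled back through the rotation of each plane; s_i^2 + r_i^2 is the sum of
   the two squared coefficients, as a_i^2 + b_i^2 = 1. *)
pose s i := c (true, i) * b i + c (false, i) * a i.
pose r i := - c (true, i) * a i + c (false, i) * b i.
have pairE (F : bool * 'I_k -> R) : \sum_j F j = \sum_i (F (true, i) + F (false, i)).
  rewrite big_split/= (eq_bigr (fun j => F (j.1, j.2))) => [|[]//].
  by rewrite -(pair_bigA _ (fun p i => F (p, i)))/= big_bool.
have e w : \sum_j c j * rotated j w + t = \sum_i s i * x i w + (\sum_i r i * y i w + t).
  rewrite pairE addrA -big_split/=; congr (_ + _); apply: eq_bigr => i _.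
  by rewrite /rotated/= vE mxE /s /r; ring.
rewrite -/rotated; under eq_Rintegral do rewrite e.
rewrite normal_cos_pair pairE; congr (_ * std_cos _); apply: eq_bigr => i _.
have h : a i ^+ 2 + b i ^+ 2 = 1 by rewrite a2 b2 subrK.
rewrite /s /r -[c (true, i) ^+ 2]mulr1 -[c (false, i) ^+ 2]mulr1 -h; ring.
Qed.

Lemma channel_output_iid : iid_normal P (fun i w => v w i 0).
Proof.
apply/iid_normalP => // A mA; have /iid_normalP h := rotated_iid.
have mA' j : measurable (if j.1 then setT else A j.2 : set R) by case: ifP.
have := h rotated_iid.1 (fun j => if j.1 then setT else A j.2) mA'.
rewrite (eq_bigr (fun j : bool * 'I_k => fine (gauss (0 : R) 1 (if (j.1, j.2).1 then setT else A (j.1, j.2).2)))) => [|[]//].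
rewrite -(pair_bigA _ (fun p i => fine (gauss (0 : R) 1 (if p then setT else A i))))/= big_bool/=.
rewrite big1 ?mul1r => [<-|i _]; last by rewrite probability_setT.
congr (P _); apply/seteqP; split=> w /= h' => [[[] i]//=|i].
exact: (h' (false, i)).
Qed.

(** Dividing the unit-variance output by sqrt (1 - l) makes it x plus noise. At l = 1 this noise
    would be infinite; the value 0 drops the coordinate and keeps [gain_mul] true for every l. *)
Let gain i := if l 0 i < 1 then (a i)^-1 else 0.

Let gain_mul i : (1 - l 0 i) * gain i = a i.
Proof.
rewrite /gain; case: ltP => [l1|l1].
  by rewrite -a2 expr2 mulfK// gt_eqF// sqrtr_gt0 subr_gt0.
have e : l 0 i = 1 by apply/le_anti; rewrite l1 andbT; case/andP: (l01 i).
by rewrite mulr0 /a e subrr sqrtr0.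
Qed.

Let G := Q *m diag_mx (\row_i gain i).

Definition test_output (w : T) : k.-tuple R := tuple_of (G *m v w).

Lemma measurable_test_output : measurable_fun setT test_output.
Proof. by apply: (measurable_tuple_of (f := fun w => G *m v w)); exact: measurable_mulmx_col. Qed.

HB.instance Definition _ :=
  isMeasurableFun.Build _ _ _ _ test_output measurable_test_output.

Let amplify (z : k.-tuple R) : k.-tuple R := tuple_of (G *m whiten Q z).

Let measurable_amplify : measurable_fun setT amplify.
Proof.
apply: (measurable_tuple_of (f := fun z => G *m whiten Q z)); apply: measurable_mulmx_col => i.
exact: measurable_whiten.
Qed.

(** A decoupled copy of the output: it has the same law, because the unit-variance output and the
    whitened [Y] are both standard normal, but it is independent of [X]. The law of (X, Ut) is
    therefore the product of the marginals. *)
Let Ut w := amplify (Y w).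

Let mUt : measurable_fun setT Ut.
Proof. by apply: measurableT_comp => //; exact: measurable_funPT. Qed.

HB.instance Definition _ := isMeasurableFun.Build _ _ _ _ Ut mUt.

Let whiten_output i w : whiten Q (test_output w) i 0 = gain i * v w i 0.
Proof.
by rewrite /test_output /whiten tuple_ofK /G -mulmxA mulKmx// mul_diag_mx mxE [in LHS]mxE.
Qed.

Let whiten_Ut i w : whiten Q (Ut w) i 0 = gain i * y i w.
Proof.
by rewrite /Ut /amplify {1}/whiten tuple_ofK /G -mulmxA mulKmx// mul_diag_mx mxE [in LHS]mxE.
Qed.

Let output_law (A : set (k.-tuple R)) : measurable A -> P (test_output @^-1` A) = P (Ut @^-1` A).
Proof.
move=> mA.
have mtv : measurable_fun setT (fun w => tuple_of (v w)) by exact: measurable_tuple_of.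
have mty : measurable_fun setT (fun w => tuple_of (whiten Q (Y w))) by exact: measurable_tuple_of.
pose m1 : {measure set k.-tuple R -> \bar R} :=
  measure_function_pushforward__canonical__measure_function_Measure P mtv.
pose m2 : {measure set k.-tuple R -> \bar R} :=
  measure_function_pushforward__canonical__measure_function_Measure P mty.
pose h (z : k.-tuple R) := tuple_of (G *m vec z).
have mh : measurable_fun setT h.
  apply: (measurable_tuple_of (f := fun z => G *m vec z)); apply: measurable_mulmx_col => i.
  by under eq_fun do rewrite mxE; exact: measurable_tnth.
have -> : test_output @^-1` A = (fun w => tuple_of (v w)) @^-1` (h @^-1` A).
  by rewrite /preimage /h; apply/seteqP; split=> w /=; rewrite tuple_ofK.
have -> : Ut @^-1` A = (fun w => tuple_of (whiten Q (Y w))) @^-1` (h @^-1` A).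
  by rewrite /preimage /h; apply/seteqP; split=> w /=; rewrite tuple_ofK.
apply: (tuple_measure_unique (m1 := m1) (m2 := m2)) => [|C mC|].
- by rewrite /m1 /= /pushforward preimage_setT probability_setT ltry.
- rewrite /m1 /m2 /= /pushforward.
  have /iid_normalP hv := channel_output_iid; have /iid_normalP hy := whiten_iid SQ Qu YS.
  transitivity (P [set w | forall i, C i (v w i 0)]).
    by congr (P _); apply/seteqP; split=> w /= h' i; have := h' i; rewrite tnth_mktuple.
  rewrite hv// -hy//.
  by congr (P _); apply/seteqP; split=> w /= h' i; have := h' i; rewrite tnth_mktuple.
- by rewrite -[X in measurable X]setTI; exact: mh.
Qed.

Let XUt : independent2 P X Ut.
Proof.
move=> A B mA mB; apply: (XY (B := amplify @^-1` B)) => //.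
by rewrite -[X in measurable X]setTI; exact: measurable_amplify.
Qed.

(** Given the output u, a whitened coordinate of [X] is N((1 - l) u, l); each factor is the ratio of
    this law to N(0, 1). *)
Let density (z : k.-tuple R * k.-tuple R) : R :=
  \prod_i normal_ratio (l 0 i) ((1 - l 0 i) * whiten Q z.2 i 0) (whiten Q z.1 i 0).

Let density_measurable : measurable_fun setT density.
Proof.
have m1 i : measurable_fun setT (fun z : k.-tuple R * k.-tuple R => whiten Q z.1 i 0).
  exact: (measurableT_comp (measurable_whiten Q i)).
have m2 i : measurable_fun setT (fun z : k.-tuple R * k.-tuple R => whiten Q z.2 i 0).
  exact: (measurableT_comp (measurable_whiten Q i)).
apply: measurable_prod => i _.
apply: measurable_funM => //; apply: measurableT_comp; first exact: measurable_expR.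
apply: measurable_funB; first by apply: measurable_funM => //; exact: measurable_funX.
apply: measurable_funM => //; apply: measurable_funX; apply: measurable_funB => //.
exact: measurable_funM.
Qed.

Let density_law (C : set (k.-tuple R * k.-tuple R)) : (forall i, 0 < l 0 i) -> measurable C ->
  distribution P (pair_RV X test_output) C =
  (\int[distribution P X \x distribution P test_output]_(z in C) (density z)%:E)%E.
Proof.
move=> l0 mC.
pose Phi (z : k.-tuple (R * R)) : k.-tuple R * k.-tuple R :=
  (tuple_of (Q *m \col_i (tnth z i).1), tuple_of (G *m \col_i (tnth z i).2)).
have mPhi : measurable_fun setT Phi.
  have mt i : measurable_fun setT (fun z : k.-tuple (R * R) => tnth z i) by exact: measurable_tnth.
  apply: measurable_fun_pair.
    apply: (measurable_tuple_of (f := fun z : k.-tuple (R * R) => Q *m \col_i (tnth z i).1)).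
    apply: measurable_mulmx_col => i; under eq_fun do rewrite mxE.
    exact: measurableT_comp.
  apply: (measurable_tuple_of (f := fun z : k.-tuple (R * R) => G *m \col_i (tnth z i).2)).
  apply: measurable_mulmx_col => i; under eq_fun do rewrite mxE.
  exact: measurableT_comp.
have mPC : measurable (Phi @^-1` C) by rewrite -[X in measurable X]setTI; exact: mPhi.
have col1 (F : 'I_k -> R * R) : (\col_i (tnth [tuple F i | i < k] i).1 : 'cV[R]_k) = \col_i (F i).1.
  by apply/colP => i; rewrite !mxE tnth_mktuple.
have col2 (F : 'I_k -> R * R) : (\col_i (tnth [tuple F i | i < k] i).2 : 'cV[R]_k) = \col_i (F i).2.
  by apply/colP => i; rewrite !mxE tnth_mktuple.
have QX w : tuple_of (Q *m \col_i x i w) = X w.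
  rewrite -[RHS]vecK [in RHS](vec_whiten Qu); congr (tuple_of (_ *m _)).
  by apply/colP => i; rewrite mxE.
have P1 w : Phi [tuple (x i w, v w i 0) | i < k] = (X w, test_output w).
  rewrite /Phi col1 col2 /= QX; congr (_, tuple_of (_ *m _)).
  by apply/colP => i; rewrite mxE.
have P0 w : Phi [tuple (x i w, y i w) | i < k] = (X w, Ut w).
  rewrite /Phi col1 col2 /= QX; congr (_, tuple_of (_ *m _)).
  by apply/colP => i; rewrite mxE.
have := channel_law SQ Qu YS XY l0 mPC.
have -> : [set w | (Phi @^-1` C) [tuple (whiten Q (X w) i 0, channel_output Q X Y l w i 0) | i < k]] =
    pair_RV X test_output @^-1` C.
  by apply/seteqP; split=> w /=; rewrite P1.
move=> e; transitivity (P (pair_RV X test_output @^-1` C)); first by [].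
rewrite e {e}.
have -> : [set w | (Phi @^-1` C) [tuple (whiten Q (X w) i 0, whiten Q (Y w) i 0) | i < k]] =
    pair_RV X Ut @^-1` C.
  by apply/seteqP; split=> w /=; rewrite P0.
pose F (z : k.-tuple R * k.-tuple R) : \bar R := ((\1_C z : R) * density z)%:E.
have mF : measurable_fun setT F.
  by apply/measurable_EFinP; apply: measurable_funM => //; exact: (bmf_indic R mC).1.
have F0 z : (0 <= F z)%E.
  by rewrite lee_fin mulr_ge0 ?indicE//; apply: prodr_ge0 => i _; exact: normal_ratio_ge0.
transitivity (\int[P]_w F (X w, Ut w))%E.
  rewrite [LHS]integral_mkcond; apply: eq_integral => w _; rewrite /patch /F indicE.
  have -> : (w \in pair_RV X Ut @^-1` C) = ((X w, Ut w) \in C) by [].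
  case: ifPn => _; last by rewrite mul0r.
  rewrite mul1r /density; congr EFin; apply: eq_bigr => i _ /=.
  (* [channel_law] supplies the ratio of output given input, [density] that of input given output;
     the symmetry identifies them. *)
  rewrite whiten_Ut mulrA gain_mul normal_ratioC//.
  by rewrite l0; case/andP: (l01 i).
rewrite (independent2_ge0_integral_pair XUt mF F0).
transitivity (\int[distribution P X]_x0 \int[distribution P test_output]_y0 F (x0, y0))%E.
  apply: eq_integral => u _; apply: eq_measure_integral => A mA _.
  by rewrite /distribution /pushforward; exact/esym/output_law.
rewrite -[LHS](fubini_tonelli1 (m1 := distribution P X) (m2 := distribution P test_output) F)//.
rewrite [RHS]integral_mkcond; apply: eq_integral => z _; rewrite /patch /F indicE.
by case: ifPn => _; rewrite ?mul1r ?mul0r.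
Qed.

Let density_gt0 z : (forall i, 0 < l 0 i) -> 0 < density z.
Proof. by move=> l0; apply: prodr_gt0 => i _; rewrite normal_ratio_expR// expR_gt0. Qed.

(** As x_i - a_i v_i is b_i times the normalized error, the quadratic terms are squares of two
    standard normals with opposite signs; in expectation they cancel and leave - (1/2) sum_i ln
    l_i. *)
Let ln_density w : (forall i, 0 < l 0 i) ->
  ln (density (X w, test_output w)) =
  \sum_i (2^-1 * x i w ^+ 2 + (- 2^-1 * channel_error w i 0 ^+ 2 + - (2^-1 * ln (l 0 i)))).
Proof.
move=> l0; apply: expR_inj; rewrite lnK ?posrE ?density_gt0// expR_sum; apply: eq_bigr => i _ /=.
rewrite whiten_output (mulrA (1 - _)) gain_mul normal_ratio_expR// -/(x i w); congr expR.
have -> : x i w - a i * v w i 0 = b i * channel_error w i 0.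
  rewrite vE mxE; have h : a i ^+ 2 + b i ^+ 2 = 1 by rewrite a2 b2 subrK.
  have e : x i w = x i w * (a i ^+ 2 + b i ^+ 2) by rewrite h mulr1.
  by rewrite {1}e; ring.
rewrite exprMn b2 mulrAC mulfV ?mul1r ?gt_eqF//; ring.
Qed.

(** If some l_i vanishes, the output determines x_i: the joint law lives on a set that is null for
    the product of the marginals, and both sides are +oo. Otherwise the explicit density is used,
    and [ln_density] gives the mean of its logarithm. *)
Lemma mutual_info_test_output :
  mutual_info X test_output = gaussian_rate S (Q *m diag_mx l *m Q^T).
Proof.
have lge0 i : 0 <= l 0 i by case/andP: (l01 i).
rewrite /mutual_info /gaussian_rate.
have [l0|/existsNP[i /negP]] := pselect (forall i, 0 < l 0 i); last first.
  rewrite lt_def lge0 andbT negbK => /eqP li.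
  have -> : \det (Q *m diag_mx l *m Q^T) = 0 by rewrite det_congr (bigD1 i)//= li mul0r mulr0.
  rewrite eqxx /relative_entropy; case: ifPn => // /asboolP /null_content_dominatesP dom; exfalso.
  pose C := [set z : k.-tuple R * k.-tuple R | whiten Q z.1 i 0 = whiten Q z.2 i 0].
  have mC : measurable C.
    have m1 : measurable_fun setT (fun z : k.-tuple R * k.-tuple R => whiten Q z.1 i 0 - whiten Q z.2 i 0).
      by apply: measurable_funB; exact: (measurableT_comp (measurable_whiten Q i)).
    rewrite (_ : C = setT `&` (fun z => whiten Q z.1 i 0 - whiten Q z.2 i 0) @^-1` [set 0]).
      by apply: m1 => //; exact: measurable_set1.
    rewrite setTI; apply/seteqP; split=> z; rewrite /C/=; first by move=> ->; rewrite subrr.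
    by move/eqP; rewrite subr_eq0 => /eqP.
  have xU w : whiten Q (test_output w) i 0 = x i w.
    rewrite whiten_output vE /gain li ltr01 /a /b li subr0 sqrtr1 sqrtr0 invr1.
    by rewrite !mul1r mul0r addr0.
  have nC : (distribution P X \x distribution P test_output)%E C = 0%E.
    apply: integral0_eq => z _; rewrite /= /distribution /pushforward.
    rewrite (_ : test_output @^-1` _ = [set w | x i w = whiten Q z i 0]).
      exact: (iid_normal_point i (whiten Q z i 0) (whiten_iid SQ Qu XS)).
    apply/seteqP; split=> w /=; rewrite /xsection/=.
      by move/set_mem; rewrite /C/= xU => ->.
    by move=> xw; apply/mem_set; rewrite /C/= xU.
  have : P (pair_RV X test_output @^-1` C) = 0%E := dom C mC nC.
  have -> : pair_RV X test_output @^-1` C = setT.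
    by apply/seteqP; split=> // w _; rewrite /C /preimage /pair_RV/= xU.
  rewrite probability_setT.
  by move/eqP; rewrite onee_eq0.
have dK : \det (Q *m diag_mx l *m Q^T) != 0.
  rewrite det_congr mulf_neq0 ?gt_eqF ?prodr_gt0//.
  by have := posdef_det Qu SQ; rewrite SQ det_mulmx det_tr -expr2.
rewrite (negbTE dK) (@relative_entropy_density _ _ _ _ _ density)//; last 2 first.
- by move=> z; exact: density_gt0.
- by move=> C mC; exact: density_law.
have mln : measurable_fun setT (fun z => (ln (density z))%:E).
  by apply/measurable_EFinP; apply: measurableT_comp => //; exact: measurable_ln.
have sq1 : (\int[gauss (0 : R) 1]_x (x ^+ 2)%:E = 1%:E)%E by exact: integral_std_sqr.
have sq (J : finType) (W : J -> T -> R) j : iid_normal P W ->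
    P.-integrable setT (EFin \o (fun w => W j w ^+ 2)) /\ (\int[P]_w (W j w ^+ 2) = 1)%R.
  move=> iid; have e := iid_normal_coord j iid (@measurable_sqr R) (fun x => sqr_ge0 x) sq1.
  have i1 : P.-integrable setT (EFin \o (fun w => W j w ^+ 2)).
    apply: ge0_integrable e => [|w]; last exact: sqr_ge0.
    by apply: measurable_funX; exact: iid.1.
  by split=> //; apply: EFin_inj; rewrite -EFin_Rintegral.
pose t i w := 2^-1 * x i w ^+ 2 + (- 2^-1 * channel_error w i 0 ^+ 2 + - (2^-1 * ln (l 0 i))).
have t1 i : P.-integrable setT (EFin \o t i) /\ (\int[P]_w t i w = - (2^-1 * ln (l 0 i)))%R.
  have [ix ex] := sq _ _ i (whiten_iid SQ Qu XS).
  have [ie ee] := sq _ _ (true, i) rotated_iid.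
  have ic : P.-integrable setT (EFin \o (fun _ : T => - (2^-1 * ln (l 0 i)))).
    exact: bmf_integrable (bmf_cst _ _).
  have i2 := integrableDr (integrableZr (- 2^-1) ie) ic.
  split; first exact: integrableDr (integrableZr _ ix) i2.
  rewrite RintegralD//; last exact: integrableZr.
  rewrite RintegralZl// ex RintegralD//; last exact: integrableZr.
  by rewrite RintegralZl// ee Rintegral_prob_cst; ring.
have [it et] := Rintegral_sum (index_enum 'I_k) (fun i => (t1 i).1).
have lnE : (fun w => ln (density (X w, test_output w))) = (fun w => \sum_i t i w).
  by apply/funext => w; exact: ln_density.
rewrite [LHS]integral_pushforward//=; last first.
  rewrite preimage_setT (_ : _ \o _ = EFin \o (fun w => ln (density (X w, test_output w))))//.
  by rewrite lnE.
rewrite preimage_setT.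
transitivity (\int[P]_w (\sum_i t i w)%:E)%E.
  by apply: eq_integral => w _ /=; rewrite -[in RHS]/((fun w => \sum_i t i w) w) -lnE.
rewrite (EFin_Rintegral it) et ln_det_ratio//; congr EFin.
rewrite (eq_bigr _ (fun i _ => (t1 i).2)) sumrN mulrN; congr (- _).
by rewrite mulr_sumr.
Qed.

Let rotated_rectangle (A C : 'I_k -> set R) :
  (forall i, measurable (A i)) -> (forall i, measurable (C i)) ->
  P [set w | (forall i, A i (channel_error w i 0)) /\ (forall i, C i (v w i 0))] =
  ((\prod_i fine (gauss (0 : R) 1 (A i))) * \prod_i fine (gauss (0 : R) 1 (C i)))%:E.
Proof.
move=> mA mC; have /iid_normalP h := rotated_iid.
have := h rotated_iid.1 (fun j => if j.1 then A j.2 else C j.2).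
have mAC (j : bool * 'I_k) : measurable (if j.1 then A j.2 else C j.2) by case: ifP.
move=> /(_ mAC); rewrite (eq_bigr (fun j : bool * 'I_k =>
  fine (gauss (0 : R) 1 (if (j.1, j.2).1 then A (j.1, j.2).2 else C (j.1, j.2).2)))) => [|[]//].
rewrite -(pair_bigA _ (fun p i => fine (gauss (0 : R) 1 (if p then A i else C i))))/= big_bool/= => <-.
congr (P _); apply/seteqP; split=> w /= => [[h1 h2] [[] i]|h'].
- exact: h1.
- exact: h2.
by split=> i; [exact: (h' (true, i))|exact: (h' (false, i))].
Qed.

Let vt (w : T) : k.-tuple R := tuple_of (v w).

Let mvt : measurable_fun setT vt.
Proof. exact: measurable_tuple_of. Qed.

HB.instance Definition _ := isMeasurableFun.Build _ _ _ _ vt mvt.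

Let error_j (j : 'I_k) (w : T) : R := channel_error w j 0.

Let merror j : measurable_fun setT (error_j j).
Proof. exact: (rotated_iid.1 (true, j)). Qed.

HB.instance Definition _ j := isMeasurableFun.Build _ _ _ _ (error_j j) (merror j).

Let error_independent j : independent2 P (error_j j) vt.
Proof.
move=> A B mA mB; have mEA : measurable (error_j j @^-1` A).
  by rewrite -[X in measurable X]setTI; exact: merror.
have p0 : 0 <= fine (P (error_j j @^-1` A)) by rewrite fine_ge0.
have pE : P (error_j j @^-1` A) = (fine (P (error_j j @^-1` A)))%:E by rewrite fineK// fin_num_measure.
pose m1 : {measure set k.-tuple R -> \bar R} :=
  measure_function_pushforward__canonical__measure_function_Measure (mrestr P mEA) mvt.
pose m2 : {measure set k.-tuple R -> \bar R} := mscale (NngNum p0)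
  (measure_function_pushforward__canonical__measure_function_Measure P mvt).
suff : m1 B = m2 B by rewrite /m1 /m2 /= /mscale /= /pushforward /mrestr /= -pE setIC.
apply: tuple_measure_unique => //.
  rewrite /m1 /= /pushforward /mrestr /= preimage_setT setTI.
  exact: le_lt_trans (probability_le1 _ mEA) (ltry 1).
move=> C mC; rewrite /m1 /m2 /= /mscale /= /pushforward /mrestr /=.
pose A' (i : 'I_k) : set R := if i == j then A else setT.
have mA' i : measurable (A' i) by rewrite /A'; case: ifP.
have A'E w : (forall i, A' i (channel_error w i 0)) <-> A (error_j j w).
  split=> [/(_ j)|Aw i]; rewrite /A' ?eqxx//.
  by case: eqP => // ->.
have vE' w : (forall i, C i (tnth (tuple_of (v w)) i)) <-> (forall i, C i (v w i 0)).
  by split=> h i; have := h i; rewrite tnth_mktuple.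
have -> : vt @^-1` [set z | forall i, C i (tnth z i)] `&` error_j j @^-1` A =
    [set w | (forall i, A' i (channel_error w i 0)) /\ (forall i, C i (v w i 0))].
  by apply/seteqP; split=> w /=; rewrite A'E vE' => -[].
have -> : error_j j @^-1` A =
    [set w | (forall i, A' i (channel_error w i 0)) /\ (forall i, setT (v w i 0))].
  by apply/seteqP; split=> w /=; [rewrite -A'E|rewrite A'E => -[]].
have -> : vt @^-1` [set z | forall i, C i (tnth z i)] =
    [set w | (forall i, setT (channel_error w i 0)) /\ (forall i, C i (v w i 0))].
  by apply/seteqP; split=> w /=; rewrite vE' => // -[].
rewrite (rotated_rectangle mA' mC) (rotated_rectangle mA' (fun _ => measurableT)).
rewrite (rotated_rectangle (fun _ => measurableT) mC) -EFinM; congr EFin.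
by rewrite [X in _ * X * _]big1 ?[X in _ * (X * _)]big1 => [|i _|i _]; rewrite ?probability_setT// mulr1 mul1r.
Qed.

Let whiten_mean (Z : {RV P >-> k.-tuple R}) i : gaussian Z S ->
  P.-integrable setT (EFin \o (fun w => whiten Q (Z w) i 0)) /\
  (\int[P]_w whiten Q (Z w) i 0 = 0)%R.
Proof.
move=> ZS; have iZ j := L2_integrable (gaussian_L2v ZS j).
have [isum esum] := Rintegral_sum (index_enum 'I_k) (fun j => integrableZr (invmx Q i j) (iZ j)).
have e : (fun w => whiten Q (Z w) i 0) = (fun w => \sum_j invmx Q i j * vec (Z w) j 0).
  by apply/funext => w; rewrite mxE.
rewrite e; split=> //; rewrite esum big1// => j _.
by rewrite RintegralZl// (gaussian_mean ZS) mulr0.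
Qed.

Let error_mean j : P.-integrable setT (EFin \o error_j j) /\ (\int[P]_w error_j j w = 0)%R.
Proof.
have [ix ex] := whiten_mean j XS; have [iy ey] := whiten_mean j YS.
have e : error_j j = (fun w => b j * x j w + (- a j) * y j w).
  by apply/funext => w; rewrite /error_j mxE mulNr.
rewrite e; split; first by apply: integrableDr; exact: integrableZr.
rewrite RintegralD//; [|exact: integrableZr|exact: integrableZr].
by rewrite RintegralZl// RintegralZl// ex ey !mulr0 addr0.
Qed.

Let error_cov2 : cov2 P channel_error channel_error = 1%:M.
Proof.
have Lx : L2v P (fun w => whiten Q (X w)) by apply: L2v_mul; exact: gaussian_L2v XS.
have Ly : L2v P (fun w => whiten Q (Y w)) by apply: L2v_mul; exact: gaussian_L2v YS.
have cov1 (Z : {RV P >-> k.-tuple R}) : gaussian Z S ->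
    cov2 P (fun w => whiten Q (Z w)) (fun w => whiten Q (Z w)) = 1%:M.
  move=> ZS; have LZ := gaussian_L2v ZS.
  rewrite cov2_mull ?cov2_mulr//; last exact: L2v_mul.
  by rewrite (gaussian_cov2 ZS) SQ !mulmxA mulVmx// mul1mx -trmx_mul mulVmx// trmx1.
have covxy : cov2 P (fun w => whiten Q (X w)) (fun w => whiten Q (Y w)) = 0.
  apply/matrixP => i j; rewrite !mxE.
  have [ix ex] := whiten_mean i XS; have [iy ey] := whiten_mean j YS.
  have := independent2_integral XY (measurable_whiten Q i) (measurable_whiten Q j) ix iy.
  by rewrite ex mul0r.
pose Db := diag_mx (\row_i b i); pose Da := diag_mx (\row_i - a i).
have e : channel_error = (fun w => Db *m whiten Q (X w) + Da *m whiten Q (Y w)).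
  apply/funext => w; apply/colP => i; rewrite /Db /Da !mul_diag_mx.
  by rewrite [LHS]mxE [RHS]mxE [X in _ = X + _]mxE [X in _ = _ + X]mxE; rewrite ![(\row_ _ _) _ _]mxE mulNr.
have LDx := L2v_mul Db Lx; have LDy := L2v_mul Da Ly.
rewrite e (cov2Dl LDx LDy (L2vD LDx LDy)) (cov2Dr LDx LDx LDy) (cov2Dr LDy LDx LDy).
rewrite (cov2_mull Db Lx LDx) (cov2_mulr Db Lx Lx) (cov2_mull Db Lx LDy) (cov2_mulr Da Ly Lx).
rewrite (cov2_mull Da Ly LDx) (cov2_mulr Db Lx Ly) (cov2_mull Da Ly LDy) (cov2_mulr Da Ly Ly).
rewrite (cov1 _ XS) (cov1 _ YS) covxy -[cov2 P (fun w => whiten Q (Y w)) _]cov2T covxy trmx0.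
rewrite !mul0mx !mulmx0 addr0 add0r !mul1mx !tr_diag_mx !mulmx_diag.
apply/matrixP => i j; rewrite !mxE; case: eqP => [->|_]; last by rewrite !mulr0n addr0.
by rewrite !mulr1n mulrNN -!expr2 a2 b2 addrC subrK.
Qed.

(** This is (S - K) S^-1 for the target error covariance K, the linear minimum mean square error
    estimator. *)
Let estimator : 'M[R]_k := Q *m diag_mx (const_mx 1 - l) *m invmx Q.

Let estimate_error w : vec (X w) - estimator *m vec (test_output w) =
  Q *m diag_mx (\row_i b i) *m channel_error w.
Proof.
rewrite (vec_whiten Qu (X w)) /estimator -!mulmxA -mulmxBr; congr (_ *m _).
rewrite -/(whiten Q (test_output w)); apply/colP => i; rewrite !mul_diag_mx.
rewrite [LHS]mxE [X in _ + X]mxE [RHS]mxE [X in _ - X]mxE whiten_output.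
have -> : (const_mx 1 - l) 0 i = 1 - l 0 i by rewrite !mxE.
have -> : (\row_j b j) 0 i = b i by rewrite mxE.
rewrite mulrA gain_mul vE -/(x i w) [channel_error w i 0]mxE.
have h : a i ^+ 2 + b i ^+ 2 = 1 by rewrite a2 b2 subrK.
have e : x i w = x i w * (a i ^+ 2 + b i ^+ 2) by rewrite h mulr1.
by rewrite {1}e; ring.
Qed.

Let L2v_error : L2v P channel_error.
Proof.
move=> i; split; first exact: merror.
have e := iid_normal_coord (true, i) rotated_iid (@measurable_sqr R) (fun x => sqr_ge0 x) (integral_std_sqr R).
apply: (ge0_integrable (c := 1)) => [|w|]; [|exact: sqr_ge0|exact: e].
by apply: measurable_funX; exact: merror.
Qed.

(** The remaining error is a linear image of [channel_error], whose coordinates are centered and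
    independent of [vt]; and each event generated by the output is an event of [vt]. *)
Let test_output_cond_exp i : is_cond_exp P (fun w => tnth (X w) i) test_output
  (fun w => (estimator *m vec (test_output w)) i 0).
Proof.
pose phi (u : k.-tuple R) := (estimator *m vec u) i 0.
have mphi : measurable_fun setT phi.
  apply: measurable_mulmx_col => j; under eq_fun do rewrite mxE; exact: measurable_tnth.
have LX := gaussian_L2v XS.
pose M := Q *m diag_mx (\row_j b j).
have LE : L2v P (fun w => M *m channel_error w) by exact: L2v_mul.
have estE w : phi (test_output w) = vec (X w) i 0 - (M *m channel_error w) i 0.
  have := congr1 (fun z : 'cV[R]_k => z i 0) (estimate_error w).
  by rewrite /= -/M [LHS]mxE [X in _ + X]mxE -/(phi _) => <-; rewrite opprB addrC subrK.
have iX := L2_integrable (LX i); have iE := L2_integrable (LE i).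
have iest : P.-integrable setT (EFin \o (fun w => phi (test_output w))).
  have := L2_integrable (L2vB LX LE i).
  by congr (P.-integrable _ (EFin \o _)); apply/funext => w; rewrite estE [LHS]mxE [X in _ + X]mxE.
split=> [B mB|//|_ [B mB <-]].
  exists (phi @^-1` B); last by rewrite setTI.
  by rewrite -[X in measurable X]setTI; exact: mphi.
rewrite setTI; have mUB : measurable (test_output @^-1` B).
  by rewrite -[X in measurable X]setTI; exact: measurable_test_output.
have iS (F : T -> R) : P.-integrable setT (EFin \o F) ->
    P.-integrable (test_output @^-1` B) (EFin \o F) by move=> iF; apply: integrableS iF.
have XE : (fun w => (tnth (X w) i)%:E) = (fun w => (phi (test_output w))%:E + ((M *m channel_error w) i 0)%:E)%E.
  by apply/funext => w; rewrite -EFinD estE subrK mxE.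
rewrite XE integralD//; try exact: iS.
suff -> : (\int[P]_(w in test_output @^-1` B) ((M *m channel_error w) i 0)%:E = 0)%E by rewrite adde0.
pose h (z : k.-tuple R) := tuple_of (G *m vec z).
have mh : measurable_fun setT h.
  apply: (measurable_tuple_of (f := fun z => G *m vec z)); apply: measurable_mulmx_col => j.
  by under eq_fun do rewrite mxE; exact: measurable_tnth.
have mhB : measurable (h @^-1` B) by rewrite -[X in measurable X]setTI; exact: mh.
have bI := bmf_indic R mhB.
have bI' : bounded_measurable (fun w => \1_(h @^-1` B) (vt w) : R) by apply: bmf_comp bI.
have Ie j : (\int[P]_w (error_j j w * (\1_(h @^-1` B) (vt w) : R)) = 0)%R.
  have [ie ee] := error_mean j.
  rewrite (independent2_integral (error_independent j) (f := id) (g := \1_(h @^-1` B)))//.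
  - by rewrite ee mul0r.
  - exact: (bmf_integrable P bI').
have iIe j : P.-integrable setT (EFin \o (fun w => error_j j w * (\1_(h @^-1` B) (vt w) : R))).
  by apply: L2_mul_integrable; [exact: L2v_error|exact: L2_bmf].
have [iS' eS'] := Rintegral_sum (index_enum 'I_k) (fun j => integrableZr (M i j) (iIe j)).
transitivity (\int[P]_w (\sum_j M i j * (error_j j w * (\1_(h @^-1` B) (vt w) : R)))%:E)%E.
  rewrite [LHS]integral_mkcond; apply: eq_integral => w _; rewrite /patch.
  have -> : (w \in test_output @^-1` B) = (vt w \in h @^-1` B).
    have -> : test_output @^-1` B = vt @^-1` (h @^-1` B); last by [].
    by rewrite /preimage /h /vt; apply/seteqP; split=> w' /=; rewrite tuple_ofK.
  rewrite indicE; case: ifPn => _; last by rewrite big1// => j _; rewrite !mulr0.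
  by rewrite mxE; congr EFin; apply: eq_bigr => j _; rewrite mulr1.
rewrite (EFin_Rintegral iS') eS' big1// => j _.
by rewrite RintegralZl// Ie mulr0.
Qed.

(** [cond_exp] is an arbitrary choice among versions, so the explicit estimator replaces it almost
    surely, inside the expectation. *)
Lemma mmse_cov_test_output : mmse_cov X test_output = Q *m diag_mx l *m Q^T.
Proof.
pose M := Q *m diag_mx (\row_j b j).
have LE : L2v P (fun w => M *m channel_error w) by exact: L2v_mul.
have covE : cov2 P (fun w => M *m channel_error w) (fun w => M *m channel_error w) =
    Q *m diag_mx l *m Q^T.
  rewrite cov2_mull ?cov2_mulr// error_cov2 mul1mx /M trmx_mul tr_diag_mx !mulmxA.
  rewrite -(mulmxA Q) mulmx_diag; congr (_ *m diag_mx _ *m _).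
  by apply/rowP => i; rewrite !mxE -expr2 b2.
rewrite -covE; apply/matrixP => i j; rewrite mxE [RHS]mxE unlock /Rintegral; congr fine.
have [ci aei] := cond_expE (test_output_cond_exp i).
have [cj aej] := cond_expE (test_output_cond_exp j).
have mX p : measurable_fun setT (fun w => tnth (X w) p) by exact: measurable_tnth_RV.
have mc p : is_cond_exp P (fun w => tnth (X w) p) test_output
    (cond_exp P (fun w => tnth (X w) p) test_output) ->
    measurable_fun setT (cond_exp P (fun w => tnth (X w) p) test_output).
  by move=> [_ iZ _]; apply/measurable_EFinP; exact: measurable_int iZ.
apply: ae_eq_integral => //.
- apply/measurable_EFinP; apply: measurable_funM; apply: measurable_funB => //; exact: mc.
- by apply/measurable_EFinP; apply: measurable_funM; [exact: (LE i).1|exact: (LE j).1].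
apply: filterS2 aei aej => w ei ej _ /=; congr EFin.
have err p : tnth (X w) p - (estimator *m vec (test_output w)) p 0 = (M *m channel_error w) p 0.
  by rewrite -estimate_error [RHS]mxE [X in _ = X + _]mxE [X in _ = _ + X]mxE.
by rewrite ei ej !err.
Qed.

End test_channel.

Section linear_image.
Context d (T : measurableType d) (R : realType) (P : probability T R) (k : nat).
Context (Y : {RV P >-> k.-tuple R}) (M : 'M[R]_k).

Definition linear_map (y : k.-tuple R) : k.-tuple R := tuple_of (M *m vec y).

Lemma measurable_linear_map : measurable_fun setT linear_map.
Proof.
apply: (measurable_tuple_of (f := fun z => M *m vec z)); apply: measurable_mulmx_col => i.
by under eq_fun do rewrite mxE; exact: measurable_tnth.
Qed.

Definition linear_image (w : T) : k.-tuple R := linear_map (Y w).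

Lemma measurable_linear_image : measurable_fun setT linear_image.
Proof. by apply: measurableT_comp measurable_linear_map _; exact: measurable_funPT. Qed.

HB.instance Definition _ :=
  isMeasurableFun.Build _ _ _ _ linear_image measurable_linear_image.

Lemma gaussian_linear_image S : gaussian Y S -> gaussian (linear_image : {RV P >-> k.-tuple R}) (M *m S *m M^T).
Proof.
move=> [[St Sp] Yg].
have qE a : quad (M *m S *m M^T) a = quad S (M^T *m a).
  by rewrite /quad trmx_mul trmxK !mulmxA.
split; first split.
- by rewrite !trmx_mul trmxK St mulmxA.
- by move=> a; rewrite qE.
move=> a A mA; rewrite qE -Yg//; congr (P _); apply/seteqP.
by split=> w /=; rewrite /linear_image /linear_map tuple_ofK trmx_mul trmxK mulmxA.
Qed.

Lemma independent_linear_image (X : {RV P >-> k.-tuple R}) :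
  independent2 P X Y -> independent2 P X linear_image.
Proof.
move=> XY A B mA mB; rewrite -[linear_image @^-1` B]/(Y @^-1` (linear_map @^-1` B)).
by apply: XY => //; rewrite -[X in measurable X]setTI; exact: measurable_linear_map.
Qed.

End linear_image.

Section gaussian_test_channel.
Context d (T : measurableType d) (R : realType) (P : probability T R) (k : nat).
Context (S K : 'M[R]_k) (X Y : {RV P >-> k.-tuple R}).
Hypotheses (pS : posdef S) (K0 : psd K) (KS : psd (S - K)).
Hypotheses (XS : gaussian X S) (YS : gaussian Y S) (XY : independent2 P X Y).

(* In a direction where K and S agree the channel must carry no information:
   there the noise would be infinite, so the direction is projected away. *)
Lemma gaussian_test_channel_exists :
  exists (Q SZ : 'M[R]_k) (Z U : {RV P >-> k.-tuple R}),
    [/\ Q *m Q = Q /\ (loewner_lt K S -> Q = 1%:M),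
        gaussian Z SZ, independent2 P X Z,
        forall w, vec (U w) = Q *m (vec (X w) + vec (Z w)) &
        mutual_info X U = gaussian_rate S K /\ mmse_cov X U = K].
Proof.
have [Q [l [Qu SQ KQ]]] := simultaneous_diagonalization pS K0.1.
have SKE : S - K = Q *m diag_mx (const_mx 1 - l) *m Q^T.
  have -> : diag_mx (const_mx 1 - l) = 1%:M - diag_mx l :> 'M[R]_k.
    by rewrite -diag_const_mx; apply/matrixP => p q; rewrite !mxE -mulrnBl.
  by rewrite mulmxBr mulmxBl mulmx1 -SQ -KQ.
have l01 i : 0 <= l 0 i <= 1.
  apply/andP; split; first by move: i; apply: (diag_congr_psd Qu); rewrite -KQ.
  have : psd (Q *m diag_mx (const_mx 1 - l) *m Q^T) by rewrite -SKE.
  by move/(diag_congr_psd Qu)/(_ i); rewrite !mxE subr_ge0.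
pose g i := if l 0 i < 1 then (Num.sqrt (1 - l 0 i))^-1 else 0.
(* The projection onto the directions with l_i < 1; when K is strictly below S these are all
   directions. *)
pose J := Q *m diag_mx (\row_i (l 0 i < 1)%R%:R) *m invmx Q.
(* In whitened coordinates the noise has variance sigma^2 = l / (1 - l), for which observing x plus
   noise leaves the error variance sigma^2 / (1 + sigma^2) = l. *)
pose M := Q *m diag_mx (\row_i (Num.sqrt (l 0 i) * g i)) *m invmx Q.
exists J, (M *m S *m M^T), (linear_image Y M : {RV P >-> k.-tuple R}), (test_output Q X Y l : {RV P >-> k.-tuple R}).
split.
- split.
    rewrite /J !mulmxA mulmxKV// -(mulmxA Q) mulmx_diag; congr (_ *m diag_mx _ *m _).
    by apply/rowP => i; rewrite !mxE -natrM mulnb andbb.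
  rewrite /loewner_lt SKE => /(diag_congr_posdef Qu) h.
  have -> : J = Q *m diag_mx (const_mx 1) *m invmx Q.
    congr (_ *m diag_mx _ *m _); apply/rowP => i; have := h i; rewrite !mxE subr_gt0 => ->.
    by [].
  by rewrite diag_const_mx mulmx1 mulmxV.
- exact: gaussian_linear_image.
- exact: independent_linear_image.
- move=> w; rewrite /test_output /linear_image /linear_map !tuple_ofK.
  rewrite (vec_whiten Qu (X w)) /M -!mulmxA -/(whiten Q (Y w)) -mulmxDr /J -?mulmxA mulKmx//.
  congr (_ *m _); apply/colP => i; rewrite !mul_diag_mx.
  rewrite [LHS]mxE [RHS]mxE [X in _ = _ * X]mxE [X in _ = _ * (_ + X)]mxE.
  rewrite ![(\row_ _ _) _ _]mxE [channel_output _ _ _ _ _ _ _]mxE /g.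
  case: ifPn => l1; last by rewrite !mul0r.
  have a0 : Num.sqrt (1 - l 0 i) != 0 by rewrite gt_eqF// sqrtr_gt0 subr_gt0.
  by rewrite mul1r; field.
- by split; rewrite KQ; [exact: (mutual_info_test_output SQ Qu XS YS XY l01)|exact: (mmse_cov_test_output SQ Qu XS YS XY l01)].
Qed.

End gaussian_test_channel.

Lemma independent_seq2 d (T : measurableType d) (R : realType) (P : probability T R)
    d1 (T1 : measurableType d1) (Y : nat -> T -> T1) s t :
  independent_seq P Y -> s != t -> independent2 P (Y s) (Y t).
Proof.
move=> h st A B mA mB; pose C u := if u == s then A else B.
have := h [:: s; t] C _ _; rewrite /= inE st.
have mC u : measurable (C u) by rewrite /C; case: ifP.
move=> /(_ isT mC); rewrite big_cons big_seq1 /C eqxx [t == s]eq_sym (negbTE st) => <-.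
congr (P _); apply/seteqP; split=> w /=.
  by move=> [Aw Bw] u /=; rewrite !inE => /orP[]/eqP ->; rewrite ?eqxx// eq_sym (negbTE st).
move=> hw; split; first by have := hw s; rewrite /= eqxx; apply; rewrite inE eqxx.
by have := hw t; rewrite /= eq_sym (negbTE st); apply; rewrite !inE eqxx orbT.
Qed.

Lemma independent_seq_state d (T : measurableType d) (R : realType) (P : probability T R)
    d1 d2 (T1 : measurableType d1) (T2 : measurableType d2)
    (X : nat -> {RV P >-> T1}) (V : nat -> {RV P >-> T2}) s t :
  independent_seq P (fun u => pair_RV (X u) (V u)) -> s != t -> independent2 P (X s) (X t).
Proof.
move=> h st A B mA mB.
have := independent_seq2 h st (measurableX mA measurableT) (measurableX mB measurableT).
have e u C : pair_RV (X u) (V u) @^-1` (C `*` setT) = X u @^-1` C.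
  by apply/seteqP; split=> w //= [].
by rewrite !e.
Qed.

Theorem theorem1 (R : realType) (k : nat)
    (d : measure_display) (T : measurableType d) (P : probability T R)
    (B SX SV We Wd : 'M[R]_k)
    (X V : nat -> {RV P >-> k.-tuple R})
    (hSX : posdef SX) (hSV : psd SV) (hWe : posdef We) (hWd : posdef Wd)
    (hX : forall t, gaussian (X t) SX)
    (hV : forall t, gaussian (V t) SV)
    (hXV : forall t, independent2 P (X t) (V t))
    (hiid : independent_seq P (fun t => pair_RV (X t) (V t)))
    (De : R) :
  let F := feasible B SX SV We De in
  [/\ strategic_rd X V B We Wd De = ereal_inf [set gaussian_rate SX K | K in F],
      F !=set0 ->
        exists2 K, F K & strategic_rd X V B We Wd De = gaussian_rate SX K &
      forall K, F K ->
        exists (Q SZ : 'M[R]_k) (Z U : {RV P >-> k.-tuple R}),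
          [/\ Q *m Q = Q /\ (loewner_lt K SX -> Q = 1%:M),
              gaussian Z SZ,
              independent2 P (X 0%N) Z,
              forall w, vec (U w) = Q *m (vec (X 0%N w) + vec (Z w)) &
              mutual_info (X 0%N) U = gaussian_rate SX K /\
              mmse_cov (X 0%N) U = K]].
Proof.
move=> F; split.
- exact: (strategic_rdE B hSX hWe.1 hWd hX hV hXV hiid).
- move=> F0; rewrite (strategic_rdE B hSX hWe.1 hWd hX hV hXV hiid).
  exact: (gaussian_rate_attained hSX hWe.1 hWd hX hV hXV hiid F0).
(* X 1 supplies the randomness of the test channel noise. *)
- move=> K [K0 KS _]; rewrite /loewner_le subr0 in K0.
  by apply: (gaussian_test_channel_exists hSX K0 KS (hX 0%N) (hX 1%N)); exact: (independent_seq_state hiid).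
Qed.
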